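(* Let $K$ be a field, $S=K[x_1,\ldots,x_n]$, and let $\Delta$ be a pure simplicial complex on $[n]$ with $\operatorname{depth}(K[\Delta])=t$ and $I_\Delta=\bigcap_{F\in\mathcal{F}(\Delta)}P_F$. The following statements are equivalent: (a) $\Delta$ has rigid depth (over $K$). (b) $\operatorname{depth}(S/I)=t$ for every ideal $I=\bigcap_{F\in\mathcal{F}(\Delta)}I_F$ where the $I_F$ are irreducible monomial ideals with $\sqrt{I_F}=P_F$ for all $F\in\mathcal{F}(\Delta)$. (c) $\operatorname{depth}(S/I)=t$ for every ideal $I=\bigcap_{F\in\mathcal{F}(\Delta)}P_F^{m_F}$ where the $m_F$ are positive integers. (d) $\operatorname{depth}(K[\Gamma])\geq t$ for every (nonempty) subcomplex $\Gamma$ of $\Delta$ with $\mathcal{F}(\Gamma)\subseteq\mathcal{F}(\Delta)$. (e) For every (nonempty) subcomplex $\Gamma$ of $\Delta$ with $\mathcal{F}(\Gamma)\subseteq\mathcal{F}(\Delta)$, the skeleton $\Gamma^{(t-1)}$ is Cohen-Macaulay (over $K$). (f) Writing $\mathcal{F}(\Delta)=\{F_1,\ldots,F_r\}$ (with $r=|\mathcal{F}(\Delta)|$), for every $1\leq k\leq\min\{r,t\}$ and any indices $1\leq i_1<\cdots<i_k\leq r$ we have $|F_{i_1}\cap\cdots\cap F_{i_k}|\geq t-k+1$.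
   Context: For a simplicial complex $\Delta$ on $[n]=\{1,\ldots,n\}$ (not every $i\in[n]$ need be a vertex), $\mathcal{F}(\Delta)$ is its set of facets; $\Delta$ is pure if all facets have the same cardinality. For $F\subseteq[n]$, $P_F=(x_i\mid i\notin F)\subset S$. The Stanley-Reisner ideal is $I_\Delta=\bigcap_{F\in\mathcal{F}(\Delta)}P_F$ and $K[\Delta]=S/I_\Delta$. Simplicial complexes are nonempty (they have at least one facet). The $i$th skeleton is $\Delta^{(i)}=\{F\in\Delta\mid \dim F\leq i\}$, where $\dim F=|F|-1$. A complex $\Gamma$ is Cohen-Macaulay over $K$ if $K[\Gamma]$ is a Cohen-Macaulay ring. An irreducible monomial ideal with radical $P_F$ is an ideal of the form $(x_j^{a_j}\mid j\notin F)$ with positive integers $a_j$. An ideal $I\subset S$ is unmixed if the associated primes of $S/I$ are exactly the minimal primes of $I$. A pure simplicial complex $\Delta$ has rigid depth (over $K$) if for every unmixed monomial ideal $I\subset S$ with $\sqrt{I}=I_\Delta$ one has $\operatorname{depth}(S/I)=\operatorname{depth}(S/I_\Delta)$. The depth is with respect to the graded maximal ideal $(x_1,\ldots,x_n)$. *)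

(* Defs.v *)
From HB Require Import structures.
From mathcomp Require Import all_boot all_order all_algebra.
From mathcomp Require Import mpoly.

Set Implicit Arguments.
Unset Strict Implicit.
Unset Printing Implicit Defensive.

Import GRing.Theory.
Local Open Scope ring_scope.

(* Ideals of R are Prop-valued predicates, since membership in an arbitrary
   ideal of {mpoly K[n]} is not decidable over an abstract field. A quotient
   R/I is handled through I itself: ideals of R/I are the ideals of R that
   contain I. *)

Definition subpred_of (R : Type) (I J : R -> Prop) : Prop :=
  forall x, I x -> J x.

Definition same_pred (R : Type) (I J : R -> Prop) : Prop :=
  forall x, I x <-> J x.

Definition is_ideal (R : comNzRingType) (I : R -> Prop) : Prop :=
  [/\ I 0, forall x y, I x -> I y -> I (x + y) & forall r x, I x -> I (r * x)].

Definition ideal_gen (R : comNzRingType) (A : R -> Prop) : R -> Prop :=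
  fun x => forall J, is_ideal J -> subpred_of A J -> J x.

Definition ideal_exp (R : comNzRingType) (I : R -> Prop) (k : nat) : R -> Prop :=
  ideal_gen (fun x => exists s : seq R,
    [/\ size s = k, forall a, a \in s -> I a & x = \prod_(a <- s) a]).

Definition radical (R : comNzRingType) (I : R -> Prop) : R -> Prop :=
  fun x => exists k : nat, I (x ^+ k).

Definition prime_id (R : comNzRingType) (P : R -> Prop) : Prop :=
  [/\ is_ideal P, ~ P 1 & forall x y, P (x * y) -> P x \/ P y].

Definition maximal_id (R : comNzRingType) (M : R -> Prop) : Prop :=
  [/\ is_ideal M, ~ M 1 &
      forall J, is_ideal J -> subpred_of M J -> ~ J 1 -> subpred_of J M].

Definition minimal_prime (R : comNzRingType) (I P : R -> Prop) : Prop :=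
  [/\ prime_id P, subpred_of I P &
      forall Q, prime_id Q -> subpred_of I Q -> subpred_of Q P ->
        subpred_of P Q].

(* P is the annihilator of the class of some x in R/I. *)
Definition associated_prime (R : comNzRingType) (I P : R -> Prop) : Prop :=
  prime_id P /\ exists x, same_pred P (fun r => I (r * x)).

Definition unmixed (R : comNzRingType) (I : R -> Prop) : Prop :=
  forall P, associated_prime I P <-> minimal_prime I P.

Definition is_max (P : nat -> Prop) (d : nat) : Prop :=
  P d /\ forall e, P e -> (e <= d)%N.

(* I + (s), the kernel of R -> (R/I)/(s)(R/I). *)
Definition ideal_ext (R : comNzRingType) (I : R -> Prop) (s : seq R) :
    R -> Prop :=
  ideal_gen (fun x => I x \/ x \in s).

(* With J s the kernel of R -> Q/(s)Q for a quotient or localization Q of R/I,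
   this says that the images of the elements of s form a Q-regular sequence. *)
Definition regular_for (R : comNzRingType) (J : seq R -> R -> Prop)
    (s : seq R) : Prop :=
  (forall i g, (i < size s)%N -> J (take i s) (s`_i * g) -> J (take i s) g)
  /\ ~ J s 1.

(* depth of R/I with respect to the ideal m: the largest length of an
   R/I-regular sequence in m. *)
Definition depth_wrt (R : comNzRingType) (m I : R -> Prop) (d : nat) : Prop :=
  is_max (fun k => exists s : seq R,
    [/\ size s = k, forall a, a \in s -> m a
      & regular_for (ideal_ext I) s]) d.

(* The preimage in R of J R_M, for a prime M. *)
Definition loc_ideal (R : comNzRingType) (M J : R -> Prop) : R -> Prop :=
  fun f => exists2 u, ~ M u & J (u * f).

(* depth of the local ring (R/I)_M. Every element of its maximal ideal is a
   unit times the image of an element of M, and multiplying by units affects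
   neither regularity nor the ideals generated, so sequences in M suffice. *)
Definition local_depth (R : comNzRingType) (M I : R -> Prop) (d : nat) : Prop :=
  is_max (fun k => exists s : seq R,
    [/\ size s = k, forall a, a \in s -> M a
      & regular_for (fun s' => loc_ideal M (ideal_ext I s')) s]) d.

(* Krull dimension of (R/I)_M: its primes correspond to the primes P of R with
   I contained in P and P contained in M. *)
Definition local_dim (R : comNzRingType) (M I : R -> Prop) (d : nat) : Prop :=
  is_max (fun k => exists p : nat -> R -> Prop,
    [/\ forall i, (i <= k)%N -> prime_id (p i),
        subpred_of I (p 0%N), subpred_of (p k) M
      & forall i, (i < k)%N ->
          subpred_of (p i) (p i.+1) /\ ~ subpred_of (p i.+1) (p i)]) d.

(* R/I is a Cohen-Macaulay ring (for R Noetherian): its localizations at all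
   maximal ideals are Cohen-Macaulay local rings. *)
Definition cohen_macaulay_quo (R : comNzRingType) (I : R -> Prop) : Prop :=
  forall M, maximal_id M -> subpred_of I M ->
    exists2 d, local_depth M I d & local_dim M I d.

Definition monomial_ideal (K : fieldType) (n : nat)
    (I : {mpoly K[n]} -> Prop) : Prop :=
  exists A : 'X_{1..n} -> Prop,
    same_pred I (ideal_gen (fun f => exists2 m, A m & f = 'X_[m])).

Definition graded_max (K : fieldType) (n : nat) : {mpoly K[n]} -> Prop :=
  ideal_gen (fun f => exists i : 'I_n, f = 'X_i).

Definition has_depth (K : fieldType) (n : nat) (I : {mpoly K[n]} -> Prop)
    (d : nat) : Prop :=
  depth_wrt (@graded_max K n) I d.

Definition is_complex (n : nat) (D : {set {set 'I_n}}) : Prop :=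
  D != set0 /\ forall F G : {set 'I_n}, F \in D -> G \subset F -> G \in D.

Definition facets (n : nat) (D : {set {set 'I_n}}) : {set {set 'I_n}} :=
  [set F | maxset (fun G => G \in D) F].

Definition pure (n : nat) (D : {set {set 'I_n}}) : Prop :=
  forall F G, F \in facets D -> G \in facets D -> #|F| = #|G|.

Definition face_dim (n : nat) (F : {set 'I_n}) : int := #|F|%:Z - 1.

Definition skeleton (n : nat) (D : {set {set 'I_n}}) (i : int) :
    {set {set 'I_n}} :=
  [set F in D | face_dim F <= i].

Definition facet_subcomplex (n : nat) (D G : {set {set 'I_n}}) : Prop :=
  [/\ is_complex G, G \subset D & facets G \subset facets D].

Definition face_prime (K : fieldType) (n : nat) (F : {set 'I_n}) :
    {mpoly K[n]} -> Prop :=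
  ideal_gen (fun f => exists2 i : 'I_n, i \notin F & f = 'X_i).

Definition facet_cap (K : fieldType) (n : nat) (D : {set {set 'I_n}})
    (J : {set 'I_n} -> {mpoly K[n]} -> Prop) : {mpoly K[n]} -> Prop :=
  fun f => forall F, F \in facets D -> J F f.

Definition stanley_reisner (K : fieldType) (n : nat) (D : {set {set 'I_n}}) :
    {mpoly K[n]} -> Prop :=
  facet_cap D (@face_prime K n).

(* J is an irreducible monomial ideal with radical face_prime F. *)
Definition irreducible_monomial (K : fieldType) (n : nat) (F : {set 'I_n})
    (J : {mpoly K[n]} -> Prop) : Prop :=
  exists a : 'I_n -> nat,
    (forall j, j \notin F -> (0 < a j)%N) /\
    same_pred J
      (ideal_gen (fun f => exists2 j : 'I_n, j \notin F & f = 'X_j ^+ a j)).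

Definition cohen_macaulay (K : fieldType) (n : nat) (D : {set {set 'I_n}}) :
    Prop :=
  cohen_macaulay_quo (@stanley_reisner K n D).

Definition rigid_depth (K : fieldType) (n : nat) (D : {set {set 'I_n}}) : Prop :=
  forall I : {mpoly K[n]} -> Prop,
    monomial_ideal I -> unmixed I ->
    same_pred (radical I) (stanley_reisner D) ->
    exists2 d, has_depth I d & has_depth (@stanley_reisner K n D) d.

(* Main.v *)
(** Depth is measured by Koszul cohomology: a quotient [S/I] of the polynomial
    ring [S] has a regular sequence of length [k] in an ideal [M = (y)] if and
    only if the cohomology [H^i(y; S/I)] vanishes for all [i < k]. Three
    inequalities then suffice.

    Lower bounds. An intersection of monomial ideals is glued by Mayer-Vietoris
    sequences from the sums of its components. A monomial ideal whose membership
    does not depend on the exponents of the variables of [s] has depth at least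
    [#|s|], and a sum of [P_F]-primary components is of this kind for
    [s := \bigcap_F F]; hence (f) gives depth at least [t] for every unmixed
    monomial ideal with radical [I_D].

    Upper bounds. The map [x_i |-> x_i ^ N] exhibits, for a monomial ideal [I] and
    a monomial [u], the ring [S/rad(I : u)] as a direct summand of [S/I], so that
    [depth S/I <= depth S/rad(I : u)]. With [u = 1] this bounds the depth by [t];
    with [u = x_1 * ... * x_n] and well chosen exponents, (a), (b) and (c) yield
    [depth K[G] >= t] for the complex [G] of any set of facets.

    Conversely, if all these depths are at least [t], the same Mayer-Vietoris
    sequences show that the sum of [k] facet ideals, which is the face prime of
    the intersection of the facets, has depth at least [t - k + 1], and this depth
    is the size of the intersection.

    For (e), a skeleton is glued from simplices, for which the Nullstellensatz
    provides, at every maximal ideal, regular sequences of polynomials in single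
    variables; so the local depths are at least [t]. Depth is at most dimension,
    and dimension is bounded by counting algebraically independent variables
    modulo primes. *)


From HB Require Import structures.
Require Import Defs.
From mathcomp Require Import all_boot all_order all_algebra.
From mathcomp Require Import mpoly boolp zify ring.

Set Implicit Arguments.
Unset Strict Implicit.
Unset Printing Implicit Defensive.

Import Order.TTheory GRing.Theory.
Local Open Scope ring_scope.

(** * Ideals and Koszul cohomology *)

(** No quotient ring enters the cohomology: cochains take values in the ring itself and identities
    hold modulo an ideal. Only vanishing ranges are used, so each exact sequence becomes an explicit
    construction of cochains.

    Regular sequences for two different ideals have nothing in common and cannot be glued;
    primitives of one cocycle modulo two ideals can. Cohomology also makes localization harmless: it
    is killed by the ideal of the [y j], so localizing at a maximal ideal generated by them does not
    change it.

    The same gluing has to work at the graded maximal ideal and, for (e), at every maximal ideal,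
    over a field that need not be algebraically closed. It is therefore done for any [y] whose ideal
    contains, for each variable, a nonzero polynomial in that variable alone.

    Subcomplexes are reached through exponents: in the colon by x_1...x_n, a component generated by
    variables becomes the unit ideal, while one generated by their squares stays proper. *)

Section IdealOperations.

Context (R : comNzRingType).
Implicit Types (I J X Y : R -> Prop) (a u x : R).

Definition sum_ideal X Y : R -> Prop :=
  fun x => exists f g, [/\ X f, Y g & x = f + g].

Definition cap_ideal X Y : R -> Prop := fun x => X x /\ Y x.

Definition adjoin I a : R -> Prop := fun x => exists f r, I f /\ x = f + r * a.

Definition lin_span N (y : 'I_N -> R) : R -> Prop :=
  fun x => exists g : 'I_N -> R, x = \sum_i g i * y i.

Definition regular_mod I a := forall g, I (a * g) -> I g.

Lemma same_predP I J : same_pred I J -> I = J.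
Proof. by move=> h; apply/funext => x; apply/propext. Qed.

Lemma idealMl I r x : is_ideal I -> I x -> I (x * r).
Proof. by move=> [_ _ h] hx; rewrite mulrC; apply: h. Qed.

Lemma idealMr I r x : is_ideal I -> I x -> I (r * x).
Proof. by move=> [_ _ h] hx; apply: h. Qed.

Lemma ideal0 I : is_ideal I -> I 0. Proof. by case. Qed.

Lemma idealD I x y : is_ideal I -> I x -> I y -> I (x + y).
Proof. by move=> [_ h _]; apply: h. Qed.

Lemma idealN I x : is_ideal I -> I x -> I (- x).
Proof. by move=> hI hx; rewrite -mulN1r; apply: idealMr. Qed.

Lemma idealB I x y : is_ideal I -> I x -> I y -> I (x - y).
Proof. by move=> hI hx hy; apply: idealD => //; apply: idealN. Qed.

Lemma idealDr I x y : is_ideal I -> I x -> I (x + y) <-> I y.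
Proof.
move=> hI hx; split=> h; last exact: idealD.
by rewrite -(addKr x y) addrC; apply: idealB.
Qed.

Lemma ideal_sum I (T : Type) (r : seq T) (P : pred T) (F : T -> R) :
  is_ideal I -> (forall i, P i -> I (F i)) -> I (\sum_(i <- r | P i) F i).
Proof.
by move=> hI h; elim/big_rec: _ => [|i x Pi hx]; [apply: ideal0 | apply: idealD; auto].
Qed.

Lemma ideal_sum_mem I (T : eqType) (r : seq T) (F : T -> R) :
  is_ideal I -> (forall i, i \in r -> I (F i)) -> I (\sum_(i <- r) F i).
Proof. by move=> hI h; rewrite big_seq; apply: ideal_sum. Qed.

Lemma adjoin_is_ideal I a : is_ideal I -> is_ideal (adjoin I a).
Proof.
move=> hI; split.
- by exists 0, 0; split; [apply: ideal0 | ring].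
- move=> _ _ [f [r [hf ->]]] [g [s [hg ->]]].
  by exists (f + g), (r + s); split; [apply: idealD | ring].
- move=> t _ [f [r [hf ->]]].
  by exists (t * f), (t * r); split; [apply: idealMr | ring].
Qed.

Lemma adjoin_sub I a x : I x -> adjoin I a x.
Proof. by move=> hx; exists x, 0; split=> //; ring. Qed.

Lemma adjoin_mem I a : is_ideal I -> adjoin I a a.
Proof. by move=> hI; exists 0, 1; split; [apply: ideal0 | ring]. Qed.

Lemma adjoin_min I J a :
  is_ideal J -> subpred_of I J -> J a -> subpred_of (adjoin I a) J.
Proof.
by move=> hJ h ha _ [f [r [hf ->]]]; apply: idealD; [|apply: h|apply: idealMr].
Qed.

Lemma lin_span_is_ideal N (y : 'I_N -> R) : is_ideal (lin_span y).
Proof.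
split.
- by exists (fun=> 0); rewrite big1 // => i _; rewrite mul0r.
- move=> _ _ [g ->] [h ->]; exists (fun i => g i + h i).
  by rewrite -big_split; apply: eq_bigr => i _; rewrite mulrDl.
- move=> r _ [g ->]; exists (fun i => r * g i).
  by rewrite mulr_sumr; apply: eq_bigr => i _; rewrite mulrA.
Qed.

Lemma lin_span_mem N (y : 'I_N -> R) i : lin_span y (y i).
Proof.
exists (fun j => (j == i)%:R); rewrite (bigD1 i) //= eqxx mul1r big1 ?addr0 //.
by move=> j /negPf ->; rewrite mul0r.
Qed.

Lemma lin_span_min N (y : 'I_N -> R) J :
  is_ideal J -> (forall i, J (y i)) -> subpred_of (lin_span y) J.
Proof.
by move=> hJ h _ [g ->]; apply: ideal_sum => // i _; apply: idealMr.
Qed.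

Lemma ideal_gen_is_ideal (A : R -> Prop) : is_ideal (ideal_gen A).
Proof.
split.
- by move=> J hJ _; apply: ideal0.
- by move=> x y hx hy J hJ h; apply: idealD => //; [apply: hx|apply: hy].
- by move=> r x hx J hJ h; apply: idealMr => //; apply: hx.
Qed.

Lemma ideal_gen_sub (A : R -> Prop) x : A x -> ideal_gen A x.
Proof. by move=> hx J _; apply. Qed.

Lemma radical_is_ideal I : is_ideal I -> is_ideal (radical I).
Proof.
move=> hI; split.
- by exists 1%N; rewrite expr1; apply: ideal0.
- move=> x y [k hk] [l hl]; exists (k + l)%N; rewrite exprDn.
  apply: ideal_sum => // i _; rewrite -mulr_natl; apply: idealMr => //.
  have [le_li|lt_il] := leqP l i.
    by apply: idealMr => //; rewrite -(subnK le_li) exprD; apply: idealMr.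
  apply: idealMl => //.
  have -> : (k + l - i = (l - i) + k)%N by lia.
  by rewrite exprD; apply: idealMr.
- by move=> r x [k hk]; exists k; rewrite exprMn; apply: idealMr.
Qed.

End IdealOperations.

Section Koszul.

Context (R : comNzRingType) (N : nat) (y : 'I_N -> R).
Implicit Types (A B : {set 'I_N}) (c b e : {set 'I_N} -> R).

Definition ksgn A (j : 'I_N) : R := (-1) ^+ #|[set i in A | (i < j)%N]|.

(** With [c A] read as the coefficient of e_A in the exterior algebra, this is left multiplication
    by the sum of the y_j e_j. *)
Definition kdiff c B : R := \sum_(j in B) ksgn B j * (y j * c (B :\ j)).

(** The interior product with the dual of e_j. *)
Definition kcontr (j : 'I_N) c A : R :=
  if j \in A then 0 else ksgn A j * c (j |: A).

Lemma ksgn_sqr A j : ksgn A j * ksgn A j = 1.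
Proof. by rewrite -expr2 sqrr_sign. Qed.

Lemma ksgnD1_ge A (i j : 'I_N) : (j <= i)%N -> ksgn (A :\ i) j = ksgn A j.
Proof.
move=> le_ji; congr (_ ^+ _); apply: eq_card => k; rewrite !inE.
by case: (eqVneq k i) => [->|//]; rewrite [RHS]andbC ltnNge le_ji.
Qed.

Lemma ksgnD1_lt A (i j : 'I_N) : i \in A -> (i < j)%N -> ksgn (A :\ i) j = - ksgn A j.
Proof.
move=> iA lt_ij; rewrite /ksgn [X in _ = - (_ ^+ X)](cardsD1 i) inE iA lt_ij.
rewrite exprS mulN1r opprK; congr (_ ^+ _); apply: eq_card => k.
by rewrite !inE andbA.
Qed.

Lemma ksgn_anti B i j : i \in B -> j \in B -> i != j ->
  ksgn B j * ksgn (B :\ j) i = - (ksgn B i * ksgn (B :\ i) j).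
Proof.
wlog lt_ij : i j / (i < j)%N => [th|] iB jB neq_ij.
  have [lt|le] := ltnP i j; first exact: th.
  rewrite (th j i) ?opprK 1?eq_sym //.
  by rewrite ltn_neqAle le andbT eq_sym (inj_eq val_inj).
by rewrite (ksgnD1_lt iB lt_ij) (ksgnD1_ge _ (ltnW lt_ij)); ring.
Qed.

Lemma kdiff_sqr c B : kdiff (kdiff c) B = 0.
Proof.
pose T j i := ksgn B j * ksgn (B :\ j) i * (y j * y i * c (B :\ j :\ i)).
have -> : kdiff (kdiff c) B =
    \sum_(j in B) \sum_(i in B | i != j) T j i.
  apply: eq_bigr => j jB; rewrite /kdiff !mulr_sumr.
  by apply: eq_big => [i|i _]; [rewrite !inE andbC | rewrite /T; ring].
(* The ordered pairs with i < j and those with j < i cancel each other by [ksgn_anti]. *)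
have -> : \sum_(j in B) \sum_(i in B | i != j) T j i =
  \sum_(j in B) \sum_(i in B | (i < j)%N) T j i +
  \sum_(j in B) \sum_(i in B | (j < i)%N) T j i.
  rewrite -big_split; apply: eq_bigr => j jB.
  rewrite (bigID (fun i : 'I_N => (i < j)%N)) /=; congr (_ + _).
    apply: eq_bigl => i; rewrite -(inj_eq val_inj) -andbA /=.
    by case: (ltngtP i j); rewrite ?andbF.
  apply: eq_bigl => i; rewrite -(inj_eq val_inj) -andbA /=.
  by case: (ltngtP i j); rewrite ?andbF.
have -> : \sum_(j in B) \sum_(i in B | (j < i)%N) T j i =
  \sum_(j in B) \sum_(i in B | (i < j)%N) T i j.
  rewrite (exchange_big_dep (fun i => i \in B)) /=; last by move=> ? ? _ /andP[].
  by apply: eq_bigr => j jB; apply: eq_bigl => i; rewrite jB.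
rewrite -big_split /=; apply: big1 => j jB.
rewrite -big_split /=; apply: big1 => i /andP[iB lt_ij].
have nij : i != j by rewrite -(inj_eq val_inj) neq_ltn lt_ij.
rewrite /T (ksgn_anti iB jB nij) !setDDl (setUC [set i]); ring.
Qed.

(** The interior product is an antiderivation, so the mixed terms cancel and only y_j survives. *)
Lemma kcontrP j c B : kdiff (kcontr j c) B + kcontr j (kdiff c) B = y j * c B.
Proof.
rewrite /kcontr; case: ifP => jB.
  rewrite addr0 /kdiff (bigD1 j) //= big1 ?addr0 => [|i /andP[iB nij]].
    rewrite !inE eqxx /= setD1K // ksgnD1_ge //.
    rewrite mulrCA; congr (_ * _).
    by rewrite mulrA ksgn_sqr mul1r.
  by rewrite !inE jB eq_sym nij mulr0 mulr0.
(* For [j] outside [B], the summand that removes [j] again gives y_j c(B); each summand that removes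
   some i in [B] cancels against the first term. *)
rewrite /kdiff [X in _ + _ * X](bigD1 j) /= ?inE ?eqxx // mulrDr.
have BE : (j |: B) :\ j = B.
  by apply/setP => i; rewrite !inE; case: eqP => // ->; rewrite jB.
have sE : ksgn (j |: B) j = ksgn B j by rewrite -{2}BE ksgnD1_ge.
rewrite sE BE mulrA ksgn_sqr mul1r addrCA -[RHS]addr0; congr (_ + _).
rewrite mulr_sumr.
rewrite [X in _ + X](eq_bigl (fun i => i \in B)); last first.
  by move=> i; rewrite /= !inE; case: (eqVneq i j) => [->|_] /=; rewrite ?jB ?andbT.
rewrite -big_split big1 //= => i iB.
have nij : i != j by apply: contraFN jB => /eqP <-.
rewrite !inE jB andbF.
have -> : j |: B :\ i = (j |: B) :\ i.
  apply/setP => k; rewrite !inE; case: (eqVneq k j) => [->|//].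
  by rewrite eq_sym nij.
have iB' : i \in j |: B by rewrite !inE iB orbT.
have jB' : j \in j |: B by rewrite !inE eqxx.
have := ksgn_anti iB' jB' nij; rewrite BE sE.
have -> : ksgn (B :\ i) j = ksgn ((j |: B) :\ i) j.
  have <- : (j |: B) :\ i :\ j = B :\ i.
    by rewrite setDDl [[set i] :|: _]setUC -setDDl BE.
  by rewrite ksgnD1_ge.
move=> h.
have -> : ksgn B i * (y i * (ksgn ((j |: B) :\ i) j * c ((j |: B) :\ i))) +
  ksgn B j * (ksgn (j |: B) i * (y i * c ((j |: B) :\ i))) =
  y i * c ((j |: B) :\ i) *
   (ksgn B i * ksgn ((j |: B) :\ i) j + ksgn B j * ksgn (j |: B) i) by ring.
have -> : ksgn B j * ksgn (j |: B) i =
    ksgn B j * ksgn B i * ksgn B i * ksgn (j |: B) i.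
  by rewrite -[_ * _ * ksgn B i]mulrA ksgn_sqr mulr1.
rewrite h.
have -> : - (ksgn (j |: B) i * ksgn ((j |: B) :\ i) j) * ksgn B i * ksgn (j |: B) i
  = - (ksgn (j |: B) i * ksgn (j |: B) i) * (ksgn ((j |: B) :\ i) j * ksgn B i) by ring.
by rewrite ksgn_sqr; ring.
Qed.

Lemma kdiffD c b B : kdiff (fun A => c A + b A) B = kdiff c B + kdiff b B.
Proof. by rewrite /kdiff -big_split /=; apply: eq_bigr => j _; ring. Qed.

Lemma kdiffB c b B : kdiff (fun A => c A - b A) B = kdiff c B - kdiff b B.
Proof.
rewrite /kdiff -sumrN -big_split /=; apply: eq_bigr => j _; ring.
Qed.

Lemma kdiffZ a c B : kdiff (fun A => a * c A) B = a * kdiff c B.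
Proof. by rewrite /kdiff mulr_sumr; apply: eq_bigr => j _; ring. Qed.

Lemma kdiff_sum (T : Type) (r : seq T) (c : T -> {set 'I_N} -> R) B :
  kdiff (fun A => \sum_(i <- r) c i A) B = \sum_(i <- r) kdiff (c i) B.
Proof.
rewrite /kdiff exchange_big /=; apply: eq_bigr => j _.
by rewrite !mulr_sumr.
Qed.

Lemma kdiff_ideal (J : R -> Prop) c k : is_ideal J ->
  (forall A, (#|A| < k)%N -> J (c A)) -> forall B, (#|B| <= k)%N -> J (kdiff c B).
Proof.
move=> hJ h B hB; apply: ideal_sum => // j jB.
apply: idealMr => //; apply: idealMr => //; apply: h.
by move: hB; rewrite (cardsD1 j) jB.
Qed.

(* Vanishing of the Koszul cohomology [H^i(y; R/J)] for all [i < k]; since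
   [kdiff] raises the size of the index set by one, the cochains of the
   various degrees need not be separated. *)
Definition koszul_vanish (J : R -> Prop) (k : nat) : Prop :=
  forall c, (forall B, (#|B| <= k)%N -> J (kdiff c B)) ->
  exists b, forall A, (#|A| < k)%N -> J (c A - kdiff b A).

Lemma koszul_vanish0 J : koszul_vanish J 0.
Proof. by move=> c _; exists c. Qed.

(** Cutting [c] off to zero from degree [k] on makes it a cocycle one degree further, which is what
    the hypothesis asks for. *)
Lemma koszul_vanish_pred J k :
  is_ideal J -> koszul_vanish J k.+1 -> koszul_vanish J k.
Proof.
move=> hJ V c hc.
have [B hB|b hb] := V (fun A => if (#|A| < k)%N then c A else 0); last first.
  by exists b => A hA; have := hb A (ltnW hA); rewrite hA.
have [lt|ge] := leqP #|B| k.
  suff -> : kdiff (fun A => if (#|A| < k)%N then c A else 0) B = kdiff c B.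
    exact: hc.
  apply: eq_bigr => j jB; rewrite ifT //.
  by move: lt; rewrite (cardsD1 j) jB.
apply: ideal_sum => // j jB; rewrite ifF ?mulr0 ?mulr0; first exact: ideal0.
by move: ge; rewrite (cardsD1 j B) jB add1n ltnS => ge; apply/negbTE; rewrite -leqNgt.
Qed.

Lemma koszul_vanish_leq J k l :
  is_ideal J -> (l <= k)%N -> koszul_vanish J k -> koszul_vanish J l.
Proof.
move=> hJ /subnKC <-; elim: (k - l)%N => [|d IH]; first by rewrite addn0.
by rewrite addnS => /koszul_vanish_pred V; apply/IH/V.
Qed.

(* By the null-homotopy [kcontrP], the ideal of the [y j] annihilates cohomology. *)
Lemma span_acts_trivially J a c k : is_ideal J -> lin_span y a ->
  (forall B, (#|B| <= k)%N -> J (kdiff c B)) ->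
  exists b, forall A, (#|A| < k)%N -> J (a * c A - kdiff b A).
Proof.
move=> hJ [g ->] hc.
exists (fun A => \sum_(j <- index_enum 'I_N) g j * kcontr j c A) => A hA.
rewrite (kdiff_sum _ (fun j A => g j * kcontr j c A)) mulr_suml -sumrB.
apply: ideal_sum => // j _; rewrite kdiffZ -mulrA -mulrBr -kcontrP addrC addKr.
apply: idealMr => //; rewrite /kcontr; case: ifP => jA; first exact: ideal0.
by apply: idealMr => //; apply: hc; rewrite cardsU1 jA.
Qed.

(* On cohomology [a] acts nilpotently, and injectively by the long exact sequence
   of multiplication by [a]. *)
Lemma koszul_vanish_regular J a k L : is_ideal J -> regular_mod J a ->
  lin_span y (a ^+ L) -> koszul_vanish (adjoin J a) k -> koszul_vanish J k.+1.
Proof.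
move=> hJ reg_a aL V c hc.
have [b hb] := span_acts_trivially hJ aL hc; clear aL.
(* One factor of [a] is removed at a time: [b] is a cocycle modulo (J, a), hence of the form d b' +
   r a, and cancelling [a] leaves [r] as a primitive of a^L c. *)
elim: L b hb => [|L IH] b hb.
  by exists b => A hA; have := hb A hA; rewrite expr0 mul1r.
have db_in B : (#|B| <= k)%N -> adjoin J a (kdiff b B).
  move=> hB; exists (kdiff b B - a ^+ L.+1 * c B), (a ^+ L * c B).
  split; last by rewrite exprS; ring.
  by rewrite -opprB; apply: idealN => //; apply: hb.
have [b' hb'] := V b db_in.
have /choice [r hr] A : exists r, (#|A| < k)%N -> J (b A - kdiff b' A - r * a).
  have [lt|ge] := ltnP #|A| k; last by exists 0.
  by have [f [r [hf ->]]] := hb' A lt; exists r => _; rewrite addrK.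
apply: (IH r) => A hA; apply: reg_a.
have -> : a * (a ^+ L * c A - kdiff r A) =
   (a ^+ L.+1 * c A - kdiff b A) +
   kdiff (fun A => b A - kdiff b' A - a * r A) A.
  by rewrite !kdiffB kdiff_sqr kdiffZ exprS; ring.
apply: idealD => //; first exact: hb.
apply: (@kdiff_ideal _ _ k) => // B hB.
by have := hr B hB; rewrite [r B * a]mulrC.
Qed.

(** The connecting map of multiplication by [a] sends [c] to [g] with d c = a g. A primitive [b] of
    [g] corrects [c] to the cocycle c - a b modulo [J]. *)
Lemma koszul_vanish_adjoin J a k : is_ideal J -> regular_mod J a ->
  koszul_vanish J k.+1 -> koszul_vanish (adjoin J a) k.
Proof.
move=> hJ reg_a V c hc.
have /choice [g hg] B : exists g, (#|B| <= k)%N -> J (kdiff c B - a * g).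
  have [le|gt] := leqP #|B| k; last by exists 0.
  by have [f [g [hf ->]]] := hc B le; exists g => _; rewrite [a * g]mulrC addrK.
have dg B : (#|B| <= k.+1)%N -> J (kdiff g B).
  move=> hB; apply: reg_a.
  have -> : a * kdiff g B = - kdiff (fun A => kdiff c A - a * g A) B.
    by rewrite kdiffB kdiff_sqr kdiffZ; ring.
  by apply: idealN => //; apply: (@kdiff_ideal _ _ k.+1).
have [b hb] := V g dg.
have [|e he] := koszul_vanish_pred hJ V (c := fun A => c A - a * b A).
  move=> B hB; rewrite kdiffB kdiffZ.
  have -> : kdiff c B - a * kdiff b B =
    (kdiff c B - a * g B) + a * (g B - kdiff b B) by ring.
  by apply: idealD => //; [apply: hg|apply: idealMr => //; apply: hb].
exists e => A hA; exists (c A - a * b A - kdiff e A), (b A).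
by split; [apply: he | ring].
Qed.

(** Primitives [b1] modulo [X] and [b2] modulo [Y] differ by a cocycle modulo X + Y. Once it is a
    coboundary d e, the cochain b1 - f is congruent to [b1] modulo [X] and to b2 + d e modulo
    [Y]. *)
Lemma koszul_vanish_cap X Y k : is_ideal X -> is_ideal Y ->
  koszul_vanish X k -> koszul_vanish Y k -> koszul_vanish (sum_ideal X Y) k.-1 ->
  koszul_vanish (cap_ideal X Y) k.
Proof.
case: k => [|k] hX hY VX VY VS c hc; first by exists c.
have [b1 hb1] := VX c (fun B hB => proj1 (hc B hB)).
have [b2 hb2] := VY c (fun B hB => proj2 (hc B hB)).
have [|e he] := VS (fun A => b1 A - b2 A).
  move=> B hB; exists (- (c B - kdiff b1 B)), (c B - kdiff b2 B).
  by split; [apply: idealN => //; apply: hb1 | apply: hb2 | rewrite kdiffB; ring].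
have /choice [f hf] A : exists f, (#|A| < k)%N ->
    X f /\ Y (b1 A - b2 A - kdiff e A - f).
  have [lt|ge] := ltnP #|A| k; last by exists 0.
  by have [f [g [hf hg ->]]] := he A lt; exists f => _; rewrite [f + g]addrC addrK.
exists (fun A => b1 A - f A) => A hA; split.
  have -> : c A - kdiff (fun A => b1 A - f A) A = (c A - kdiff b1 A) + kdiff f A.
    by rewrite kdiffB; ring.
  apply: idealD => //; first exact: hb1.
  by apply: (@kdiff_ideal _ _ k) => // B /hf[].
have -> : c A - kdiff (fun A => b1 A - f A) A = (c A - kdiff b2 A) -
   kdiff (fun A => b1 A - b2 A - kdiff e A - f A) A.
  by rewrite !kdiffB kdiff_sqr; ring.
apply: idealB => //; first exact: hb2.
by apply: (@kdiff_ideal _ _ k) => // B /hf[].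
Qed.

(** The connecting map sends [c] to the part [f] of d c that lies in [X], a cocycle modulo both
    ideals. A primitive [b] of it splits [c] into a cocycle [b] modulo [X] and a cocycle c - b
    modulo [Y]. *)
Lemma koszul_vanish_sum X Y k : is_ideal X -> is_ideal Y ->
  koszul_vanish X k -> koszul_vanish Y k -> koszul_vanish (cap_ideal X Y) k.+1 ->
  koszul_vanish (sum_ideal X Y) k.
Proof.
move=> hX hY VX VY VC c hc.
have /choice [f hf] B : exists f, (#|B| <= k)%N -> X f /\ Y (kdiff c B - f).
  have [le|gt] := leqP #|B| k; last by exists 0.
  by have [f [g [hf hg ->]]] := hc B le; exists f => _; rewrite [f + g]addrC addrK.
have [|b hb] := VC f.
  move=> B hB; split; first by apply: (@kdiff_ideal _ _ k.+1) => // A /hf[].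
  have -> : kdiff f B = - kdiff (fun A => kdiff c A - f A) B.
    by rewrite kdiffB kdiff_sqr; ring.
  by apply: idealN => //; apply: (@kdiff_ideal _ _ k.+1) => // A /hf[].
have [|e1 he1] := VX b.
  move=> B hB; have -> : kdiff b B = f B - (f B - kdiff b B) by ring.
  by apply: idealB => //; [case: (hf B hB) | case: (hb B hB)].
have [|e2 he2] := VY (fun A => c A - b A).
  move=> B hB; have -> : kdiff (fun A => c A - b A) B =
    (kdiff c B - f B) + (f B - kdiff b B) by rewrite kdiffB; ring.
  by apply: idealD => //; [case: (hf B hB) | case: (hb B hB)].
exists (fun A => e1 A + e2 A) => A hA.
exists (b A - kdiff e1 A), (c A - b A - kdiff e2 A).
by split; [apply: he1 | apply: he2 | rewrite kdiffD; ring].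
Qed.

End Koszul.

(** * Regular sequences over Noetherian rings *)

Section RegularSequences.

Context (R : comNzRingType).
Implicit Types (I J M : R -> Prop) (s : seq R).

(** [T] is the identity or [loc_ideal M], so one recursion covers regular sequences on R/J and on
    its localization at [M]. *)
Fixpoint reg_seq (T : (R -> Prop) -> R -> Prop) J s : Prop :=
  if s is a :: s' then regular_mod (T J) a /\ reg_seq T (adjoin J a) s'
  else True.

Definition adjoin_seq J s : R -> Prop := foldl (@adjoin R) J s.

Lemma adjoin_seq_is_ideal J s : is_ideal J -> is_ideal (adjoin_seq J s).
Proof. by elim: s J => [|a s IH] J hJ //; apply/IH/adjoin_is_ideal. Qed.

Lemma adjoin_seq_sub J s : subpred_of J (adjoin_seq J s).
Proof. by elim: s J => [|a s IH] J x hx //; apply/IH/adjoin_sub. Qed.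

Lemma adjoin_seq_min J K s : is_ideal K -> subpred_of J K ->
  (forall a, a \in s -> K a) -> subpred_of (adjoin_seq J s) K.
Proof.
move=> hK; elim: s J => [|a s IH] J hJK hs //; apply: IH => [|b bs].
  by apply: adjoin_min => //; apply: hs; rewrite inE eqxx.
by apply: hs; rewrite inE bs orbT.
Qed.

Lemma adjoin_seq_mem J s a : is_ideal J -> a \in s -> adjoin_seq J s a.
Proof.
elim: s J => // b s IH J hJ; rewrite inE => /orP[/eqP->|as_]; last first.
  by apply: (IH (adjoin J b)) => //; apply: adjoin_is_ideal.
by apply: (@adjoin_seq_sub (adjoin J b)); apply: adjoin_mem.
Qed.

Lemma ideal_extE I s : is_ideal I -> ideal_ext I s = adjoin_seq I s.
Proof.
move=> hI; apply: same_predP => x; split.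
  apply; first exact: adjoin_seq_is_ideal.
  by move=> z [hz|hz]; [apply: adjoin_seq_sub | apply: adjoin_seq_mem].
apply: adjoin_seq_min; first exact: ideal_gen_is_ideal.
  by move=> z hz; apply: ideal_gen_sub; left.
by move=> z hz; apply: ideal_gen_sub; right.
Qed.

Lemma reg_seqP T J s : reg_seq T J s <->
  forall i g, (i < size s)%N -> T (adjoin_seq J (take i s)) (s`_i * g) ->
    T (adjoin_seq J (take i s)) g.
Proof.
elim: s J => [|a s IH] J //=; split.
  by move=> [ha /IH hs] [|i] g //=; [move=> _; apply: ha | apply: hs].
move=> h; split; first by move=> g; apply: (h 0%N g).
by apply/IH => i g; apply: (h i.+1 g).
Qed.

Lemma regular_forP T I s : is_ideal I ->
  regular_for (fun s' => T (ideal_ext I s')) s <->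
  reg_seq T I s /\ ~ T (adjoin_seq I s) 1.
Proof.
move=> hI; rewrite /regular_for reg_seqP ideal_extE //.
by split=> -[h1 h2]; split=> // i g; have := h1 i g; rewrite ideal_extE.
Qed.

Lemma loc_ideal_is_ideal M J : prime_id M -> is_ideal J ->
  is_ideal (loc_ideal M J).
Proof.
move=> [hM M1 hMM] hJ; split.
- by exists 1 => //; rewrite mulr0; apply: ideal0.
- move=> f g [u hu huf] [v hv hvg]; exists (u * v); first by case/hMM.
  rewrite mulrDr; apply: idealD => //; last by rewrite -mulrA; apply: idealMr.
  by rewrite [u * v]mulrC -mulrA; apply: idealMr.
- by move=> r f [u hu huf]; exists u => //; rewrite mulrCA; apply: idealMr.
Qed.

Lemma loc_ideal_sub M J : ~ M 1 -> subpred_of J (loc_ideal M J).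
Proof. by move=> M1 f hf; exists 1 => //; rewrite mul1r. Qed.

Lemma loc_ideal_adjoin M J a : prime_id M -> is_ideal J ->
  loc_ideal M (adjoin (loc_ideal M J) a) = loc_ideal M (adjoin J a).
Proof.
move=> pM hJ; have [hM M1 hMM] := pM.
apply: same_predP => f; split => -[u hu].
  move=> [g [r [[v hv hvg] e]]]; exists (v * u); first by case/hMM.
  exists (v * g), (v * r); split => //; rewrite -mulrA e; ring.
move=> [g [r [hg e]]]; exists u => //; exists g, r; split=> //.
exact: loc_ideal_sub.
Qed.

Lemma maximal_prime M : maximal_id M -> prime_id M.
Proof.
move=> [hM M1 hmax]; split=> // x y hxy.
case: (pselect (M x)) => hx; [by left|right].
case: (pselect (adjoin M x 1)) => [[f [r [hf e]]]|h1].
  rewrite -[y]mul1r e mulrDl; apply: idealD => //; first exact: idealMl.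
  by rewrite -mulrA; apply: idealMr.
case: hx; apply: (hmax (adjoin M x)) => //; first exact: adjoin_is_ideal.
  by move=> z; apply: adjoin_sub.
exact: adjoin_mem.
Qed.

Lemma maximal_unit M u : maximal_id M -> ~ M u -> exists v, M (1 - v * u).
Proof.
move=> [hM M1 hmax] hu.
case: (pselect (adjoin M u 1)) => [[f [r [hf e]]]|h1].
  by exists r; rewrite e addrK.
case: hu; apply: (hmax (adjoin M u)) => //; first exact: adjoin_is_ideal.
  by move=> z; apply: adjoin_sub.
exact: adjoin_mem.
Qed.

Lemma reg_seq_loc M J s : reg_seq id J s -> reg_seq (loc_ideal M) J s.
Proof.
elim: s J => //= a s IH J [ha hs]; split; last exact: IH.
by move=> g [u hu h]; exists u => //; apply: ha; rewrite mulrCA.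
Qed.

(** Membership in the radical is allowed because a regular sequence in the ideal of the x_i will be
    tested against y_i = x_i^N. *)
Lemma koszul_vanish_reg_seq N (y : 'I_N -> R) J s : is_ideal J ->
  reg_seq id J s -> (forall a, a \in s -> radical (lin_span y) a) ->
  koszul_vanish y J (size s).
Proof.
elim: s J => [|a s IH] J hJ /=; first by move=> *; apply: koszul_vanish0.
move=> [ha hs] hy; have [L hL] := hy a (mem_head _ _).
apply: (koszul_vanish_regular hJ ha hL); apply: IH => //.
  exact: adjoin_is_ideal.
by move=> b bs; apply: hy; rewrite inE bs orbT.
Qed.

Lemma common_denominator (T : finType) M J (P : pred T) (f : T -> R) :
  prime_id M -> is_ideal J -> (forall i, P i -> loc_ideal M J (f i)) ->
  exists2 u, ~ M u & forall i, P i -> J (u * f i).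
Proof.
move=> [hM M1 hMM] hJ h.
have /choice [u hu] i : exists u, ~ M u /\ (P i -> J (u * f i)).
  case: (boolP (P i)) => [/h[u hu huf]|_]; first by exists u.
  by exists 1.
exists (\prod_i u i) => [|i Pi].
  elim/big_rec: _ => [//|i x _ hx /hMM[]//]; by case: (hu i).
rewrite (bigD1 i) //= mulrAC; apply: idealMl => //.
by case: (hu i) => _; apply.
Qed.

(** Cohomology is killed by [M], and any [u] outside [M] has an inverse [v] modulo [M]; so the
    denominators introduced by localizing already act invertibly. *)
Lemma koszul_vanish_loc N (y : 'I_N -> R) M J k : maximal_id M ->
  subpred_of M (lin_span y) -> is_ideal J ->
  koszul_vanish y (loc_ideal M J) k <-> koszul_vanish y J k.
Proof.
move=> maxM My hJ; have pM := maximal_prime maxM; have [hM M1 hMM] := pM.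
have hL := loc_ideal_is_ideal pM hJ.
split=> V c hc.
  have [|b hb] := V c; first by move=> B hB; apply/loc_ideal_sub/hc.
  have [u hu ub] := common_denominator (P := fun A : {set 'I_N} => (#|A| < k)%N)
    pM hJ hb.
  have [v /My hv] := maximal_unit maxM hu.
  have [|e he] := span_acts_trivially (k := k) hJ hv (c := fun A => c A - kdiff y b A).
    by move=> B hB; rewrite kdiffB kdiff_sqr subr0; apply: hc.
  exists (fun A => b A + e A) => A hA; rewrite kdiffD.
  have -> : c A - (kdiff y b A + kdiff y e A) =
   ((1 - v * u) * (c A - kdiff y b A) - kdiff y e A) +
    v * (u * (c A - kdiff y b A)) by ring.
  by apply: idealD => //; [apply: he | apply: idealMr => //; apply: ub].
have [u hu uc] := common_denominator (P := fun A : {set 'I_N} => (#|A| <= k)%N)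
    pM hJ hc.
have [v /My hv] := maximal_unit maxM hu.
have [|b hb] := V (fun A => u * c A); first by move=> B /uc; rewrite kdiffZ.
have [e he] := span_acts_trivially hL hv hc.
exists (fun A => e A + v * b A) => A hA; rewrite kdiffD kdiffZ.
have -> : c A - (kdiff y e A + v * kdiff y b A) =
  ((1 - v * u) * c A - kdiff y e A) + v * (u * c A - kdiff y b A) by ring.
apply: idealD => //; first exact: he.
by apply: idealMr => //; apply: loc_ideal_sub => //; apply: hb.
Qed.

(** Regularity holds only after localization, so each step passes to [loc_ideal M J], uses
    regularity there and returns by [koszul_vanish_loc]. *)
Lemma koszul_vanish_loc_reg_seq N (y : 'I_N -> R) M J s : maximal_id M ->
  subpred_of M (lin_span y) -> is_ideal J ->
  reg_seq (loc_ideal M) J s -> (forall a, a \in s -> M a) ->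
  koszul_vanish y J (size s).
Proof.
move=> maxM My; elim: s J => [|a s IH] J hJ /=.
  by move=> *; apply: koszul_vanish0.
move=> [ha hs] hy; have pM := maximal_prime maxM.
have hL := loc_ideal_is_ideal pM hJ.
apply/(koszul_vanish_loc _ maxM My hJ).
apply: (@koszul_vanish_regular _ _ _ _ a _ 1%N) => //.
  by rewrite expr1; apply/My/hy/mem_head.
apply/(koszul_vanish_loc _ maxM My); first exact: adjoin_is_ideal.
rewrite loc_ideal_adjoin //; apply/(koszul_vanish_loc _ maxM My).
  exact: adjoin_is_ideal.
by apply: IH => // [|b bs]; [apply: adjoin_is_ideal | apply: hy; rewrite inE bs orbT].
Qed.

End RegularSequences.

(** * Associated primes and the existence of regular elements *)

Section Noetherian.

Context (R : comNzRingType).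
Implicit Types (I J M P Q : R -> Prop) (f g a : R).

(** The chain condition is put in terms of sequences of elements: such a sequence comes directly out
    of a choice of ever new elements. *)
Definition noetherian : Prop :=
  forall f : nat -> R, exists k, lin_span (fun i : 'I_k => f i) (f k).

Hypothesis noethR : noetherian.

Lemma noetherian_max (F : (R -> Prop) -> Prop) I :
  (forall J, F J -> is_ideal J) -> F I ->
  exists J, [/\ F J, subpred_of I J &
    forall J', F J' -> subpred_of J J' -> subpred_of J' J].
Proof.
move=> Fid FI; apply: contrapT => none.
pose good J := F J /\ subpred_of I J.
have /choice [h hh] (J : {J | good J}) : exists J' : {J | good J},
    subpred_of (sval J) (sval J') /\ exists x, sval J' x /\ ~ sval J x.
  case: J => J [FJ IJ] /=; apply: contrapT => nex; apply: none.
  exists J; split=> // J' FJ' JJ' x xJ'; apply: contrapT => nx; apply: nex.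
  by exists (exist good J' (conj FJ' (fun z hz => JJ' z (IJ z hz)))); split=> //; exists x.
pose c k := iter k h (exist good I (conj FI (fun z hz => hz))).
have c_mono k l : (k <= l)%N -> subpred_of (sval (c k)) (sval (c l)).
  move=> /subnKC <-; elim: (l - k)%N => [|d IH] x; first by rewrite addn0.
  by rewrite addnS => /IH /(proj1 (hh (c (k + d)%N))).
have /choice [x hx] k : exists x, sval (c k.+1) x /\ ~ sval (c k) x.
  exact: (proj2 (hh (c k))).
have [k hk] := noethR x; case: (hx k) => _; apply.
apply: lin_span_min hk; first by apply: Fid; case: (proj2_sig (c k)).
by move=> i; apply: (c_mono i.+1) => //; case: (hx i).
Qed.

Lemma noetherian_fg I : is_ideal I -> exists N (y : 'I_N -> R), I = lin_span y.
Proof.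
move=> hI; pose F J := subpred_of J I /\ exists N (y : 'I_N -> R), J = lin_span y.
have [||J [[JI [N [y Jy]]] _ maxJ]] := @noetherian_max F (lin_span (fun i : 'I_0 => 0)).
- by move=> J [_ [N [y ->]]]; apply: lin_span_is_ideal.
- by split; [apply: lin_span_min => // -[] | exists 0%N, (fun i : 'I_0 => 0)].
subst J; exists N, y; apply: same_predP => x; split=> [xI|/JI//].
pose z (i : 'I_N.+1) := if unlift ord_max i is Some j then y j else x.
apply: (maxJ (lin_span z)).
- split; last by exists N.+1, z.
  apply: lin_span_min => // i; rewrite /z; case: unliftP => [j _|_] //.
  by apply/JI/lin_span_mem.
- apply: lin_span_min => [|j]; first exact: lin_span_is_ideal.
  by have := lin_span_mem z (lift ord_max j); rewrite {2}/z liftK.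
- by have := lin_span_mem z ord_max; rewrite {2}/z unlift_none.
Qed.

Definition annih J f : R -> Prop := fun r => J (r * f).

(** The annihilators of such [f] are the maximal associated primes. They already cover all zero
    divisors of R/J, and distinct ones are incomparable, which eases prime avoidance. *)
Definition max_annih J f : Prop :=
  ~ J f /\ forall g, ~ J g -> subpred_of (annih J f) (annih J g) ->
    subpred_of (annih J g) (annih J f).

Lemma annih_is_ideal J f : is_ideal J -> is_ideal (annih J f).
Proof.
move=> hJ; split; rewrite /annih.
- by rewrite mul0r; apply: ideal0.
- by move=> x y hx hy; rewrite mulrDl; apply: idealD.
- by move=> r x hx; rewrite -mulrA; apply: idealMr.
Qed.

Lemma max_annih_exists J f : is_ideal J -> ~ J f ->
  exists2 g, max_annih J g & subpred_of (annih J f) (annih J g).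
Proof.
move=> hJ hf; pose F I := exists g, ~ J g /\ I = annih J g.
have [||I [[g [hg ->]] sub_fg maxI]] := @noetherian_max F (annih J f).
- by move=> _ [g [_ ->]]; apply: annih_is_ideal.
- by exists f.
by exists g => //; split=> // h hh sub; apply: maxI => //; exists h.
Qed.

Lemma max_annih_prime J f : is_ideal J -> max_annih J f -> prime_id (annih J f).
Proof.
move=> hJ [hf hmax]; split; first exact: annih_is_ideal.
  by rewrite /annih mul1r.
move=> x y hxy; case: (pselect (annih J f y)) => hy; [by right|left].
apply: (hmax (y * f)) => //; last by rewrite /annih mulrA.
by move=> r hr; rewrite /annih mulrCA; apply: idealMr.
Qed.

Lemma prime_prod P (T : eqType) (s : seq T) (F : T -> R) : prime_id P ->
  P (\prod_(i <- s) F i) -> exists2 i, i \in s & P (F i).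
Proof.
move=> [_ P1 hP]; elim: s => [|i s IH]; first by rewrite big_nil.
rewrite big_cons => /hP[h|/IH[j js h]]; first by exists i; rewrite ?mem_head.
by exists j => //; rewrite inE js orbT.
Qed.

Lemma max_annih_avoid J M (L : seq R) : is_ideal J -> is_ideal M ->
  (forall f, f \in L -> max_annih J f) ->
  (forall f, f \in L -> ~ subpred_of M (annih J f)) ->
  exists2 a, M a & forall f, f \in L -> ~ annih J f a.
Proof.
move=> hJ hM; elim: L => [|f L IH] hL nM; first by exists 0 => //; apply: ideal0.
have [|g gL|a aM ha] := IH.
- by move=> g gL; apply: hL; rewrite inE gL orbT.
- by apply: nM; rewrite inE gL orbT.
have [fP f1 fM] := max_annih_prime hJ (hL f (mem_head _ _)).
case: (pselect (annih J f a)) => haf; last first.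
  by exists a => // g; rewrite inE => /orP[/eqP->//|/ha].
(* Since [a] lies in the annihilator of [f] but not in that of [g], maximality forbids the second to
   be contained in the first. The product of the [b g] then changes [a] modulo the new prime
   only. *)
have /choice [b hb] g : exists b, g \in L -> annih J g b /\ ~ annih J f b.
  case: (boolP (g \in L)) => gL; last by exists 0.
  apply: contrapT => nb; apply: (ha g gL).
  have gL' : g \in f :: L by rewrite inE gL orbT.
  apply: (proj2 (hL g gL')) haf; first by case: (hL f (mem_head _ _)).
  by move=> r hr; apply: contrapT => hrf; apply: nb; exists r.
have [m [hm hmf]] : exists m, M m /\ ~ annih J f m.
  apply: contrapT => nm; apply: (nM f (mem_head _ _)) => m hm.
  by apply: contrapT => hmf; apply: nm; exists m.
exists (a + m * \prod_(g <- L) b g).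
  by apply: idealD => //; apply: idealMl.
move=> g; rewrite inE => /orP[/eqP->|gL].
  rewrite (idealDr _ fP haf) => /fM[//|/prime_prod h].
  by have [|g' g'L hg'] := h; [split | case: (hb g' g'L)].
rewrite addrC (idealDr _ (annih_is_ideal _ hJ)); first exact: ha.
apply: idealMr; first exact: annih_is_ideal.
have := annih_is_ideal g hJ; case: (hb g gL) => hbg _ hI.
by rewrite (big_rem g) //=; apply: idealMl.
Qed.

(** Otherwise there is an infinite sequence whose annihilators are contained in no earlier one. Some
    term is a combination of its predecessors; a product of elements that kill these, each outside
    the prime of the term, kills the term and contradicts primality. *)
Lemma max_annih_finite J : is_ideal J -> exists L : seq R,
  (forall f, f \in L -> max_annih J f) /\
  (forall f, max_annih J f ->
     exists2 g, g \in L & subpred_of (annih J f) (annih J g)).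
Proof.
move=> hJ; apply: contrapT => none.
pose good (L : seq R) := forall f, f \in L -> max_annih J f.
have /choice [h hh] (L : seq R) : exists f, good L -> max_annih J f /\
    forall g, g \in L -> ~ subpred_of (annih J f) (annih J g).
  case: (pselect (good L)) => gL; last by exists 0.
  apply: contrapT => nf; apply: none; exists L; split=> // f hf.
  apply: contrapT => ng; apply: nf; exists f => _; split=> // g gL' sub.
  by apply: ng; exists g.
pose s := fix s k := if k is k'.+1 then rcons (s k') (h (s k')) else [::].
have sE k : s k = mkseq (fun i => h (s i)) k.
  by elim: k => [//|k IH]; rewrite mkseqS -IH.
have gs k : good (s k).
  elim: k => //= k IH f; rewrite mem_rcons inE => /orP[/eqP->|/IH//].
  by case: (hh _ IH).
have [k [g hg]] := noethR (fun i => h (s i)).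
have [mk nk] := hh _ (gs k).
have pk := max_annih_prime hJ mk.
have in_s (i : 'I_k) : h (s i) \in s k.
  rewrite (sE k); apply: (map_f (fun j => h (s j))); rewrite mem_iota add0n /=.
  exact: ltn_ord.
have /choice [b hb] (i : 'I_k) : exists b, annih J (h (s i)) b /\ ~ annih J (h (s k)) b.
  apply: contrapT => nb; apply: (nk _ (in_s i)).
  apply: (proj2 (gs k _ (in_s i))); first by case: mk.
  by move=> r hr; apply: contrapT => hrf; apply: nb; exists r.
have [|i _] := prime_prod (s := index_enum 'I_k) (F := b) pk; last by case: (hb i).
rewrite /annih hg mulr_sumr; apply: ideal_sum => // i _.
rewrite (bigD1 i) //= mulrCA; apply: idealMr => //.
by rewrite mulrAC; apply: idealMl => //; case: (hb i).
Qed.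

(** The last hypothesis says that [M] kills no nonzero class of R/J, so [M] is contained in none of
    the finitely many maximal annihilators. *)
Lemma exists_regular J M : is_ideal J -> is_ideal M ->
  (forall f, (forall a, M a -> J (a * f)) -> J f) ->
  exists2 a, M a & regular_mod J a.
Proof.
move=> hJ hM soc.
have [L [hL cover]] := max_annih_finite hJ.
have [|a aM ha] := max_annih_avoid hJ hM hL.
  by move=> f /hL[nf _] sub; apply/nf/soc => a /sub.
exists a => // g hg; apply: contrapT => ng.
have [f mf sub] := max_annih_exists hJ ng.
have [f' f'L sub'] := cover f mf.
by apply: (ha f' f'L); apply/sub'/sub.
Qed.

Lemma reg_seq_exists N (y : 'I_N -> R) J k : is_ideal J ->
  koszul_vanish y J k ->
  exists s, [/\ size s = k, forall a, a \in s -> lin_span y a & reg_seq id J s].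
Proof.
elim: k J => [|k IH] J hJ V; first by exists [::].
have [|a aM reg_a] := exists_regular hJ (lin_span_is_ideal y).
  (* Vanishing of H^0: the cochain with value [f] at the empty set is a cocycle, and there are no
     nonzero coboundaries in degree 0. *)
  move=> f hf; pose c (A : {set 'I_N}) := if A == set0 then f else 0.
  have [B hB|b /(_ set0)] := koszul_vanish_leq hJ (ltn0Sn k) V (c := c).
    apply: ideal_sum => // j jB; apply: idealMr => //.
    rewrite /c; case: eqP => _; first exact/hf/lin_span_mem.
    by rewrite mulr0; apply: ideal0.
  by rewrite cards0 /kdiff big_set0 subr0 /c eqxx; apply.
have [s [ss sM hs]] := IH _ (adjoin_is_ideal a hJ)
  (koszul_vanish_adjoin hJ reg_a V).
exists (a :: s); split=> //=; first by rewrite ss.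
by move=> b; rewrite inE => /orP[/eqP->|/sM].
Qed.

End Noetherian.

(** * Monomial ideals *)

Section MonomialIdeals.

Context (K : fieldType) (n : nat).
Local Notation S := {mpoly K[n]}.
Local Notation mon := 'X_{1..n}.
Implicit Types (U V : mon -> Prop) (f g : S) (m : mon) (j : 'I_n).

Lemma mcoeffMX_if f m k :
  (f * 'X_[m])@_k = if (m <= k)%MM then f@_(k - m)%MM else 0.
Proof.
case: ifP => [le_mk|nle]; first by rewrite -{1}(submK le_mk) addmC mcoeffMX.
apply/eqP; rewrite mcoeff_eq0 (perm_mem (msuppMX f m)).
apply/negP => /mapP[m' _ e]; move: nle; rewrite e.
by have -> : (m <= m + m')%MM by apply/mnm_lepP => i; rewrite mnmDE leq_addr.
Qed.

(** A common form for projections to sets of terms, [undilate] and the coefficients in one variable.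
    In [mcoeff_mterms], [h'] is the partial inverse of [h] on [P]. *)
Definition mterms (P : pred mon) (h : mon -> mon) f : S :=
  \sum_(m <- msupp f | P m) f@_m *: 'X_[h m].

Lemma mcoeff_mterms P h (h' : mon -> option mon) f k :
  (forall m k, (P m && (h m == k)) = (Some m == h' k)) ->
  (mterms P h f)@_k = oapp (fun m => f@_m) 0 (h' k).
Proof.
move=> hh'; rewrite /mterms linear_sum /=.
under eq_bigr do rewrite mcoeffZ mcoeffX.
transitivity (\sum_(m <- msupp f | Some m == h' k) f@_m).
  rewrite [RHS]big_mkcond [LHS]big_mkcond /=; apply: eq_bigr => m _.
  rewrite -hh'; case: (P m) => //=.
  by case: eqP => _; rewrite ?mulr1 ?mulr0.
case: (h' k) => [m0|] /=; last by rewrite big_pred0.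
rewrite (eq_bigl (pred1 m0)) => [|m]; last by rewrite /= (inj_eq Some_inj).
case: (boolP (m0 \in msupp f)) => hm0.
  by rewrite -big_filter filter_pred1_uniq ?msupp_uniq // big_seq1.
rewrite big_seq_cond big_pred0 ?memN_msupp_eq0 // => m.
by rewrite /=; case: (eqVneq m m0) => [->|]; rewrite ?andbF // (negPf hm0).
Qed.

Definition up_closed U := forall m m', U m -> (m <= m')%MM -> U m'.

(** Encoding monomial ideals by their exponents turns sums and intersections into unions and
    intersections of sets, and so makes distributivity a matter of logic. *)
Definition mono U : S -> Prop := fun f => forall m, f@_m != 0 -> U m.

Lemma mono_is_ideal U : up_closed U -> is_ideal (mono U).
Proof.
move=> upU; split.
- by move=> m; rewrite mcoeff0 eqxx.
- move=> f g hf hg m; rewrite mcoeffD => hm.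
  have [e|] := eqVneq f@_m 0; last exact: hf.
  by apply: hg; apply: contraNneq hm => g0; rewrite e g0 addr0.
- move=> r f hf m; rewrite -mcoeff_msupp => /msuppM_le /allpairsP[[m1 m2] /=].
  move=> [_ h2 ->]; apply: (upU m2); first by apply: hf; rewrite -mcoeff_msupp.
  by apply/mnm_lepP => i; rewrite mnmDE leq_addl.
Qed.

Lemma mono_X U m : mono U 'X_[m] <-> U m.
Proof.
split=> [|Um k]; first by apply; rewrite mcoeffX eqxx oner_eq0.
by rewrite mcoeffX; case: (m =P k) => [<-//|_]; rewrite eqxx.
Qed.

Lemma mono_sub U V : (forall m, U m -> V m) -> subpred_of (mono U) (mono V).
Proof. by move=> UV f hf m /hf/UV. Qed.

Lemma mono_eq U V : (forall m, U m <-> V m) -> mono U = mono V.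
Proof.
by move=> UV; apply: same_predP => f; split; apply: mono_sub => m /UV.
Qed.

Lemma mono_cap U V :
  cap_ideal (mono U) (mono V) = mono (fun m => U m /\ V m).
Proof.
apply: same_predP => f; split=> [[hU hV] m hm|h].
  by split; [apply: hU | apply: hV].
by split=> m /h[].
Qed.

Lemma mono_sum U V :
  sum_ideal (mono U) (mono V) = mono (fun m => U m \/ V m).
Proof.
apply: same_predP => f; split.
  move=> [g [h [hg hh ->]]] m; rewrite mcoeffD => hm.
  have [e|/hg] := eqVneq g@_m 0; last by left.
  by right; apply: hh; apply: contraNneq hm => g0; rewrite e g0 addr0.
move=> hf; pose g := mterms (fun m => `[< U m >]) id f.
have gE m : g@_m = if `[< U m >] then f@_m else 0.
  rewrite /g (mcoeff_mterms (h' := fun k => if `[< U k >] then Some k else None)).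
    by case: ifP.
  move=> {}m k; case: (eqVneq m k) => [->|ne]; case: (asboolP (U k)) => Uk //=;
  rewrite ?andbT ?andbF ?eqxx ?(inj_eq Some_inj) ?(negPf ne) ?asboolT ?asboolF //.
exists g, (f - g); split; last by rewrite addrC subrK.
  by move=> m; rewrite gE; case: asboolP => // _; rewrite eqxx.
move=> m; rewrite mcoeffB gE; case: asboolP => Um; first by rewrite subrr eqxx.
by rewrite subr0 => /hf[].
Qed.

Lemma mono_gen U : up_closed U ->
  mono U = ideal_gen (fun f => exists2 m, U m & f = 'X_[m]).
Proof.
move=> upU; apply: same_predP => f; split.
  move=> hf; rewrite [f]mpolyE; apply: ideal_sum_mem.
    exact: ideal_gen_is_ideal.
  move=> m hm; rewrite -mul_mpolyC; apply: (idealMr _ (ideal_gen_is_ideal _)).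
  by apply: ideal_gen_sub; exists m => //; apply: hf; rewrite -mcoeff_msupp.
apply; first exact: mono_is_ideal.
by move=> _ [m Um ->]; apply/mono_X.
Qed.

Lemma ideal_gen_mono (A : mon -> Prop) (B : S -> Prop) :
  same_pred B (fun f => exists2 m, A m & f = 'X_[m]) ->
  ideal_gen B = mono (fun m => exists2 a, A a & (a <= m)%MM).
Proof.
move=> /same_predP ->; have up : up_closed (fun m => exists2 a, A a & (a <= m)%MM).
  by move=> m m' [a Aa le] le'; exists a => //; apply: lepm_trans le le'.
apply: same_predP => f; split.
  apply; first exact: mono_is_ideal.
  by move=> _ [m Am ->]; apply/mono_X; exists m => //; apply: lepm_refl.
rewrite mono_gen //; apply; first exact: ideal_gen_is_ideal.
move=> _ [m [a Aa le] ->]; rewrite -(submK le) mpolyXD.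
apply: (idealMr _ (ideal_gen_is_ideal _)).
by apply: ideal_gen_sub; exists a.
Qed.

Lemma mono_terms (J : S -> Prop) f : is_ideal J ->
  (forall m, f@_m != 0 -> J 'X_[m]) -> J f.
Proof.
move=> hJ h; rewrite [f]mpolyE; apply: ideal_sum_mem => // m hm.
by rewrite -mul_mpolyC; apply: idealMr => //; apply: h; rewrite -mcoeff_msupp.
Qed.

(* The ring map [x_i |-> x_i ^ N], followed by multiplication by [x ^ c], has the
   retraction [undilate], which is linear over [K[x_1 ^ N, ..., x_n ^ N]]. *)
Section Dilation.

Context (N : nat) (c : mon).
Hypotheses (N_gt0 : (0 < N)%N) (c_lt : forall j, (c j < N)%N).

Definition dilate f : S := 'X_[c] * mmap (@mpolyC n K) (fun i => 'X_i ^+ N) f.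

Definition undilate f : S :=
  mterms (fun m => [forall i, (c i <= m i)%N && (N %| m i - c i)%N])
         (fun m => [multinom ((m i - c i) %/ N)%N | i < n]) f.

Lemma dilateE f : dilate f = \sum_(m <- msupp f) f@_m *: 'X_[c + m *+ N].
Proof.
rewrite /dilate /mmap mulr_sumr; apply: eq_bigr => m _.
rewrite mul_mpolyC -scalerAr mpolyXD /mmap1; congr (_ *: (_ * _)).
rewrite [RHS]mpolyXE_id; apply: eq_bigr => i _.
by rewrite mulmnE -exprM mulnC.
Qed.

Lemma mcoeff_undilate f k : (undilate f)@_k = f@_(c + k *+ N)%MM.
Proof.
rewrite (mcoeff_mterms (h' := fun k => Some (c + k *+ N)%MM)) // => {}m k'.
rewrite (inj_eq Some_inj); apply/andP/eqP.
  move=> [/forallP hm /eqP <-]; apply/mnmP => i; have /andP[le dv] := hm i.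
  by rewrite mnmDE mulmnE mnmE divnK // subnKC.
move=> ->; split.
  by apply/forallP => i; rewrite mnmDE mulmnE leq_addr addKn dvdn_mull.
by apply/eqP/mnmP => i; rewrite mnmE mnmDE mulmnE addKn mulnK.
Qed.

Lemma undilate_dilate f : undilate (dilate f) = f.
Proof.
apply/mpolyP => k; rewrite mcoeff_undilate dilateE.
rewrite linear_sum /= [in RHS](mpolyE f) linear_sum /=; apply: eq_bigr => m _.
rewrite !mcoeffZ !mcoeffX eqm_add2l; congr (_ * (nat_of_bool _)%:R).
apply/eqP/eqP => [e|-> //]; apply/mnmP => i.
have := congr1 (fun m : mon => m i) e; rewrite !mulmnE => /eqP.
by rewrite eqn_pmul2r // => /eqP.
Qed.

Lemma dilate_zmod : zmod_morphism dilate.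
Proof. by move=> f g; rewrite /dilate raddfB mulrBr. Qed.

Lemma undilate_zmod : zmod_morphism undilate.
Proof. by move=> f g; apply/mpolyP => k; rewrite !(mcoeffB, mcoeff_undilate). Qed.

Lemma dilate_X j f : dilate ('X_j * f) = 'X_j ^+ N * dilate f.
Proof.
rewrite /dilate rmorphM /= mulrCA; congr (_ * _).
by rewrite mmapX mmap1U.
Qed.

Lemma undilate_X j f : undilate ('X_j ^+ N * f) = 'X_j * undilate f.
Proof.
apply/mpolyP => k; rewrite mcoeff_undilate mpolyXn (mulrC _ f) (mulrC _ (undilate f)).
rewrite !mcoeffMX_if mcoeff_undilate lep1mP.
(* As c_j < N, the factor x^c never supplies a missing x_j^N. *)
have -> : (U_(j) *+ N <= c + k *+ N)%MM = (k j != 0%N).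
  apply/mnm_lepP/idP => [/(_ j)|kj i]; rewrite mulmnE mnm1E mnmDE mulmnE.
    rewrite eqxx mul1n; case: (k j) => //; rewrite addn0 => h.
    by have := c_lt j; lia.
  case: eqP => [<-|_]; last by rewrite mul0n.
  by case: (k j) kj => // kj _; nia.
case: ifP => // kj; congr (_@__); apply/mnmP => i.
by rewrite !(mnmBE, mnmDE, mulmnE, mnm1E) mulnBl; case: eqP => [<-|_] /=; nia.
Qed.

Lemma dilate_mono U f : mono (fun m => U (c + m *+ N)%MM) f -> mono U (dilate f).
Proof.
move=> hf k; rewrite dilateE -mcoeff_msupp => /msupp_sum_le /flatten_mapP[m].
rewrite filter_predT => hm /msuppZ_le; rewrite msuppX inE => /eqP ->.
by apply: hf; rewrite -mcoeff_msupp.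
Qed.

Lemma undilate_mono U f :
  mono U f -> mono (fun m => U (c + m *+ N)%MM) (undilate f).
Proof. by move=> hf k; rewrite mcoeff_undilate => /hf. Qed.

End Dilation.

(** Only additivity and compatibility with the [y j] are asked of [phi], since [undilate] is not
    multiplicative. *)
Lemma kdiff_map (R R' : comNzRingType) N (y : 'I_N -> R) (z : 'I_N -> R')
    (phi : R -> R') (c : {set 'I_N} -> R) B :
  zmod_morphism phi -> (forall (j : 'I_N) x, phi (y j * x) = z j * phi x) ->
  phi (kdiff y c B) = kdiff z (phi \o c) B.
Proof.
move=> phiB phiX.
have phi0 : phi 0 = 0 by rewrite -(subr0 0) phiB subrr.
have phiN x : phi (- x) = - phi x by rewrite -sub0r phiB phi0 sub0r.
have phiD x x' : phi (x + x') = phi x + phi x'.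
  by rewrite -{1}[x']opprK phiB phiN opprK.
rewrite /kdiff (big_morph phi phiD phi0); apply: eq_bigr => j _.
rewrite -phiX /ksgn -signr_odd -[in RHS]signr_odd !mulr_sign.
by case: (odd _).
Qed.

(** A cocycle is dilated, acquires a primitive over the x_i^N, and the retraction carries this
    primitive back. *)
Lemma koszul_vanish_dilate N (c : mon) U k :
  (0 < N)%N -> (forall j, (c j < N)%N) ->
  koszul_vanish (fun i : 'I_n => 'X_i ^+ N : S) (mono U) k ->
  koszul_vanish (fun i : 'I_n => 'X_i : S) (mono (fun m => U (c + m *+ N)%MM)) k.
Proof.
move=> N_gt0 c_lt V x hx.
have [|b hb] := V (dilate N c \o x).
  move=> B /hx /dilate_mono.
  rewrite (kdiff_map (z := fun i => 'X_i ^+ N) _ _ (dilate_zmod _ _)) //.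
  exact: dilate_X.
exists (undilate N c \o b) => A /hb /(undilate_mono N_gt0 (c := c)) /=.
rewrite undilate_zmod // (undilate_dilate c N_gt0 (x A)).
rewrite (kdiff_map (z := fun i => 'X_i) _ _ (undilate_zmod _ _)) //.
exact: undilate_X.
Qed.

End MonomialIdeals.

(** * Polynomial rings *)

Section HilbertBasis.

Context (K : fieldType) (n : nat).
Local Notation S := {mpoly K[n]}.
Local Notation mon := 'X_{1..n}.

(** Induction on the variables compared. A set that is sufficient for [l] fails at [j] only for
    monomials with j-exponent below the bound [B]; each of these finitely many values gets a set of
    its own. *)
Lemma dickson (l : seq 'I_n) (A : mon -> Prop) : exists s : seq mon,
  (forall b, b \in s -> A b) /\
  (forall a, A a -> exists2 b, b \in s & forall j, j \in l -> (b j <= a j)%N).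
Proof.
elim: l A => [|j l IH] A.
  case: (pselect (exists a, A a)) => [[a Aa]|nA].
    by exists [:: a]; split=> [b|b _]; [rewrite inE => /eqP-> | exists a; rewrite ?inE].
  by exists [::]; split=> // a Aa; case: nA; exists a.
have [s0 [s0A s0P]] := IH A.
have /choice [s hs] e := IH (fun a => A a /\ a j = e).
pose B := \max_(b <- s0) b j.
exists (s0 ++ flatten [seq s e | e <- iota 0 B]); split=> [b|a Aa].
  rewrite mem_cat => /orP[/s0A//|/flatten_mapP[e _]].
  by case: (hs e) => h _ /h[].
have [b bs0 hb] := s0P a Aa.
have [le|lt] := leqP (b j) (a j).
  exists b; first by rewrite mem_cat bs0.
  by move=> i; rewrite inE => /orP[/eqP->|/hb].
have [h1 h2] := hs (a j); have [b' b's hb'] := h2 a (conj Aa erefl).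
exists b'.
  rewrite mem_cat; apply/orP; right; apply/flatten_mapP; exists (a j) => //.
  rewrite mem_iota /=; apply: leq_trans lt _.
  by rewrite /B (big_rem b) //= leq_maxl.
by move=> i; rewrite inE => /orP[/eqP->|/hb'//]; case: (h1 _ b's) => _ ->.
Qed.

Lemma mlead_reduce (p q : S) : p != 0 -> q != 0 -> (mlead q <= mlead p)%MM ->
  exists r, p - r * q != 0 -> (mlead (p - r * q)%R < mlead p)%O.
Proof.
move=> p0 q0 le; pose c := p@_(mlead p) / q@_(mlead q).
pose r : S := c *: 'X_[mlead p - mlead q]; exists r => h0.
have lp : p@_(mlead p) != 0 by rewrite mleadc_eq0.
have lq : q@_(mlead q) != 0 by rewrite mleadc_eq0.
have c0 : c != 0 by rewrite mulf_neq0 ?invr_eq0.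
have lr : mlead r = (mlead p - mlead q)%MM.
  by rewrite mleadZ_proper ?mleadXm // mcoeffX eqxx mulr1.
have cr : r@_(mlead r) = c by rewrite lr mcoeffZ mcoeffX eqxx mulr1.
have lrq : mlead (r * q) = mlead p.
  have nz : r@_(mlead r) * q@_(mlead q) != 0 by rewrite cr mulf_neq0.
  by rewrite (mleadM_proper nz) lr submK.
have crq : (r * q)@_(mlead p) = p@_(mlead p).
  have := mleadcM r q; rewrite cr lr submK // => ->.
  by rewrite /c divfK.
have := mleadB_le p (r * q); rewrite lrq joinxx le_eqVlt => /orP[/eqP e|//].
have := mlead_supp h0; rewrite e mcoeff_msupp mcoeffB crq subrr eqxx.
by [].
Qed.

(** Dickson's lemma is applied to the leading monomials of all the ideals [Ik k] together. At an
    index where the finitely many minimal ones occur, division reduces every later element to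
    zero. *)
Lemma mpoly_noetherian : noetherian S.
Proof.
move=> f; pose Ik k := lin_span (fun i : 'I_k => f i).
have Ik_id k : is_ideal (Ik k) by apply: lin_span_is_ideal.
have Ik_mono k l x : (k <= l)%N -> Ik k x -> Ik l x.
  move=> le; apply: lin_span_min => // i.
  exact: (lin_span_mem (fun i : 'I_l => f i) (widen_ord le i)).
have [s [sA sP]] := dickson (enum 'I_n)
  (fun m => exists k g, [/\ g != 0, Ik k g & mlead g = m]).
have [k hk] : exists k, forall b, b \in s ->
    exists g, [/\ g != 0, Ik k g & mlead g = b].
  elim: s sA {sP} => [|b s IH] sA; first by exists 0%N.
  have [|k hk] := IH; first by move=> b' b's; apply: sA; rewrite inE b's orbT.
  have [l [g [g0 gl e]]] := sA b (mem_head _ _).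
  exists (maxn k l) => b'; rewrite inE => /orP[/eqP->|/hk[g' [? h ?]]].
    by exists g; split=> //; apply: Ik_mono gl; rewrite leq_maxr.
  by exists g'; split=> //; apply: Ik_mono h; rewrite leq_maxl.
exists k; suff main m : forall l g, Ik l g -> mlead g = m -> Ik k g.
  apply: (main _ k.+1) => //.
  exact: (lin_span_mem (fun i : 'I_k.+1 => f i) ord_max).
elim/(well_founded_ind (@ltom_wf n)): m => m IH l g hg em.
have [->|g0] := eqVneq g 0; first exact: ideal0.
have [|b bs hb] := sP m; first by exists l, g.
have [q [q0 kq qb]] := hk b bs.
have [|r hr] := mlead_reduce g0 q0.
  by apply/mnm_lepP => i; rewrite em qb; apply: hb; rewrite mem_enum.
rewrite -(subrK (r * q) g); apply: idealD => //; last exact: idealMr.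
have [->|d0] := eqVneq (g - r * q) 0; first exact: ideal0.
apply: (IH _ _ (maxn k l) _ _ erefl); first by rewrite -em; apply: hr.
apply: idealB => //; first by apply: Ik_mono hg; rewrite leq_maxr.
by apply: idealMr => //; apply: Ik_mono kq; rewrite leq_maxl.
Qed.

End HilbertBasis.

(** * Coefficients with respect to one variable, and regularity of polynomials in one variable *)

Section CoordinateCoefficients.

Context (K : fieldType) (n : nat).
Local Notation S := {mpoly K[n]}.
Local Notation mon := 'X_{1..n}.
Implicit Types (f g a : S) (m : mon) (i j : 'I_n) (J : S -> Prop).

Definition coord_coef j (e : nat) f : S :=
  mterms (fun m => m j == e) (fun m => m - U_(j) *+ e)%MM f.

Lemma mcoeff_coord_coef j e f k :
  (coord_coef j e f)@_k = if k j == 0%N then f@_(k + U_(j) *+ e)%MM else 0.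
Proof.
rewrite (mcoeff_mterms
  (h' := fun k => if k j == 0%N then Some (k + U_(j) *+ e)%MM else None)).
  by case: ifP.
move=> m {}k; have [k0|k0] := eqVneq (k j) 0%N.
  rewrite (inj_eq Some_inj); apply/andP/eqP => [[/eqP mj /eqP <-]|->].
    rewrite submK //; apply/mnm_lepP => i; rewrite mulmnE mnm1E.
    by case: eqP => [<-|_]; rewrite ?mul1n ?mj.
  by rewrite addmK mnmDE mulmnE mnm1E eqxx k0 mul1n.
apply/andP => -[/eqP mj /eqP e']; move: k0.
by rewrite -e' mnmBE mulmnE mnm1E eqxx mj mul1n subnn.
Qed.

Lemma coord_coef_zmod j e : zmod_morphism (coord_coef j e).
Proof.
move=> f g; apply/mpolyP => k; rewrite mcoeffB !mcoeff_coord_coef.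
by case: ifP => _; rewrite ?subr0 // mcoeffB.
Qed.

HB.instance Definition _ j e :=
  GRing.isZmodMorphism.Build S S (coord_coef j e) (coord_coef_zmod j e).

Lemma coord_coefZ j e c f : coord_coef j e (c *: f) = c *: coord_coef j e f.
Proof.
apply/mpolyP => k; rewrite mcoeffZ !mcoeff_coord_coef.
by case: ifP => _; rewrite ?mulr0 // mcoeffZ.
Qed.

Lemma coord_coefXM j e m f : m j = 0%N ->
  coord_coef j e ('X_[m] * f) = 'X_[m] * coord_coef j e f.
Proof.
move=> m0; apply/mpolyP => k; rewrite mcoeff_coord_coef !(mulrC 'X_[m]).
rewrite !mcoeffMX_if mcoeff_coord_coef mnmBE m0 subn0.
case: ifP => k0; last by rewrite if_same.
have -> : (m <= k + U_(j) *+ e)%MM = (m <= k)%MM.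
  apply/mnm_lepP/mnm_lepP => h i; have := h i; rewrite mnmDE mulmnE mnm1E.
    by case: eqP => [<-|_]; rewrite ?m0 ?mul0n ?addn0.
  by move=> /leq_trans; apply; apply: leq_addr.
case: ifP => // /mnm_lepP le; congr (_@__); apply/mnmP => i.
by rewrite !(mnmBE, mnmDE) -addnBAC.
Qed.

Lemma coord_coef_free j e a f :
  (forall m, a@_m != 0 -> m j = 0%N) ->
  coord_coef j e (a * f) = a * coord_coef j e f.
Proof.
move=> ha; rewrite [a]mpolyE !mulr_suml raddf_sum /=.
apply: eq_big_seq => m; rewrite mcoeff_msupp => /ha m0.
by rewrite -!scalerAl coord_coefZ coord_coefXM.
Qed.

Lemma coord_coef_shift j e d f : coord_coef j e ('X_j ^+ d * f) =
  if (d <= e)%N then coord_coef j (e - d)%N f else 0.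
Proof.
apply/mpolyP => k; rewrite mpolyXn mulrC mcoeff_coord_coef mcoeffMX_if.
have [k0|k0] := eqVneq (k j) 0%N; last first.
  by case: ifP; rewrite ?mcoeff0 // mcoeff_coord_coef (negPf k0).
have -> : (U_(j) *+ d <= k + U_(j) *+ e)%MM = (d <= e)%N.
  apply/mnm_lepP/idP => [/(_ j)|le i]; rewrite mnmDE !mulmnE mnm1E.
    by rewrite eqxx !mul1n k0.
  by case: eqP => _; rewrite ?mul1n ?mul0n // (leq_trans le) ?leq_addl.
case: ifP => le; last by rewrite mcoeff0.
rewrite mcoeff_coord_coef k0 eqxx; congr (_@__); apply/mnmP => i.
rewrite !(mnmBE, mnmDE, mulmnE) mnm1E.
by case: eqP => _; rewrite ?mul1n ?mul0n ?subn0 // addnBA.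
Qed.

Lemma expo_lt_msize j f k B : f@_k != 0 -> (msize f <= B)%N -> (k j < B)%N.
Proof.
rewrite -mcoeff_msupp => /msize_mdeg_lt lt; apply: leq_trans; apply: leq_trans lt.
by rewrite ltnS mdegE (bigD1 j) //= leq_addr.
Qed.

Lemma coord_coef_eq0 j e f : (msize f <= e)%N -> coord_coef j e f = 0.
Proof.
move=> le; apply/mpolyP => k; rewrite mcoeff0 mcoeff_coord_coef.
case: ifP => // _; apply: memN_msupp_eq0; apply: msize_mdeg_ge.
by rewrite mdegD mdegMn mdeg1 mul1n (leq_trans le) ?leq_addl.
Qed.

Lemma mpoly_coord_sum j f B : (msize f <= B)%N ->
  f = \sum_(e < B) 'X_j ^+ e * coord_coef j e f.
Proof.
move=> hB; apply/mpolyP => k; rewrite linear_sum /=.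
under eq_bigr => e _ do
  rewrite mpolyXn mulrC mcoeffMX_if mcoeff_coord_coef mnmBE mulmnE mnm1E eqxx mul1n.
have [f0|fk] := eqVneq f@_k 0.
  rewrite f0 big1 // => e _; case: ifP => // le; case: ifP => //.
  by rewrite submK.
have kB := expo_lt_msize j fk hB.
rewrite (bigD1 (Ordinal kB)) //= subnn eqxx.
have le : (U_(j) *+ k j <= k)%MM.
  apply/mnm_lepP => i; rewrite mulmnE mnm1E.
  by case: eqP => [<-|_]; rewrite ?mul1n.
rewrite le submK // big1 ?addr0 // => e ne.
case: ifP => // /mnm_lepP /(_ j); rewrite mulmnE mnm1E eqxx mul1n => ke.
rewrite ifF //; apply: contraNF ne; rewrite subn_eq0 => ek.
by rewrite -(inj_eq val_inj) /= eqn_leq ke.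
Qed.

(** For an ideal, this says that it is extended from the polynomial ring in the variables other than
    x_j. *)
Definition coord_stable j J := forall e f, J f -> J (coord_coef j e f).

Definition univariate j a := forall m, a@_m != 0 -> m = (U_(j) *+ m j)%MM.

Lemma univariate_sum j a B : univariate j a -> (msize a <= B)%N ->
  a = \sum_(e < B) a@_(U_(j) *+ e)%MM *: 'X_j ^+ e.
Proof.
move=> ua hB; apply/mpolyP => k; rewrite linear_sum /=.
under eq_bigr => e _ do rewrite mcoeffZ mcoeffXn.
have [a0|ak] := eqVneq a@_k 0.
  rewrite a0 big1 // => e _; case: eqP => [->|_]; last by rewrite mulr0.
  by rewrite a0 mul0r.
have kB := expo_lt_msize j ak hB.
rewrite (bigD1 (Ordinal kB)) //= -(ua k ak) eqxx mulr1 big1 ?addr0 // => e ne.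
case: eqP => [ek|_]; last by rewrite mulr0.
case/eqP: ne; apply: val_inj => /=.
by rewrite -ek mulmnE mnm1E eqxx mul1n.
Qed.

(* If [d] is the degree of [a], the coefficient of [x_j ^ (e + d)] in [a * g] is a
   nonzero scalar times that of [x_j ^ e] in [g], up to coefficients of [g] in
   higher degrees. *)
Lemma univariate_regular j a J : is_ideal J -> coord_stable j J ->
  univariate j a -> a != 0 -> regular_mod J a.
Proof.
move=> hJ stJ ua a0 g hag.
pose ac d := a@_(U_(j) *+ d)%MM; pose B := msize a.
have aE := univariate_sum ua (leqnn B).
pose P d := (d < B)%N && (ac d != 0).
have exP : exists d, P d.
  apply: contrapT => nP; case/eqP: a0; rewrite aE big1 // => e _.
  have [h|h] := eqVneq (ac e) 0; first by rewrite -/(ac _) h scale0r.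
  by case: nP; exists (e : nat); rewrite /P ltn_ord.
have ubP d : P d -> (d <= B)%N by case/andP=> /ltnW.
case: (ex_maxnP exP ubP) => D /andP[D_lt D0] Dmax.
(* Downward induction on [e], starting beyond the size of [g], where the coefficients vanish. *)
have main e : J (coord_coef j e g).
  have [s hs] : exists s, (msize g <= s)%N by exists (msize g).
  have [d] := ubnP (s - e)%N; elim: d e => // d IH e hd.
  have zero e' : (s <= e')%N -> J (coord_coef j e' g).
    by move=> le; rewrite coord_coef_eq0 ?(leq_trans hs) //; apply: ideal0.
  have [/zero//|lt] := leqP s e.
  have above e' : (e < e')%N -> J (coord_coef j e' g) by move=> lt'; apply: IH; lia.
  have : J (coord_coef j (e + D) (a * g)) by apply: stJ.
  have -> : coord_coef j (e + D) (a * g) =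
      ac D *: coord_coef j e g +
      \sum_(i < B | i != Ordinal D_lt) coord_coef j (e + D) ((ac i *: 'X_j ^+ i) * g).
    rewrite {1}aE mulr_suml raddf_sum /= (bigD1 (Ordinal D_lt)) //=.
    by rewrite -scalerAl coord_coefZ coord_coef_shift leq_addl addnK.
  rewrite addrC idealDr //; last first.
    apply: ideal_sum => // i ne; rewrite -scalerAl coord_coefZ.
    have [->|ai] := eqVneq (ac i) 0; first by rewrite scale0r; apply: ideal0.
    rewrite -mul_mpolyC; apply: idealMr => //; rewrite coord_coef_shift.
    have iD : (i < D)%N.
      rewrite ltn_neqAle; apply/andP; split; last by apply: Dmax; rewrite /P ltn_ord.
      by apply: contraNneq ne => iD; apply/eqP/val_inj.
    by rewrite ifT; [apply: above; lia | lia].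
  move=> /(idealMr (ac D)^-1%:MP hJ).
  by rewrite mul_mpolyC scalerA mulVf // scale1r.
rewrite (mpoly_coord_sum j (leqnn (msize g))); apply: ideal_sum => // e _.
exact: idealMr.
Qed.

Lemma coord_stable_adjoin i j a J : is_ideal J -> i != j ->
  coord_stable j J -> univariate i a -> coord_stable j (adjoin J a).
Proof.
move=> hJ ij st ua e _ [f [r [hf ->]]].
exists (coord_coef j e f), (coord_coef j e r); split; first exact: st.
rewrite raddfD /= [r * a]mulrC coord_coef_free 1?mulrC // => m /ua ->.
by rewrite mulmnE mnm1E (negPf ij).
Qed.

Definition invariant_on (s : {set 'I_n}) (U : mon -> Prop) :=
  forall m m', (forall j, j \notin s -> m j = m' j) -> U m -> U m'.

Lemma coord_stable_mono s U j : invariant_on s U -> j \in s ->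
  coord_stable j (mono U : S -> Prop).
Proof.
move=> inv js e f hf k; rewrite mcoeff_coord_coef.
case: ifP => [_ /hf|_]; last by rewrite eqxx.
apply: inv => i nis; rewrite mnmDE mulmnE mnm1E.
by case: eqP => [ji|_]; [rewrite -ji js in nis | rewrite addn0].
Qed.

(** The [a j] form a regular sequence: each is regular on an ideal extended from the other
    variables, and adjoining it preserves this property for the variables still to come. *)
Lemma koszul_vanish_invariant N (y : 'I_N -> S) (s : {set 'I_n}) U :
  up_closed U -> invariant_on s U ->
  (forall j, j \in s -> exists a, [/\ univariate j a, a != 0 & lin_span y a]) ->
  koszul_vanish y (mono U) #|s|.
Proof.
move=> upU inv h.
have /choice [a ha] j : exists a, j \in s ->
    [/\ univariate j a, a != 0 & lin_span y a].
  by case: (boolP (j \in s)) => [/h[a ?]|_]; [exists a | exists 0].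
have -> : #|s| = size (map a (enum s)) by rewrite size_map cardE.
apply: koszul_vanish_reg_seq; first exact: mono_is_ideal.
  have st j : j \in enum s -> coord_stable j (mono U : S -> Prop).
    by rewrite mem_enum; apply: coord_stable_mono.
  have sub j : j \in enum s -> j \in s by rewrite mem_enum.
  move: (mono_is_ideal K upU) (enum_uniq (mem s)) st sub.
  elim: (enum s) (mono U) => //= j l IH J hJ /andP[jl ul] st sub.
  have [ua a0 _] := ha j (sub j (mem_head _ _)).
  split; first exact: (univariate_regular hJ (st j (mem_head _ _)) ua a0).
  apply: IH => //; first exact: adjoin_is_ideal.
  - move=> i il; apply: (coord_stable_adjoin (i := j)) => //.
      by apply: contraNneq jl => ->.
    by apply: st; rewrite inE il orbT.
  - by move=> i il; apply: sub; rewrite inE il orbT.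
move=> _ /mapP[j + ->]; rewrite mem_enum => /ha[_ _ h'].
by exists 1%N; rewrite expr1.
Qed.

End CoordinateCoefficients.

(** * Dimension of polynomial rings *)

Section ResidueField.

Context (R : comNzRingType) (p : R -> Prop) (primep : prime_id p).

(** Membership is made boolean classically, so that the quotient by a prime ideal and then its field
    of fractions can be formed. *)
Let pb : {pred R} := fun x => `[< p x >].

Let pb_zmod : zmod_closed pb.
Proof.
have [hp _ _] := primep; split.
  by rewrite unfold_in; apply/asboolP; exact: ideal0.
by move=> x y /asboolP hx /asboolP hy; rewrite unfold_in; apply/asboolP; exact: idealB.
Qed.

Let pb_proper : (1 \notin pb) /\ forall a, {in pb, forall u, a * u \in pb}.
Proof.
have [hp p1 _] := primep; split; first by rewrite unfold_in; apply/asboolP.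
by move=> a x /asboolP hx; rewrite unfold_in; apply/asboolP; exact: idealMr.
Qed.

Let pb_prime : @prime_idealr_closed R pb.
Proof.
have [hp p1 hpp] := primep => u v /asboolP /hpp[h|h]; apply/orP.
  by left; rewrite unfold_in; apply/asboolP.
by right; rewrite unfold_in; apply/asboolP.
Qed.

HB.instance Definition _ := GRing.isZmodClosed.Build R pb pb_zmod.
HB.instance Definition _ := isProperIdeal.Build R pb pb_proper.
HB.instance Definition _ := isPrimeIdealrClosed.Build R pb pb_prime.

Let I : prime_idealr R := pb.
Definition prime_quotient := {ideal_quot I}.
HB.instance Definition _ := GRing.ComNzRing.on prime_quotient.
Local Notation Q := prime_quotient.

Let unitQ : pred Q := fun x => `[< exists y, y * x = 1 >].
Let invQ (x : Q) : Q :=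
  if pselect (exists y, y * x = 1) is left h then sval (cid h) else x.

Let mulVQ : {in unitQ, left_inverse 1 invQ *%R}.
Proof.
move=> x; rewrite unfold_in => /asboolP h; rewrite /invQ.
by case: pselect => // h'; case: cid.
Qed.

Let unitQP (x y : Q) : y * x = 1 -> unitQ x.
Proof. by move=> h; apply/asboolP; exists y. Qed.

Let invQ_out : {in [predC unitQ], invQ =1 id}.
Proof.
move=> x; rewrite inE unfold_in => /asboolP h; rewrite /invQ.
by case: pselect.
Qed.

HB.instance Definition _ :=
  GRing.ComNzRing_hasMulInverse.Build Q mulVQ unitQP invQ_out.

Let Q_domain : GRing.integral_domain_axiom Q.
Proof. by move=> x y; apply: Quotient.rquot_IdomainAxiom. Qed.

HB.instance Definition _ := GRing.ComUnitRing_isIntegral.Build Q Q_domain.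

Lemma residue_field : exists (L : fieldType) (iota : {rmorphism R -> L}),
  forall f, iota f = 0 <-> p f.
Proof.
exists {fraction Q}, (@FracField.tofrac Q \o (\pi_Q : R -> Q))%qT => f /=.
have e : (f \in I) = (\pi_Q f == \pi_Q 0)%qT.
  by rewrite -[f in LHS]subr0 Quotient.idealrBE.
have e' : (f \in I) = `[< p f >] by [].
split=> [/eqP|hf]; last apply/eqP; rewrite tofrac_eq0.
  by rewrite -(rmorph0 (\pi_Q : {rmorphism R -> Q}))%qT -e e' => /asboolP.
by rewrite -(rmorph0 (\pi_Q : {rmorphism R -> Q}))%qT -e e'; apply/asboolP.
Qed.

End ResidueField.

(** * Algebraic independence of variables modulo a prime *)

Section Dimension.

Context (K : fieldType) (n : nat).
Local Notation S := {mpoly K[n]}.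
Local Notation mon := 'X_{1..n}.
Implicit Types (f g a h : S) (T : {set 'I_n}) (p q : S -> Prop) (i j : 'I_n).

Definition poly_in T f := forall m : mon, f@_m != 0 -> forall j, j \notin T -> m j = 0%N.

Lemma poly_inB T f g : poly_in T f -> poly_in T g -> poly_in T (f - g).
Proof.
move=> hf hg m; rewrite mcoeffB => nz.
have [e|/hf//] := eqVneq f@_m 0; apply: hg.
by apply: contraNneq nz => g0; rewrite e g0 subrr.
Qed.

Lemma poly_in0 T : poly_in T 0. Proof. by move=> m; rewrite mcoeff0 eqxx. Qed.

Lemma poly_inN T f : poly_in T f -> poly_in T (- f).
Proof. by move=> hf; rewrite -sub0r; apply: poly_inB => //; apply: poly_in0. Qed.

Lemma poly_inD T f g : poly_in T f -> poly_in T g -> poly_in T (f + g).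
Proof.
move=> hf hg; rewrite -[g]opprK; apply: poly_inB => //.
exact: poly_inN.
Qed.

Lemma poly_inM T f g : poly_in T f -> poly_in T g -> poly_in T (f * g).
Proof.
move=> hf hg m; rewrite -mcoeff_msupp => /msuppM_le /allpairsP[[m1 m2] /=].
rewrite !mcoeff_msupp => -[h1 h2 ->] j jT.
by rewrite mnmDE (hf _ h1) // (hg _ h2).
Qed.

Lemma poly_inC T c : poly_in T c%:MP.
Proof.
by move=> m; rewrite mcoeffC; case: (m =P 0%MM) => [-> _ j _|_]; rewrite ?mnm0E // mulr0 eqxx.
Qed.

Lemma poly_in1 T : poly_in T 1. Proof. exact: (@poly_inC T 1). Qed.

Lemma poly_inX T j : j \in T -> poly_in T 'X_j.
Proof.
move=> jT m; rewrite mcoeffX; case: (U_(j)%MM =P m) => [<- _ i iT|_]; last by rewrite eqxx.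
by rewrite mnm1E; case: eqP => // e; rewrite -e jT in iT.
Qed.

Lemma poly_in_exp T f s : poly_in T f -> poly_in T (f ^+ s).
Proof.
move=> hf; elim: s => [|s IH]; first by rewrite expr0; apply: poly_in1.
by rewrite exprS; apply: poly_inM.
Qed.

(** The variables of [T] are algebraically independent modulo [p]; the largest size of such a [T]
    takes the place of the transcendence degree of the residue field. *)
Definition indep p T := forall f, poly_in T f -> p f -> f = 0.

Lemma indep0 p : prime_id p -> indep p set0.
Proof.
move=> [hp p1 _] f hf pf.
have e : f = (f@_0%MM)%:MP.
  apply/mpolyP => m; rewrite mcoeffC.
  case: (m =P 0%MM) => [->|ne]; first by rewrite mulr1.
  rewrite mulr0; apply/eqP/negP => /negP /hf h; apply: ne.
  by apply/mnmP => j; rewrite h ?inE // mnm0E.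
have [f0|f0] := eqVneq f@_0%MM 0; first by rewrite e f0 mpolyC0.
case: p1; have := idealMr (f@_0%MM)^-1%:MP hp pf.
by rewrite [X in p (_ * X)]e -mpolyCM mulVf // mpolyC1.
Qed.

Lemma indep_mono p q T : subpred_of p q -> indep q T -> indep p T.
Proof. by move=> pq ind f hf /pq; apply: ind. Qed.

Section Localized.

Context (p : S -> Prop) (primep : prime_id p) (T : {set 'I_n}).
Context (L : fieldType) (iota : {rmorphism S -> L}).
Hypothesis ker_iota : forall f, iota f = 0 <-> p f.
Hypothesis indT : indep p T.
Hypothesis maxT : forall j, j \notin T -> ~ indep p (j |: T).

(* [frac_in g T'] is the image of [K[x_T'][1/g]] in the residue field. *)
Definition frac_in g (T' : {set 'I_n}) (z : L) : Prop :=
  exists s a, poly_in T' a /\ z * iota g ^+ s = iota a.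

Lemma iota_neq0 a : poly_in T a -> a != 0 -> iota a != 0.
Proof. by move=> ha /eqP a0; apply/eqP => /ker_iota /(indT ha). Qed.

Lemma frac_in_iota g T' a : poly_in T' a -> frac_in g T' (iota a).
Proof. by move=> ha; exists 0%N, a; rewrite expr0 mulr1. Qed.

Lemma frac_inD g T' z w : poly_in T' g ->
  frac_in g T' z -> frac_in g T' w -> frac_in g T' (z + w).
Proof.
move=> hg [s [a [ha ea]]] [t [b [hb eb]]].
exists (s + t)%N, (a * g ^+ t + b * g ^+ s); split.
  by apply: poly_inD; apply: poly_inM => //; apply: poly_in_exp.
rewrite rmorphD !rmorphM !rmorphXn -ea -eb exprD /=; ring.
Qed.

Lemma frac_inM g T' z w :
  frac_in g T' z -> frac_in g T' w -> frac_in g T' (z * w).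
Proof.
move=> [s [a [ha ea]]] [t [b [hb eb]]].
exists (s + t)%N, (a * b); split; first exact: poly_inM.
by rewrite rmorphM -ea -eb exprD /=; ring.
Qed.

Lemma frac_in_exp g T' z s : frac_in g T' z -> frac_in g T' (z ^+ s).
Proof.
move=> hz; elim: s => [|s IH]; last by rewrite exprS; apply: frac_inM.
by rewrite expr0 -(rmorph1 iota); apply/frac_in_iota/poly_in1.
Qed.

Lemma frac_in_sum g T' (I : Type) (r : seq I) (P : pred I) (F : I -> L) :
  poly_in T' g -> (forall k, P k -> frac_in g T' (F k)) ->
  frac_in g T' (\sum_(i <- r | P i) F i).
Proof.
move=> hg h; elim/big_rec: _ => [|i x Pi hx]; last by apply: frac_inD; auto.
by rewrite -(rmorph0 iota); apply/frac_in_iota/poly_in0.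
Qed.

Lemma frac_in_prod g T' (I : Type) (r : seq I) (P : pred I) (F : I -> L) :
  (forall k, P k -> frac_in g T' (F k)) ->
  frac_in g T' (\prod_(i <- r | P i) F i).
Proof.
move=> h; elim/big_rec: _ => [|i x Pi hx]; last by apply: frac_inM; auto.
by rewrite -(rmorph1 iota); apply/frac_in_iota/poly_in1.
Qed.

(** By maximality of [T], some nonzero polynomial in x_T and x_j lies in [p]; it is sorted by powers
    of x_j, and [D] is its degree in x_j. *)
Lemma algebraic_relation j : j \notin T -> exists (C : nat -> S) D,
  [/\ forall e, poly_in T (C e), C D != 0 & p (\sum_(e < D.+1) 'X_j ^+ e * C e)].
Proof.
move=> jT; have [h [hh ph h0]] : exists h, [/\ poly_in (j |: T) h, p h & h != 0].
  apply: contrapT => nh; apply: (maxT jT) => h hh ph.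
  by apply/eqP; apply: contra_notT nh => h0; exists h.
pose B := msize h; pose C e := coord_coef j e h.
have hE := mpoly_coord_sum j (leqnn B).
pose P d := (d < B)%N && (C d != 0).
have exP : exists d, P d.
  apply: contrapT => nP; case/eqP: h0; rewrite hE big1 // => e _.
  have [z|z] := eqVneq (C e) 0; first by rewrite -/(C _) z mulr0.
  by case: nP; exists (e : nat); rewrite /P ltn_ord.
have ubP d : P d -> (d <= B)%N by case/andP=> /ltnW.
case: (ex_maxnP exP ubP) => D /andP[D_lt D0] Dmax.
exists C, D; split=> //.
- move=> e m; rewrite mcoeff_coord_coef.
  case: ifP => [/eqP mj /hh hm i iT|]; last by rewrite eqxx.
  have [->//|ij] := eqVneq i j.
  have /hm : i \notin j |: T by rewrite !inE negb_or ij.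
  by rewrite mnmDE => /eqP; rewrite addn_eq0 => /andP[/eqP].
- suff -> : \sum_(e < D.+1) 'X_j ^+ e * C e = h by [].
  rewrite (big_ord_widen _ (fun e => 'X_j ^+ e * C e) D_lt) [RHS]hE big_mkcond /=.
  apply: eq_bigr => e _; case: ifP => // /negbT eD.
  have [z|z] := eqVneq (C e) 0; first by rewrite -/(C _) z mulr0.
  by case/negP: eD; apply: Dmax; rewrite /P ltn_ord.
Qed.

(** The element [g] is the product of the leading coefficients of the relations of the x_j outside
    [T]. Inverting it makes these relations monic, so all of S becomes integral over K[x_T][1/g]. *)
Lemma integral_over_indep : exists g, [/\ poly_in T g, g != 0 &
  forall f, exists P : {poly L},
    [/\ P \is monic, root P (iota f) & forall i : nat, frac_in g T P`_i]].
Proof.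
have /choice [C] j : exists C : nat -> S, j \notin T -> exists D,
  [/\ forall e, poly_in T (C e), C D != 0 & p (\sum_(e < D.+1) 'X_j ^+ e * C e)].
  by case: (boolP (j \in T)) => [_|/algebraic_relation[C ?]]; [exists (fun=> 0) | exists C].
move=> /(_ _) hC0.
have /choice [D hD] j : exists D, j \notin T ->
  [/\ forall e, poly_in T (C j e), C j D != 0 & p (\sum_(e < D.+1) 'X_j ^+ e * C j e)].
  by case: (boolP (j \in T)) => [_|/hC0[D ?]]; [exists 0%N | exists D].
pose g := \prod_(j | j \notin T) C j (D j).
have gT : poly_in T g.
  rewrite /g; elim/big_rec: _ => [|j x /hD[hj _ _] hx]; first exact: poly_in1.
  exact: poly_inM.
have g0 : g != 0 by apply/prodf_neq0 => j /hD[].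
have ig0 : iota g != 0 by apply: iota_neq0.
exists g; split=> //.
(* To speak of integrality, K[x_T][1/g] is presented as the image of a polynomial ring: the extra
   variable goes to 1/g, and the variables outside [T] go to 0. *)
pose hvar (i : 'I_n.+1) : L :=
  if unlift ord_max i is Some j then (if j \in T then iota 'X_j else 0)
  else (iota g)^-1.
pose rho : {rmorphism {mpoly K[n.+1]} -> L} := mmap (iota \o @mpolyC n K) hvar.
have fracV : frac_in g T (iota g)^-1.
  by exists 1%N, 1; rewrite expr1 mulVf // rmorph1; split=> //; apply: poly_in1.
have rho_frac b : frac_in g T (rho b).
  rewrite /rho /= /mmap; apply: frac_in_sum => // m _.
  apply: frac_inM; first by apply/frac_in_iota/poly_inC.
  apply: frac_in_prod => i _; apply: frac_in_exp; rewrite /hvar.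
  case: unlift => // j; case: ifP => jT; first by apply/frac_in_iota/poly_inX.
  by rewrite -(rmorph0 iota); apply/frac_in_iota/poly_in0.
have rhoC c : rho c%:MP = iota c%:MP by rewrite /rho /= mmapC.
have rhoX j : j \in T -> rho 'X_(lift ord_max j) = iota 'X_j.
  by move=> jT; rewrite /rho /= mmapX mmap1U /hvar liftK jT.
have rhoV : rho 'X_ord_max = (iota g)^-1.
  by rewrite /rho /= mmapX mmap1U /hvar unlift_none.
have iota_rho a : poly_in T a -> exists b, rho b = iota a.
  move=> aT; exists (\sum_(m <- msupp a) (a@_m)%:MP *
     \prod_(j < n | j \in T) 'X_(lift ord_max j) ^+ m j).
  rewrite rmorph_sum [in RHS](mpolyE a) rmorph_sum /=; apply: eq_big_seq => m.
  rewrite mcoeff_msupp => /aT hm; rewrite -mul_mpolyC !rmorphM rhoC; congr (_ * _).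
  rewrite mpolyXE_id !rmorph_prod [RHS](bigID (mem T)) /= [X in _ = _ * X]big1 ?mulr1.
    by apply: eq_bigr => j jT; rewrite !rmorphXn rhoX.
  by move=> j jT; rewrite hm // expr0 rmorph1.
have frac_rho z : frac_in g T z -> exists b, rho b = z.
  move=> [s [a [/iota_rho[b hb] e]]]; exists (b * 'X_ord_max ^+ s).
  by rewrite rmorphM rmorphXn rhoV hb -e exprVn mulfK // expf_neq0.
have int_frac z : frac_in g T z -> integralOver rho z.
  by move=> /frac_rho[b <-]; apply: integral_id.
have intX j : integralOver rho (iota 'X_j).
  case: (boolP (j \in T)) => jT; first by rewrite -rhoX //; apply: integral_id.
  have [CT CD rel] := hD j jT; have iC0 := iota_neq0 (CT _) CD.
  pose Q := \poly_(e < (D j).+1) (iota (C j e) / iota (C j (D j))).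
  have sQ : size Q = (D j).+1.
    by rewrite size_poly_eq // divff // oner_eq0.
  apply: (@integral_root_monic _ _ _ _ Q).
  - by rewrite monicE lead_coefE sQ coef_poly ltnSn divff.
  - have /ker_iota := rel; rewrite rmorph_sum /= => h.
    rewrite /root horner_poly; under eq_bigr do rewrite mulrAC.
    rewrite -mulr_suml; apply/eqP.
    rewrite -[RHS](mul0r (iota (C j (D j)))^-1) -[X in _ = X / _]h; congr (_ / _).
    by apply: eq_bigr => e _; rewrite rmorphM rmorphXn mulrC.
  - apply/integral_poly => e; apply: int_frac; rewrite coef_poly.
    case: ifP => _; last by rewrite -(rmorph0 iota); apply/frac_in_iota/poly_in0.
    apply: frac_inM; first exact: frac_in_iota.
    (* The inverse of one leading coefficient is the product of the others divided by [g]. *)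
    exists 1%N, (\prod_(i | (i \notin T) && (i != j)) C i (D i)); split.
      elim/big_rec: _ => [|i x /andP[/hD[hi _ _] _] hx]; first exact: poly_in1.
      exact: poly_inM.
    by rewrite expr1 {1}/g (bigD1 j) //= rmorphM mulrA mulVf // mul1r.
move=> f; have [P monP rootP] : integralOver rho (iota f).
  rewrite [f]mpolyE rmorph_sum /=; elim/big_rec: _ => [|m x _ hx].
    exact: integral0.
  apply: integral_add => //; rewrite -mul_mpolyC rmorphM /=.
  apply: integral_mul; first by rewrite -rhoC; apply: integral_id.
  rewrite mpolyXE_id rmorph_prod /=; elim/big_rec: _ => [|j y _ hy].
    exact: integral1.
  apply: integral_mul => //; rewrite rmorphXn; elim: (m j) => [|e IH].
    by rewrite expr0; apply: integral1.
  by rewrite exprS; apply: integral_mul.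
exists (map_poly rho P); split=> //; first exact: monic_map.
by move=> i; rewrite coef_map; apply: rho_frac.
Qed.

End Localized.

Lemma max_indep p : prime_id p ->
  exists2 T, indep p T & forall T', indep p T' -> (#|T'| <= #|T|)%N.
Proof.
move=> /indep0 /asboolP h.
case: (@arg_maxnP _ set0 (fun T => `[< indep p T >]) (fun T => #|T|) h) => T.
by move=> /asboolP hT hmax; exists T => // T' /asboolP; apply: hmax.
Qed.

Lemma max_indepU1 p T j : (forall T', indep p T' -> (#|T'| <= #|T|)%N) ->
  j \notin T -> ~ indep p (j |: T).
Proof. by move=> hmax jT /hmax; rewrite cardsU1 jT add1n ltnn. Qed.

Lemma one_add_mulX_neq0 g j : g != 0 ->
  (1 + g * 'X_j)@_(mlead g + U_(j))%MM != 0 /\ 1 + g * 'X_j != 0.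
Proof.
move=> g0; suff hm : (1 + g * 'X_j)@_(mlead g + U_(j))%MM != 0.
  by split=> //; apply: contraNneq hm => ->; rewrite mcoeff0.
have ne : (mlead g + U_(j) == 0)%MM = false by rewrite mnmD_eq0 mnm1_eq0 andbF.
by rewrite mcoeffD mcoeff1 ne add0r addmC mcoeffMX mleadc_eq0.
Qed.

Lemma one_add_mulX_not_unit g j w : g != 0 -> (1 + g * 'X_j) * w != 1.
Proof.
move=> g0; apply/eqP => e; have [hm h0] := one_add_mulX_neq0 j g0.
have w0 : w != 0 by apply: contra_eq_neq e => ->; rewrite mulr0 eq_sym oner_eq0.
have lhw : (mlead (1 + g * 'X_j)%R + mlead w)%MM = 0%MM.
  by rewrite -mleadM_proper ?mulf_neq0 ?mleadc_eq0 // e mlead1.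
move/eqP: lhw; rewrite mnmD_eq0 => /andP[/eqP lh0 _].
move: hm; rewrite -mcoeff_msupp => /msupp_le_mlead /lemc_mdeg.
by rewrite lh0 mdeg0 leqn0 mdegD mdeg1 addn1.
Qed.

(* If [x_i] were transcendental, [1 + g * x_i] would divide a power of [g], since
   its inverse is integral over [K[x_T][1/g]]; but [g] is invertible modulo it. *)
Lemma maximal_indep_empty M T : maximal_id M -> indep M T ->
  (forall T', indep M T' -> (#|T'| <= #|T|)%N) -> T = set0.
Proof.
move=> maxM indT maxT; apply/eqP/set0Pn => -[i iT].
have pM := maximal_prime maxM; have [L [iota ker_iota]] := residue_field pM.
have [g [gT g0 intg]] :=
  integral_over_indep ker_iota indT (fun j => max_indepU1 maxT (j := j)).
pose h : S := 1 + g * 'X_i.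
have hT : poly_in T h.
  by apply: poly_inD; [apply: poly_in1 | apply: poly_inM => //; apply: poly_inX].
have [_ h0] := one_add_mulX_neq0 i g0; rewrite -/h in h0.
have ih0 : iota h != 0 by apply: (iota_neq0 ker_iota indT).
have nMh : ~ M h by move=> /ker_iota e; rewrite e eqxx in ih0.
have [v /ker_iota] := maximal_unit maxM nMh.
rewrite rmorphB rmorphM rmorph1 => /eqP; rewrite subr_eq0 => /eqP vh.
have [P [monP rootPv fracP]] := intg v.
pose m := (size P).-1.
have sP : size P = m.+1 by rewrite /m prednK // size_poly_gt0 monic_neq0.
have Pm : P`_m = 1 by move/monicP: monP; rewrite lead_coefE.
(* The monic equation of v = 1/h, multiplied by h^m, reads 1 + sum P_k h^(m-k) = 0; hence 1/h = [w],
   which involves no power of [v]. *)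
pose w := - \sum_(k < m) P`_k * iota h ^+ (m - k.+1).
have hw : iota h * w = 1.
  have : P.[iota v] * iota h ^+ m = 0 by rewrite (rootP rootPv) mul0r.
  rewrite horner_coef sP mulr_suml big_ord_recr /= Pm mul1r -exprMn -vh expr1n.
  move=> e; rewrite /w mulrN mulr_sumr; apply: addr0_eq; rewrite -[RHS]e.
  congr (_ + _); apply: eq_bigr => k _.
  have -> : iota h ^+ m = iota h ^+ k * (iota h * iota h ^+ (m - k.+1)).
    by rewrite -exprS subnSK // -exprD subnKC // ltnW.
  by rewrite -mulrA [iota v ^+ k * _]mulrA -exprMn -vh expr1n mul1r mulrCA.
have [s [a [aT ea]]] : frac_in iota g T w.
  rewrite /w -mulN1r; apply: frac_inM.
    by rewrite -(rmorphN1 iota); apply/frac_in_iota/poly_inN/poly_in1.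
  apply: frac_in_sum => // k _; apply: frac_inM; first exact: fracP.
  by apply/frac_in_exp/frac_in_iota.
have gsE : g ^+ s = h * a.
  apply/eqP; rewrite -subr_eq0; apply/eqP/indT.
    by apply: poly_inB; [apply: poly_in_exp | apply: poly_inM].
  by apply/ker_iota; rewrite rmorphB rmorphXn rmorphM -ea mulrA hw mul1r subrr.
(* Modulo [h], g x_i is -1, so (g x_i)^s - (-1)^s is a multiple of [h]. As g^s is one too, [h]
   divides (-1)^s and is a unit. *)
pose W := \sum_(k < s) (g * 'X_i) ^+ (s.-1 - k) * (-1) ^+ k : S.
have hW : h * W = (g * 'X_i) ^+ s - (-1) ^+ s by rewrite subrXX opprK addrC.
have /eqP := one_add_mulX_not_unit i ((-1) ^+ s * (a * 'X_i ^+ s - W)) g0; apply.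
rewrite -/h mulrCA mulrBr mulrA -gsE -exprMn hW opprB addrC subrK.
by rewrite -expr2 sqrr_sign.
Qed.

Lemma nullstellensatz M j : maximal_id M ->
  exists a, [/\ univariate j a, a != 0 & M a].
Proof.
move=> maxM; have [T indT maxT] := max_indep (maximal_prime maxM).
have T0 := maximal_indep_empty maxM indT maxT; subst T.
apply: contrapT => na; apply: (max_indepU1 maxT (j := j)); first by rewrite inE.
move=> f hf Mf; apply/eqP; apply: contra_notT na => f0; exists f; split=> //.
move=> m hm; apply/mnmP => i; rewrite mulmnE mnm1E; case: eqP => [<-|ij].
  by rewrite mul1n.
by rewrite mul0n (hf m hm) // !inE orbF; apply/eqP => /esym.
Qed.

(** Dividing by X while the constant term vanishes only shifts the coefficients, and it keeps the
    nonzero root. *)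
Lemma monic_root_nz (L : fieldType) (B : L -> Prop) (P : {poly L}) z :
  P \is monic -> root P z -> (forall i : nat, B P`_i) -> z != 0 ->
  exists Q : {poly L}, [/\ root Q z, forall i : nat, B Q`_i & Q`_0 != 0].
Proof.
have [k] := ubnP (size P); elim: k P => // k IH P sP monP rP BP z0.
have [P0|P0] := eqVneq P`_0 0; last by exists P.
have /factor_theorem[Q eP] : root P 0 by rewrite /root horner_coef0 P0.
rewrite subr0 in eP.
have Q0 : Q != 0.
  apply: contraTneq monP => Q0.
  by rewrite eP Q0 mul0r monicE lead_coef0 eq_sym oner_eq0.
apply: (IH Q) => //.
- by move: sP; rewrite eP size_mulX.
- by move: monP; rewrite !monicE eP lead_coefMX.
- by move: rP; rewrite eP rootM rootX (negPf z0) orbF.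
- by move=> i; have := BP i.+1; rewrite eP coefMX.
Qed.

(** If [T] were maximal modulo [p], an element f of q outside p would satisfy a monic equation over
    K[x_T][1/g], which can be taken with nonzero constant term. That term is a multiple of f, so
    clearing denominators puts a nonzero polynomial in x_T into [q]. *)
Lemma prime_lt_indep p q T : prime_id p -> prime_id q -> subpred_of p q ->
  ~ subpred_of q p -> indep q T ->
  exists2 T', indep p T' & (#|T| < #|T'|)%N.
Proof.
move=> pp pq spq nqp indq; apply: contrapT => none.
have indT := indep_mono spq indq.
have maxT T' : indep p T' -> (#|T'| <= #|T|)%N.
  by move=> h; rewrite leqNgt; apply: contra_notN none => lt; exists T'.
have [f [qf npf]] : exists f, q f /\ ~ p f.
  apply: contrapT => nf; apply: nqp => f qf; apply: contrapT => npf.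
  by apply: nf; exists f.
have [L [iota ker_iota]] := residue_field pp.
have [g [gT g0 intg]] :=
  integral_over_indep ker_iota indT (fun j => max_indepU1 maxT (j := j)).
have [P [monP rP fracP]] := intg f.
have if0 : iota f != 0 by apply/eqP => /ker_iota.
have [Q [rQ fracQ Q0]] := monic_root_nz monP rP fracP if0.
have [s [a [aT ea]]] := fracQ 0%N.
have [t [r [_ er]]] : frac_in iota g setT (- \sum_(k < (size Q).-1) Q`_k.+1 * iota f ^+ k).
  have inT b : poly_in setT b by move=> m _ j; rewrite inE.
  rewrite -mulN1r; apply: frac_inM.
    by rewrite -(rmorphN1 iota); apply/frac_in_iota.
  apply: frac_in_sum => // k _; apply: frac_inM.
    by have [s' [a' [_ e']]] := fracQ k.+1; exists s', a'.
  by apply/frac_in_exp/frac_in_iota.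
have Q0E : Q`_0 = iota f * - \sum_(k < (size Q).-1) Q`_k.+1 * iota f ^+ k.
  have := rootP rQ; rewrite (@horner_coef_wide _ (size Q).-1.+1) ?leqSpred //.
  rewrite big_ord_recl expr0 mulr1.
  move=> /eqP; rewrite addr_eq0 => /eqP ->; rewrite mulrN mulr_sumr; congr (- _).
  by apply: eq_bigr => k _; rewrite /= exprS mulrCA.
have [hq q1 _] := pq.
have rel : p (a * g ^+ t - f * (r * g ^+ s)).
  apply/ker_iota; rewrite rmorphB !rmorphM !rmorphXn -ea -er {1}Q0E.
  by apply/eqP; rewrite subr_eq0; apply/eqP; ring.
have ag0 : a * g ^+ t = 0.
  apply: indq; first by apply: poly_inM => //; apply: poly_in_exp.
  rewrite -(subrK (f * (r * g ^+ s)) (a * g ^+ t)).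
  by apply: idealD => //; [apply: spq | apply: idealMl].
have /eqP := ag0; rewrite mulf_eq0 expf_eq0 (negPf g0) andbF orbF => /eqP a0.
move: ea; rewrite a0 rmorph0 => /eqP; rewrite mulf_eq0 (negPf Q0) /= expf_eq0.
by move=> /andP[_ /eqP /ker_iota /(indT _ gT) g00]; rewrite g00 eqxx in g0.
Qed.

(** Going down the chain from the empty set, each step enlarges the independent set. At the bottom
    it avoids the variables in [P 0], hence lies in [s]. *)
Lemma prime_chain_length (P : nat -> S -> Prop) k (s : {set 'I_n}) :
  (forall i : nat, (i <= k)%N -> prime_id (P i)) ->
  (forall i : nat, (i < k)%N ->
    subpred_of (P i) (P i.+1) /\ ~ subpred_of (P i.+1) (P i)) ->
  (forall j, j \notin s -> P 0%N 'X_j) -> (k <= #|s|)%N.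
Proof.
move=> primeP chainP P0.
have [T indT leT] : exists2 T, indep (P 0%N) T & (k <= #|T|)%N.
  have step d : (d <= k)%N -> exists2 T, indep (P (k - d)%N) T & (d <= #|T|)%N.
    elim: d => [|d IH] dk.
      by exists set0 => //; apply: indep0; apply: primeP; rewrite subn0.
    have [T indT leT] := IH (ltnW dk).
    have [|h1 h2] := chainP (k - d.+1)%N; first by lia.
    have e : (k - d.+1).+1 = (k - d)%N by lia.
    rewrite e in h1 h2.
    have [||T' ? lt] := prime_lt_indep _ _ h1 h2 indT; try by apply: primeP; lia.
    by exists T' => //; apply: leq_ltn_trans lt.
  by have := step k (leqnn k); rewrite subnn.
apply: leq_trans leT _; apply/subset_leq_card/subsetP => j jT.
apply: contraT => /P0 /(indT _ (poly_inX jT)) /eqP.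
by rewrite -msize_poly_eq0 msizeX.
Qed.

End Dimension.

(** * Depth is at most dimension *)

Section DepthDimension.

Context (R : comNzRingType).
Hypothesis noethR : noetherian R.
Implicit Types (I J M : R -> Prop).

Lemma prime_avoiding J (W : R -> Prop) : is_ideal J -> W 1 ->
  (forall x y, W x -> W y -> W (x * y)) -> (forall x, W x -> ~ J x) ->
  exists P, [/\ prime_id P, subpred_of J P & forall x, W x -> ~ P x].
Proof.
move=> hJ W1 WM dis.
pose F I := is_ideal I /\ forall x, W x -> ~ I x.
have [||P [[hP disP] JP maxP]] := @noetherian_max R noethR F J.
- by move=> I [].
- by [].
exists P; split=> //; split=> //; first exact: disP.
have meets x : ~ P x -> exists2 w, W w & adjoin P x w.
  move=> nx; apply: contrapT => nw; apply/nx/(maxP (adjoin P x)).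
  - split; first exact: adjoin_is_ideal.
    by move=> w Ww hw; apply: nw; exists w.
  - by move=> z; apply: adjoin_sub.
  - exact: adjoin_mem.
move=> x y hxy; case: (pselect (P x)) => hx; [by left|right].
apply: contrapT => hy.
have [w1 Ww1 [f1 [r1 [hf1 e1]]]] := meets x hx.
have [w2 Ww2 [f2 [r2 [hf2 e2]]]] := meets y hy.
apply: (disP (w1 * w2)); first exact: WM.
have -> : w1 * w2 = f1 * w2 + r1 * (x * f2) + (r1 * r2) * (x * y).
  by rewrite e1 e2; ring.
apply: idealD => //; last exact: idealMr.
by apply: idealD => //; [apply: idealMl | do 2!apply: idealMr => //].
Qed.

(** A chain above (J, a) starting at a prime q_0 is prolonged downwards. As [a] is regular, [J]
    contains no product of a power of [a] with an element outside q_0; a prime over [J] avoiding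
    these products lies in q_0 and misses [a]. *)
Lemma reg_seq_prime_chain M J s : maximal_id M -> is_ideal J ->
  reg_seq (loc_ideal M) J s -> subpred_of J M -> (forall a, a \in s -> M a) ->
  exists p : nat -> R -> Prop,
    [/\ forall i, (i <= size s)%N -> prime_id (p i),
        subpred_of J (p 0%N), subpred_of (p (size s)) M
      & forall i, (i < size s)%N ->
          subpred_of (p i) (p i.+1) /\ ~ subpred_of (p i.+1) (p i)].
Proof.
move=> maxM; have pM := maximal_prime maxM; have [hM M1 hMM] := pM.
elim: s J => [|a s IH] J hJ.
  move=> _ JM _; by exists (fun=> M); split.
move=> [ha hs] JM sM.
have aM : M a by apply: sM; rewrite mem_head.
have [|||q [primeq Jq qM chainq]] := IH (adjoin J a) _ hs.
- exact: adjoin_is_ideal.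
- exact: adjoin_min.
- by move=> b bs; apply: sM; rewrite inE bs orbT.
have qiM i : (i <= size s)%N -> subpred_of (q i) M.
  move=> le; have : subpred_of (q i) (q (size s)).
    rewrite -(subnKC le); have : (i + (size s - i) <= size s)%N by rewrite subnKC.
    elim: (size s - i)%N => [|d IHd] h x; first by rewrite addn0.
    rewrite addnS => /IHd hd; apply: (proj1 (chainq _ _)); first by rewrite -addnS.
    by apply: hd; apply: leq_trans h; rewrite addnS.
  by move=> h x /h /qM.
have [hq q1 hqq] := primeq 0%N (leq0n _).
pose W x := exists w e, ~ q 0%N w /\ x = w * a ^+ e.
have W1 : W 1 by exists 1, 0%N; split=> //; rewrite expr0 mulr1.
have WM x y : W x -> W y -> W (x * y).
  move=> [w [e [hw ->]]] [w' [e' [hw' ->]]].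
  exists (w * w'), (e + e')%N; split; first by case/hqq.
  by rewrite exprD; ring.
have dis x : W x -> ~ J x.
  move=> [w [e [hw ->]]] Jwa.
  have : loc_ideal M J (w * a ^+ e) by apply: loc_ideal_sub.
  elim: e {Jwa} => [|e IHe].
    rewrite expr0 mulr1 => -[u hu Ju]; have [|qu|//] := hqq u w.
      by apply: Jq; apply: adjoin_sub.
    by apply: hu; apply: qiM qu.
  by rewrite exprS mulrCA => /ha.
have [P [primeP JP disP]] := prime_avoiding hJ W1 WM dis.
exists (fun i => if i is i'.+1 then q i' else P); split=> //.
- by case.
- case=> [_|i]; last exact: chainq.
  split=> [x Px|sub].
    by apply: contrapT => nq; apply: (disP x) => //; exists x, 0%N; rewrite expr0 mulr1.
  apply: (disP a); first by exists 1, 1%N; rewrite expr1 mul1r.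
  by apply: sub; apply: Jq; apply: adjoin_mem.
Qed.

End DepthDimension.

(** * Stanley-Reisner ideals *)

Section SquarefreeIdeals.

Context (K : fieldType) (n : nat).
Local Notation S := {mpoly K[n]}.
Local Notation mon := 'X_{1..n}.
Implicit Types (U : mon -> Prop) (f g : S) (m : mon) (i j : 'I_n).
Implicit Types (F G s : {set 'I_n}) (D : {set {set 'I_n}}).

Definition msupport m : {set 'I_n} := [set j | m j != 0%N].

Definition off_face F m : Prop := ~~ (msupport m \subset F).

Definition off_complex D m : Prop := msupport m \notin D.

Definition mnm_ind s : mon := [multinom (nat_of_bool (j \in s)) | j < n].

Lemma mem_msupport m j : (j \in msupport m) = (m j != 0%N).
Proof. by rewrite inE. Qed.

Lemma off_faceP F m : off_face F m <-> exists2 j, j \notin F & m j != 0%N.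
Proof.
split=> [/subsetPn[j]|[j jF mj]]; first by rewrite mem_msupport; exists j.
by apply/subsetPn; exists j; rewrite // mem_msupport.
Qed.

Lemma msupportS m m' : (m <= m')%MM -> msupport m \subset msupport m'.
Proof.
move=> /mnm_lepP le; apply/subsetP => j; rewrite !mem_msupport -!lt0n => h.
exact: leq_trans (le j).
Qed.

Lemma msupport_ind s : msupport (mnm_ind s) = s.
Proof. by apply/setP => j; rewrite mem_msupport mnmE eqb0 negbK. Qed.

Lemma msupport_muln m N : (0 < N)%N -> msupport (m *+ N)%MM = msupport m.
Proof.
move=> N0; apply/setP => j; rewrite !mem_msupport mulmnE muln_eq0.
by rewrite negb_or -!lt0n N0 andbT.
Qed.

Lemma msupportD m m' : msupport (m + m')%MM = msupport m :|: msupport m'.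
Proof.
by apply/setP => j; rewrite !inE mnmDE addn_eq0 negb_and.
Qed.

Lemma off_face_up F : up_closed (off_face F).
Proof.
move=> m m' /off_faceP[j jF mj] /msupportS/subsetP le; apply/off_faceP.
by exists j => //; rewrite -mem_msupport; apply: le; rewrite mem_msupport.
Qed.

Lemma off_complex_up D : is_complex D -> up_closed (off_complex D).
Proof.
move=> [_ hD] m m' h /msupportS le; apply: contraNN h => h; exact: hD h le.
Qed.

Lemma off_face_invariant F : invariant_on F (off_face F).
Proof.
move=> m m' e /off_faceP[j jF mj]; apply/off_faceP; exists j => //.
by rewrite -e.
Qed.

Lemma face_primeE F : @face_prime K n F = mono (off_face F).
Proof.
rewrite /face_prime (@ideal_gen_mono _ _ (fun m => exists2 i, i \notin F & m = U_(i)%MM)).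
  apply: mono_eq => m; split=> [[_ [i iF ->]]|/off_faceP[j jF mj]].
    by rewrite lep1mP => mi; apply/off_faceP; exists i.
  by exists U_(j)%MM; [exists j | rewrite lep1mP].
move=> f; split=> [[i iF ->]|[_ [i iF ->] ->]]; last by exists i.
by exists U_(i)%MM; first by exists i.
Qed.

Lemma facets_sub D F : F \in facets D -> F \in D.
Proof. by rewrite inE => /maxsetp. Qed.

Lemma facets_antichain D F G :
  F \in facets D -> G \in facets D -> F \subset G -> F = G.
Proof.
rewrite inE => /maxsetP[_ maxF] /facets_sub GD FG.
by rewrite [G]maxF.
Qed.

Lemma facets_above D F : F \in D -> exists2 G, G \in facets D & F \subset G.
Proof.
by move=> /(@maxset_exists _ (fun G => G \in D)) [G hG FG]; exists G; rewrite // inE.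
Qed.

Lemma complex_facet D : is_complex D -> exists F, F \in facets D.
Proof. by move=> [/set0Pn[F /facets_above[G hG _]] _]; exists G. Qed.

Lemma off_complexE D m : is_complex D ->
  off_complex D m <-> (forall F, F \in facets D -> off_face F m).
Proof.
move=> [_ hD]; split=> [h F /facets_sub FD|h].
  by apply: contraNN h; apply: hD.
apply/negP => /facets_above[F /h]; rewrite /off_face => /negP nF hF.
exact: nF.
Qed.

Lemma facet_cap_mono D (J : {set 'I_n} -> S -> Prop) (V : {set 'I_n} -> mon -> Prop) :
  (forall F, F \in facets D -> J F = mono (V F)) ->
  facet_cap D J = mono (fun m => forall F, F \in facets D -> V F m).
Proof.
move=> h; apply: same_predP => f; split=> hf.
  by move=> m fm F FD; have := hf F FD; rewrite h //; apply.
by move=> F FD; rewrite h // => m /hf; apply.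
Qed.

Lemma stanley_reisnerE D : is_complex D -> @stanley_reisner K n D = mono (off_complex D).
Proof.
move=> hD; rewrite /stanley_reisner (facet_cap_mono (fun F _ => face_primeE F)).
by apply: mono_eq => m; apply: iff_sym; apply: off_complexE.
Qed.

Lemma face_prime_prime F : prime_id (mono (off_face F) : S -> Prop).
Proof.
(* P_F is the kernel of the endomorphism [theta] of S that sends the variables outside [F] to 0. *)
pose h i : S := if i \in F then 'X_i else 0.
pose theta : {rmorphism S -> S} := mmap (@mpolyC n K) h.
have thetaE f : theta f = mterms (fun m => msupport m \subset F) id f.
  rewrite /theta /= /mmap /mterms [RHS]big_mkcond /=; apply: eq_bigr => m _.
  rewrite mul_mpolyC /mmap1; case: ifPn => [mF|/subsetPn[j]].
    rewrite mpolyXE_id; congr (_ *: _); apply: eq_bigr => i _; rewrite /h.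
    case: ifPn => // iF; suff -> : m i = 0%N by rewrite !expr0.
    by apply/eqP; apply: contraNT iF; rewrite -mem_msupport; apply: (subsetP mF).
  rewrite mem_msupport => mj jF; rewrite (bigD1 j) //= /h (negPf jF).
  by rewrite expr0n (negPf mj) mul0r scaler0.
have theta0 f : mono (off_face F) f <-> theta f = 0.
  have c k : (theta f)@_k = if msupport k \subset F then f@_k else 0.
    rewrite thetaE (mcoeff_mterms
      (h' := fun k => if msupport k \subset F then Some k else None)).
      by case: ifP.
    move=> m {}k; case: (eqVneq m k) => [->|ne]; case: ifP => //= h1;
      by rewrite ?andbF ?eqxx ?(inj_eq Some_inj) ?(negPf ne).
  split=> [hf|e m fm].
    apply/mpolyP => k; rewrite c mcoeff0; case: ifP => // kF.
    by apply/eqP/negP => /negP/hf; rewrite /off_face kF.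
  apply/negP => mF; have := c m; rewrite e mF mcoeff0 => f0.
  by rewrite -f0 eqxx in fm.
split.
- exact/mono_is_ideal/off_face_up.
- by move=> /theta0/eqP; rewrite rmorph1 oner_eq0.
- move=> x y /theta0/eqP; rewrite rmorphM mulf_eq0 => /orP[]/eqP/theta0; by [left|right].
Qed.

Lemma graded_maxE : @graded_max K n = lin_span (fun i : 'I_n => 'X_i : S).
Proof.
apply: same_predP => f; split.
  apply; first exact: lin_span_is_ideal.
  by move=> _ [i ->]; apply: (lin_span_mem (fun i => 'X_i : S)).
apply: lin_span_min => [|i]; first exact: ideal_gen_is_ideal.
by apply: ideal_gen_sub; exists i.
Qed.

Lemma graded_max_mono : @graded_max K n = mono (off_face set0).
Proof.
rewrite -face_primeE /face_prime /graded_max; congr ideal_gen.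
apply/funext => f; apply/propext; split=> -[i]; last by move=> _ ->; exists i.
by move=> ->; exists i; rewrite ?inE.
Qed.

Lemma graded_max_coef f : @graded_max K n f <-> f@_0%MM = 0.
Proof.
rewrite graded_max_mono; split=> [hf|f0 m fm].
  by apply/eqP/negP => /negP/hf/off_faceP[j _]; rewrite mnm0E.
apply/off_faceP; apply: contrapT => nm; move: fm; suff -> : m = 0%MM by rewrite f0 eqxx.
apply/mnmP => j; rewrite mnm0E; apply/eqP; apply: contra_notT nm => mj.
by exists j; rewrite ?inE.
Qed.

Lemma graded_max_maximal : maximal_id (@graded_max K n).
Proof.
have hM : is_ideal (@graded_max K n) by apply: ideal_gen_is_ideal.
split=> //; first by move=> /graded_max_coef /eqP; rewrite mcoeff1 eqxx oner_eq0.
move=> J hJ MJ J1 f Jf; apply/graded_max_coef/eqP; apply: contra_notT J1 => f0.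
have h : J (f@_0%MM)%:MP.
  have -> : (f@_0%MM)%:MP = f - (f - (f@_0%MM)%:MP) by ring.
  apply: idealB => //; apply/MJ/graded_max_coef.
  by rewrite mcoeffB mcoeffC eqxx mulr1 subrr.
have := idealMr (f@_0%MM)^-1%:MP hJ h.
by rewrite -mpolyCM mulVf // mpolyC1.
Qed.

Lemma mono_sub_graded_max U : ~ U 0%MM -> subpred_of (mono U) (@graded_max K n).
Proof.
by move=> U0 f hf; apply/graded_max_coef/eqP; apply: contra_notT U0 => /hf.
Qed.

Local Notation X := (fun i : 'I_n => 'X_i : S).

Lemma variable_coord (j : 'I_n) :
  exists a : S, [/\ univariate j a, a != 0 & lin_span X a].
Proof.
exists 'X_j; split; last exact: (lin_span_mem X).
  move=> m; rewrite mcoeffX; case: (U_(j)%MM =P m) => [<- _|_]; last by rewrite eqxx.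
  by rewrite mnm1E eqxx mulm1n.
by rewrite -msize_poly_eq0 msizeX.
Qed.

(* [depth_geq U k] says that the depth of [S / mono U] is at least [k]. *)
Definition depth_geq U k := koszul_vanish X (mono U) k.

Lemma depth_geqP U k : up_closed U -> depth_geq U k <->
  exists s : seq S,
    [/\ size s = k, forall a, a \in s -> @graded_max K n a & reg_seq id (mono U) s].
Proof.
move=> upU; have hU := mono_is_ideal K upU; rewrite graded_maxE.
split=> [V|[s [<- sM rs]]]; first exact: (reg_seq_exists (@mpoly_noetherian K n) hU V).
apply: koszul_vanish_reg_seq => // a /sM h.
by exists 1%N; rewrite expr1.
Qed.

Lemma has_depthP U d : up_closed U -> ~ U 0%MM ->
  has_depth (mono U : S -> Prop) d <-> is_max (depth_geq U) d.
Proof.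
move=> upU U0; have hU := mono_is_ideal K upU.
rewrite /has_depth /depth_wrt.
suff -> : (fun k => exists s : seq S,
    [/\ size s = k, forall a, a \in s -> @graded_max K n a
      & regular_for (ideal_ext (mono U)) s]) = depth_geq U by [].
apply/funext => k; apply/propext; rewrite depth_geqP //; split=> -[s [sk sM rs]].
  exists s; split=> //; apply: (proj1 _); exact: (proj1 (regular_forP id s hU)).
exists s; split=> //; apply/(regular_forP id s hU); split=> //.
have [hM M1 _] := graded_max_maximal => h1; apply: M1.
by apply: adjoin_seq_min h1 => //; apply: mono_sub_graded_max.
Qed.

(** A regular sequence in (x) lies in the radical of the ideal of the x_i^N, so vanishing also holds
    for the x_i^N, as the retraction requires. *)
Lemma depth_geq_dilate U k N (c : mon) :
  up_closed U -> (0 < N)%N -> (forall j, (c j < N)%N) ->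
  depth_geq U k -> depth_geq (fun m => U (c + m *+ N)%MM) k.
Proof.
move=> upU N0 cN /depth_geqP[//|s [<- sM rs]].
apply: koszul_vanish_dilate => //.
apply: koszul_vanish_reg_seq => //; first exact: mono_is_ideal.
move=> a /sM; rewrite graded_maxE; apply: lin_span_min.
  exact/radical_is_ideal/lin_span_is_ideal.
by move=> i; exists N; apply: (lin_span_mem (fun i => 'X_i ^+ N : S)).
Qed.

Lemma depth_geq_leq U k l : up_closed U -> (l <= k)%N -> depth_geq U k -> depth_geq U l.
Proof. by move=> upU; apply/koszul_vanish_leq/mono_is_ideal. Qed.

Lemma depth_geq_eq U U' k : (forall m, U m <-> U' m) -> depth_geq U k -> depth_geq U' k.
Proof. by move=> e; rewrite /depth_geq (mono_eq K e). Qed.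

(* The cochain with value 1 at [s] is a cocycle, and not a coboundary since
   coboundaries have coefficients in the graded maximal ideal. *)
Lemma depth_geq_face s k : depth_geq (off_face s) k -> (k <= #|s|)%N.
Proof.
move=> V; rewrite leqNgt; apply/negP => lt.
have hI : is_ideal (mono (off_face s) : S -> Prop) by apply/mono_is_ideal/off_face_up.
pose c (A : {set 'I_n}) : S := (A == s)%:R.
have [B _|b /(_ s lt)] := V c.
  apply: ideal_sum => // j jB; apply: (idealMr _ hI).
  rewrite /c; have [e|_] := eqVneq (B :\ j) s; last by rewrite mulr0; apply: (ideal0 hI).
  rewrite mulr1; apply/mono_X/off_faceP; exists j; last by rewrite mnm1E eqxx.
  by rewrite -e !inE eqxx.
have [hM M1 _] := graded_max_maximal.
rewrite /c eqxx => h1; apply: M1; rewrite -(subrK (kdiff X b s) 1).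
apply: (idealD hM).
  apply: mono_sub_graded_max h1; rewrite /off_face.
  suff -> : msupport 0%MM = set0 by rewrite sub0set.
  by apply/setP => j; rewrite mem_msupport mnm0E inE.
rewrite /kdiff; apply: (@ideal_sum _ _ _ _ _ _ hM) => j _.
apply: (idealMr _ hM); apply: (idealMl _ hM).
by rewrite graded_maxE; apply: (lin_span_mem X).
Qed.

(* [off_face F] is the dilation of [off_complex D] at the product of the variables
   of [F]: algebraically, the prime of [F] is the radical of a colon ideal. *)
Lemma depth_geq_complex_facet D F k : is_complex D -> F \in facets D ->
  depth_geq (off_complex D) k -> (k <= #|F|)%N.
Proof.
move=> hD FD V; apply: depth_geq_face.
have cN j : (mnm_ind F j < 2)%N by rewrite mnmE; case: (j \in F).
have h := depth_geq_dilate (N := 2) (off_complex_up hD) isT cN V.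
apply: (depth_geq_eq _ h) => m.
rewrite /off_complex /off_face msupportD msupport_muln // msupport_ind.
split; apply: contraNN; first by move=> /setUidPl->; apply: facets_sub.
move=> h'.
have [G GD FG] := facets_above h'.
have [FG1 FG2] : F \subset G /\ msupport m \subset G by apply/andP; rewrite -subUset.
by rewrite (facets_antichain FD GD FG1).
Qed.

Lemma bounded_is_max (P : nat -> Prop) k B : P k -> (forall l, P l -> (l <= B)%N) ->
  exists2 d, is_max P d & (k <= d)%N.
Proof.
move=> Pk ub.
have ex : exists l, `[< P l >] by exists k; apply/asboolP.
have ub' l : `[< P l >] -> (l <= B)%N by move/asboolP/ub.
case: (ex_maxnP ex ub') => d /asboolP Pd dmax.
exists d; last exact/dmax/asboolP.
by split=> // e /asboolP; apply: dmax.
Qed.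

Lemma off_complex_proper D : is_complex D -> ~ off_complex D 0%MM.
Proof.
move=> hD; have [F FD] := complex_facet hD; rewrite /off_complex.
suff -> : msupport 0%MM = set0.
  by case: hD => _ h; rewrite (h F) ?sub0set // facets_sub.
by apply/setP => j; rewrite mem_msupport mnm0E inE.
Qed.

Lemma has_depth_complex D d : is_complex D ->
  has_depth (@stanley_reisner K n D) d <-> is_max (depth_geq (off_complex D)) d.
Proof.
move=> hD; rewrite stanley_reisnerE // has_depthP //; first exact: off_complex_up.
exact: off_complex_proper.
Qed.

Lemma has_depth_complex_geq D t : is_complex D -> depth_geq (off_complex D) t ->
  exists2 d, has_depth (@stanley_reisner K n D) d & (t <= d)%N.
Proof.
move=> hD V; have [F FD] := complex_facet hD.
have [d hd td] := bounded_is_max V (fun l => depth_geq_complex_facet hD FD (k := l)).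
by exists d => //; apply/has_depth_complex.
Qed.

End SquarefreeIdeals.

(** * Gluing *)

Section Gluing.

Context (K : fieldType) (n N : nat) (y : 'I_N -> {mpoly K[n]}).
Local Notation mon := 'X_{1..n}.
Local Notation V U k := (koszul_vanish y (mono U) k).
Implicit Types (U : mon -> Prop) (m : mon) (F W s : {set 'I_n}).

Definition some_of (T : eqType) (Q : T -> mon -> Prop) (l : seq T) : mon -> Prop :=
  fun m => exists2 i, i \in l & Q i m.

Definition all_of (T : eqType) (Q : T -> mon -> Prop) (l : seq T) : mon -> Prop :=
  fun m => forall i, i \in l -> Q i m.

Lemma all_of_up (T : eqType) (Q : T -> mon -> Prop) l :
  (forall i, up_closed (Q i)) -> up_closed (all_of Q l).
Proof. by move=> up m m' h le i il; apply: up (h i il) le. Qed.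

Lemma vanish_cap U U' k : up_closed U -> up_closed U' ->
  V U k -> V U' k -> V (fun m => U m \/ U' m) k.-1 -> V (fun m => U m /\ U' m) k.
Proof.
move=> up up' h1 h2; rewrite -mono_sum -mono_cap.
by apply: koszul_vanish_cap => //; apply: mono_is_ideal.
Qed.

Lemma vanish_sum U U' k : up_closed U -> up_closed U' ->
  V U k -> V U' k -> V (fun m => U m /\ U' m) k.+1 -> V (fun m => U m \/ U' m) k.
Proof.
move=> up up' h1 h2; rewrite -mono_sum -mono_cap.
by apply: koszul_vanish_sum => //; apply: mono_is_ideal.
Qed.

Lemma some_of1 (T : eqType) (Q : T -> mon -> Prop) i m :
  some_of Q [:: i] m <-> Q i m.
Proof.
by split=> [[j]|h]; [rewrite inE => /eqP-> | exists i; rewrite ?inE].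
Qed.

Lemma all_of1 (T : eqType) (Q : T -> mon -> Prop) i m :
  all_of Q [:: i] m <-> Q i m.
Proof.
split=> [h|h j]; first by apply: h; rewrite inE.
by rewrite inE => /eqP->.
Qed.

Lemma some_of_cons (T : eqType) (Q : T -> mon -> Prop) i l m :
  some_of Q (i :: l) m <-> Q i m \/ some_of Q l m.
Proof.
split=> [[j]|[h|[j jl h]]]; last by exists j; rewrite // inE jl orbT.
  by rewrite inE => /orP[/eqP->|jl]; [left | right; exists j].
by exists i; rewrite // inE eqxx.
Qed.

Lemma all_of_cons (T : eqType) (Q : T -> mon -> Prop) i l m :
  all_of Q (i :: l) m <-> Q i m /\ all_of Q l m.
Proof.
split=> [h|[h1 h2] j]; last by rewrite inE => /orP[/eqP->|/h2].
by split=> [|j jl]; apply: h; rewrite inE ?eqxx ?jl ?orbT.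
Qed.

Lemma some_of_or (T : eqType) (Q : T -> mon -> Prop) U l m : l != [::] ->
  some_of (fun i m => U m \/ Q i m) l m <-> U m \/ some_of Q l m.
Proof.
case: l => // i l _; split=> [[j jl [h|h]]|[h|[j jl h]]]; first by left.
- by right; exists j.
- by exists i; [rewrite inE eqxx | left].
- by exists j => //; right.
Qed.

Lemma all_of_or (T : eqType) (Q : T -> mon -> Prop) U l m :
  all_of (fun i m => U m \/ Q i m) l m <-> U m \/ all_of Q l m.
Proof.
split=> [h|[h|h] i il]; [|by left|by right; apply: h].
case: (pselect (U m)) => Um; [by left|right=> i il].
by case: (h i il).
Qed.

Lemma vanish_eq U U' k : (forall m, U m <-> U' m) -> V U k -> V U' k.
Proof. by move=> e; rewrite (mono_eq K e). Qed.

(* Mayer-Vietoris, using that monomial ideals form a distributive lattice. *)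
Lemma glue (T : eqType) (Q : T -> mon -> Prop) (l : seq T) t :
  (forall i, up_closed (Q i)) -> l != [::] ->
  (forall l', subseq l' l -> l' != [::] -> V (some_of Q l') (t.+1 - size l')) ->
  V (all_of Q l) t.
Proof.
elim: l t Q => // i l IH t Q up _ h.
have [l0|l0] := eqVneq l [::].
  have := h [:: i]; rewrite l0 subn1 => /(_ (subseq_refl _) isT).
  by apply: vanish_eq => m; rewrite some_of1 all_of1.
case: t h => [|t] h; first exact: koszul_vanish0.
suff : V (fun m => Q i m /\ all_of Q l m) t.+1.
  by apply: vanish_eq => m; rewrite all_of_cons.
apply: vanish_cap => //; first exact: all_of_up.
- have := h [:: i]; rewrite sub1seq mem_head subn1 => /(_ isT isT).
  by apply: vanish_eq => m; rewrite some_of1.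
- apply: IH => // l' sub l'0; apply: h => //.
  exact: subseq_trans sub (subseq_cons _ _).
(* By distributivity the sum of [Q i] with the intersection of the others is the intersection of the
   sums, a family to which induction applies with [t] lowered by one. *)
- have : V (all_of (fun j m => Q i m \/ Q j m) l) t.
    apply: IH => // [j|l' sub l'0].
      by move=> m m' [h'|h'] le; [left|right]; apply: up h' le.
    have := h (i :: l'); rewrite /= eqxx => /(_ sub isT); rewrite subSS.
    by apply: vanish_eq => m; rewrite some_of_or // some_of_cons.
  by apply: vanish_eq => m; rewrite all_of_or.
Qed.

(** Induction on the list for the shifted family [Q i m \/ Q j m]: its intersections are sums of two
    ideals whose intersection is controlled, and the sequence for a sum costs one degree. *)
Lemma unglue (T : eqType) (Q : T -> mon -> Prop) (l : seq T) t :
  (forall i, up_closed (Q i)) -> l != [::] ->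
  (forall l', subseq l' l -> l' != [::] -> V (all_of Q l') t) ->
  V (some_of Q l) (t.+1 - size l).
Proof.
elim: l t Q => // i l IH t Q up _ h.
have [l0|l0] := eqVneq l [::].
  rewrite l0 subn1; have := h [:: i]; rewrite l0 => /(_ (subseq_refl _) isT).
  by apply: vanish_eq => m; rewrite some_of1 all_of1.
case: t h => [|t] h; first by rewrite /= subSS sub0n; apply: koszul_vanish0.
have upl l' : up_closed (all_of Q l') by apply: all_of_up.
suff : V (some_of (fun j m => Q i m \/ Q j m) l) (t.+1 - size l).
  by rewrite /= subSS; apply: vanish_eq => m; rewrite some_of_or // some_of_cons.
apply: IH => // [j|l' sub l'0].
  by move=> m m' [h'|h'] le; [left|right]; apply: up h' le.
suff : V (fun m => Q i m \/ all_of Q l' m) t.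
  by apply: vanish_eq => m; rewrite all_of_or.
apply: vanish_sum => //.
- apply: (@koszul_vanish_leq _ _ _ _ t.+1) => //; first exact: mono_is_ideal.
  have := h [:: i]; rewrite sub1seq mem_head => /(_ isT isT).
  by apply: vanish_eq => m; rewrite all_of1.
- apply: (@koszul_vanish_leq _ _ _ _ t.+1) => //; first exact: mono_is_ideal.
  by apply: h => //; apply: subseq_trans sub (subseq_cons _ _).
- have := h (i :: l'); rewrite /= eqxx => /(_ sub isT).
  by apply: vanish_eq => m; rewrite all_of_cons.
Qed.

Lemma glue_set (T : finType) (Q : T -> mon -> Prop) (A : {set T}) t :
  (forall i, up_closed (Q i)) -> A != set0 ->
  (forall B : {set T}, B \subset A -> B != set0 ->
     V (fun m => exists2 i, i \in B & Q i m) (t.+1 - #|B|)) ->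
  V (fun m => forall i, i \in A -> Q i m) t.
Proof.
move=> up A0 h; suff : V (all_of Q (enum A)) t.
  by apply: vanish_eq => m; split=> h' i iA; apply: h'; rewrite mem_enum in iA *.
apply: glue => // [|l sub l0]; first by rewrite -size_eq0 -cardE cards_eq0.
have ul : uniq l by apply: subseq_uniq sub _; apply: enum_uniq.
have := h [set i in l]; rewrite cardsE (card_uniqP ul) => h'.
suff : V (fun m => exists2 i, i \in [set i in l] & Q i m) (t.+1 - size l).
  by apply: vanish_eq => m; split=> -[i il Qi]; exists i; rewrite // inE in il *.
apply: h'; first by apply/subsetP => i; rewrite inE => /(mem_subseq sub); rewrite mem_enum.
by apply: contraNneq l0 => l0; case: l l0 {sub ul} => // i l /setP/(_ i); rewrite !inE eqxx.
Qed.

Lemma unglue_set (T : finType) (Q : T -> mon -> Prop) (A : {set T}) t :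
  (forall i, up_closed (Q i)) -> A != set0 ->
  (forall B : {set T}, B \subset A -> B != set0 ->
     V (fun m => forall i, i \in B -> Q i m) t) ->
  V (fun m => exists2 i, i \in A & Q i m) (t.+1 - #|A|).
Proof.
move=> up A0 h; suff : V (some_of Q (enum A)) (t.+1 - size (enum A)).
  rewrite -cardE; apply: vanish_eq => m.
  by split=> -[i iA Qi]; exists i; rewrite // mem_enum in iA *.
apply: unglue => // [|l sub l0]; first by rewrite -size_eq0 -cardE cards_eq0.
suff : V (fun m => forall i, i \in [set i in l] -> Q i m) t.
  by apply: vanish_eq => m; split=> h' i il; apply: h'; rewrite inE in il *.
apply: h; first by apply/subsetP => i; rewrite inE => /(mem_subseq sub); rewrite mem_enum.
by apply: contraNneq l0 => l0; case: l l0 {sub} => // i l /setP/(_ i); rewrite !inE eqxx.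
Qed.

(** This holds for the variables themselves by [variable_coord], and for generators of any maximal
    ideal by [nullstellensatz]. *)
Hypothesis y_coord : forall j : 'I_n,
  exists a, [/\ univariate j a, a != 0 & lin_span y a].

Lemma vanish_invariant U s : up_closed U -> invariant_on s U -> V U #|s|.
Proof. by move=> up inv; apply: koszul_vanish_invariant. Qed.

(* The support of [m] is not a face of the join of the simplex on [W] with the
   skeleton of [F] whose facets have [j] elements. *)
Definition off_join W F (j : nat) m : Prop :=
  ~~ ((msupport m \subset W :|: F) && (#|msupport m :\: W| <= j)%N).

Lemma off_join_up W F j : up_closed (off_join W F j).
Proof.
move=> m m' h /msupportS le; apply: contraNN h => /andP[h1 h2].
rewrite (subset_trans le h1) /=; apply: leq_trans h2.
by apply/subset_leq_card/setSD.
Qed.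

(** For v in [F], the complex is the union of the faces avoiding v and the star of v. Both are joins
    of the same kind over [F :\ v], and so is their intersection, with [j] and the depth lowered by
    one. The recursion ends in simplices, at [j] equal to 0 or to #|F|. *)
Lemma off_join_vanish W F j : [disjoint W & F] -> (j <= #|F|)%N ->
  V (off_join W F j) (#|W| + j).
Proof.
have [k] := ubnP #|F|; elim: k W F j => // k IH W F j Fk dWF jF.
have [jE|jne] := eqVneq j #|F|.
  rewrite jE -cardsUI; move: (dWF); rewrite -setI_eq0 => /eqP ->; rewrite cards0 addn0.
  suff : V (off_face (W :|: F)) #|W :|: F|.
    apply: vanish_eq => m; rewrite /off_join /off_face; split; last first.
      apply: contraNN => h; rewrite h /=; apply/subset_leq_card/subsetP => i.
      by rewrite inE => /andP[iW /(subsetP h)]; rewrite inE (negPf iW).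
    by apply: contraNN => /andP[].
  by apply: vanish_invariant; [apply: off_face_up | apply: off_face_invariant].
have [j0|jpos] := posnP j.
  rewrite j0 addn0; suff : V (off_face W) #|W|.
    apply: vanish_eq => m; rewrite /off_join /off_face leqn0 cards_eq0 setD_eq0.
    split; apply: contraNN; first by move=> /andP[].
    by move=> h; rewrite h subsetU // h.
  by apply: vanish_invariant; [apply: off_face_up | apply: off_face_invariant].
have [v vF] : exists v, v \in F by apply/card_gt0P; lia.
have vW : v \notin W by apply: contraTN dWF => vW; apply/pred0Pn; exists v; rewrite /= vW.
have cF : #|F| = (#|F :\ v|).+1 by rewrite (cardsD1 v) vF.
have dW' : [disjoint W & F :\ v].
  by apply: disjointWr dWF; apply: subD1set.
have dvW' : [disjoint v |: W & F :\ v].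
  rewrite -setI_eq0 setIUl setU_eq0 setI_eq0 (setI_eq0 W) dW' andbT.
  by rewrite disjoints1 !inE eqxx.
have V1 : V (off_join W (F :\ v) j) (#|W| + j).
  by apply: IH => //; lia.
have V2 : V (off_join (v |: W) (F :\ v) j.-1) (#|W| + j).
  have -> : (#|W| + j = #|v |: W| + j.-1)%N by rewrite cardsU1 vW; lia.
  by apply: IH => //; lia.
have V3 : V (off_join W (F :\ v) j.-1) (#|W| + j).-1.
  have -> : ((#|W| + j).-1 = #|W| + j.-1)%N by lia.
  by apply: IH => //; lia.
have sub1 m : (msupport m \subset W :|: F :\ v) =
    (msupport m \subset W :|: F) && (v \notin msupport m).
  have [vm|vm] /= := boolP (v \in msupport m).
    by rewrite andbF; apply/negP => /subsetP/(_ v vm); rewrite !inE eqxx (negPf vW).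
  rewrite andbT; apply/subsetP/subsetP => h i im; have := h i im; rewrite !inE.
    by case: (i \in W) => //= /andP[].
  case: (i \in W) => //= ->; rewrite andbT.
  by apply: contraNneq vm => <-.
have sub2 m : (msupport m \subset (v |: W) :|: F :\ v) = (msupport m \subset W :|: F).
  suff -> : (v |: W) :|: F :\ v = W :|: F by [].
  apply/setP => i; rewrite !inE.
  by case: (eqVneq i v) => [->|] //=; rewrite vF orbT.
have cE m : #|msupport m :\: W| = ((v \in msupport m) + #|msupport m :\: (v |: W)|)%N.
  rewrite (cardsD1 v) inE vW /=; congr (_ + _)%N; apply: eq_card => i.
  by rewrite !inE negb_or andbA.
suff : V (fun m => off_join W (F :\ v) j m /\ off_join (v |: W) (F :\ v) j.-1 m) (#|W| + j).
  apply: vanish_eq => m; rewrite /off_join sub1 sub2 cE.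
  case: (_ \subset _) => //=; case: (v \in _) => /=.
    by split=> [[_ h]|h]; [|split=> //]; lia.
  by split=> [[]|h]; last split; lia.
apply: vanish_cap => //; try exact: off_join_up.
move: V3; apply: vanish_eq => m; rewrite /off_join sub1 sub2 cE.
case: (_ \subset _) => /=; last by split=> // _; left.
case: (v \in _) => /=; first by split=> // _; left.
by split=> [h|[]]; [right|..]; lia.
Qed.

End Gluing.

(** * The intersection condition on facets *)

Section FacetConditions.

Context (K : fieldType) (n : nat) (D : {set {set 'I_n}}) (t : nat).
Hypothesis cplxD : is_complex D.
Local Notation S := {mpoly K[n]}.
Local Notation mon := 'X_{1..n}.
Local Notation X := (fun i : 'I_n => 'X_i : S).
Implicit Types (U : mon -> Prop) (m : mon) (F H : {set 'I_n}).
Implicit Types (A B G C : {set {set 'I_n}}).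

Definition facet_bound : Prop := forall k : nat, (1 <= k <= minn #|facets D| t)%N ->
  forall A, A \subset facets D -> #|A| = k ->
  (t - k + 1 <= #|\bigcap_(F in A) F|)%N.

Definition gen_complex A : {set {set 'I_n}} := 
  [set H : {set 'I_n} | [exists F in A, H \subset F]].

Lemma gen_complexP A H : reflect (exists2 F, F \in A & H \subset F) (H \in gen_complex A).
Proof. by rewrite inE; apply: (iffP exists_inP) => -[F FA HF]; exists F. Qed.

Lemma facets_gen_complex A : A \subset facets D -> facets (gen_complex A) = A.
Proof.
move=> /subsetP AD; apply/setP => H; apply/idP/idP => [hH|HA].
  have /gen_complexP[F FA HF] := facets_sub hH.
  have FG : F \in gen_complex A by apply/gen_complexP; exists F.
  move: hH; rewrite inE => /maxsetP[_ /(_ F FG HF) <-] //.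
rewrite inE; apply/maxsetP; split; first by apply/gen_complexP; exists H.
move=> H' /gen_complexP[F FA H'F] HH'.
have e := facets_antichain (AD _ HA) (AD _ FA) (subset_trans HH' H'F).
by apply/eqP; rewrite eqEsubset HH' andbT e.
Qed.

Lemma gen_complex_sub A : A \subset facets D -> A != set0 ->
  facet_subcomplex D (gen_complex A).
Proof.
move=> AD A0; split; last by rewrite facets_gen_complex.
  split.
    by have /set0Pn[F FA] := A0; apply/set0Pn; exists F; apply/gen_complexP; exists F.
  move=> F H /gen_complexP[F' F'A FF'] HF; apply/gen_complexP; exists F' => //.
  exact: subset_trans FF'.
apply/subsetP => H /gen_complexP[F /(subsetP AD) /facets_sub FD HF].
by case: cplxD => _; apply; [exact: FD|].
Qed.

Lemma off_gen_complex A m : A \subset facets D -> A != set0 ->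
  off_complex (gen_complex A) m <-> (forall F, F \in A -> off_face F m).
Proof.
move=> AD A0; have [cA _ _] := gen_complex_sub AD A0.
by rewrite off_complexE // facets_gen_complex.
Qed.

Lemma some_off_face B m :
  (exists2 F, F \in B & off_face F m) <-> off_face (\bigcap_(F in B) F) m.
Proof.
split=> [[F FB]|].
  by apply: contraNN => h; apply: subset_trans h _; apply: bigcap_inf.
move=> h; apply: contrapT => nF; move/negP: h; apply; apply/bigcapsP => F FB.
by apply: contrapT => nF'; apply: nF; exists F => //; apply/negP.
Qed.

Lemma facet_bound_card B : facet_bound -> B \subset facets D -> B != set0 ->
  (t.+1 - #|B| <= #|\bigcap_(F in B) F|)%N.
Proof.
move=> hf BD B0; have [le|gt] := leqP #|B| t; last first.
  by have -> : (t.+1 - #|B| = 0)%N by apply/eqP; rewrite subn_eq0.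
have B1 : (0 < #|B|)%N by rewrite card_gt0.
have := hf #|B| _ B BD erefl; rewrite leq_min B1 le subset_leq_card // => /(_ isT).
by rewrite addn1 subSn.
Qed.

Lemma facets_neq0 C : is_complex C -> facets C != set0.
Proof. by move=> /complex_facet[F FC]; apply/set0Pn; exists F. Qed.

Lemma vanish_of_facet_bound N (y : 'I_N -> S) (Q : {set 'I_n} -> mon -> Prop) :
  (forall j : 'I_n, exists a, [/\ univariate j a, a != 0 & lin_span y a]) ->
  facet_bound -> (forall F, up_closed (Q F)) -> (forall F, invariant_on F (Q F)) ->
  koszul_vanish y (mono (fun m => forall F, F \in facets D -> Q F m)) t.
Proof.
move=> hy hf up inv; apply: glue_set => //; first exact: facets_neq0.
move=> B BD B0; have upB : up_closed (fun m => exists2 F, F \in B & Q F m).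
  by move=> m m' [F FB h] le; exists F => //; apply: up h le.
apply: (koszul_vanish_leq (mono_is_ideal K upB) (facet_bound_card hf BD B0)).
apply: vanish_invariant => // m m' e [F FB h]; exists F => //.
apply: inv h => j jF; apply: e; apply: contraNN jF => /bigcapP; exact.
Qed.

Lemma skeletonP C m :
  off_complex (skeleton C (t%:Z - 1)) m <->
  off_complex C m \/ ~~ (#|msupport m| <= t)%N.
Proof.
rewrite /off_complex /skeleton inE negb_and /face_dim Num.Theory.lerD2r lez_nat.
by split=> [/orP[]|[->|->]]; rewrite ?orbT //; [left|right].
Qed.

Lemma skeleton_complex C : is_complex C -> is_complex (skeleton C (t%:Z - 1)).
Proof.
move=> hC; have [F /facets_sub FC] := complex_facet hC; have [_ dC] := hC; split.
  apply/set0Pn; exists set0; rewrite inE (dC F) ?sub0set //=.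
  by rewrite /face_dim Num.Theory.lerD2r lez_nat cards0.
move=> H H'; rewrite !inE => /andP[HC Hd] H'H; rewrite (dC H) //=.
by move: Hd; rewrite /face_dim !Num.Theory.lerD2r !lez_nat; apply/leq_trans/subset_leq_card.
Qed.

Lemma off_skeletonE C m : is_complex C ->
  off_complex (skeleton C (t%:Z - 1)) m <->
  (forall F, F \in facets C -> off_join set0 F t m).
Proof.
move=> hC; rewrite skeletonP off_complexE // /off_join; split.
  move=> [h|h] F FC; rewrite set0U setD0 negb_and; last by rewrite h orbT.
  by have := h F FC; rewrite /off_face => ->.
move=> h; case: (boolP (#|msupport m| <= t)%N) => le; last by right.
by left=> F /h; rewrite set0U setD0 le andbT.
Qed.

Lemma some_off_join B m :
  (exists2 F, F \in B & off_join set0 F t m) <->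
  (if B == set0 then False else off_join set0 (\bigcap_(F in B) F) t m).
Proof.
have [->|B0] := eqVneq B set0; first by split=> // -[F]; rewrite inE.
rewrite /off_join set0U setD0 negb_and; split.
  move=> [F FB]; rewrite set0U ?setD0 negb_and => /orP[h|->]; last by rewrite orbT.
  by apply/orP; left; apply/some_off_face; exists F.
move=> /orP[/some_off_face[F FB h]|h].
  by exists F => //; rewrite set0U ?setD0 negb_and; apply/orP; left.
by have /set0Pn[F FB] := B0; exists F => //; rewrite set0U ?setD0 negb_and h orbT.
Qed.

(** This replaces [t] by a bound of at most #|F|, as [off_join_vanish] requires. *)
Lemma off_join_minn F m : off_join set0 F (minn t #|F|) m <-> off_join set0 F t m.
Proof.
rewrite /off_join set0U setD0; split; apply: contraNN => /andP[h le].
  by rewrite h leq_min le; apply: subset_leq_card.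
by rewrite h; move: le; rewrite leq_min => /andP[].
Qed.

Lemma skeleton_vanish N (y : 'I_N -> S) G :
  (forall j : 'I_n, exists a, [/\ univariate j a, a != 0 & lin_span y a]) ->
  facet_bound -> facet_subcomplex D G ->
  koszul_vanish y (mono (off_complex (skeleton G (t%:Z - 1)))) t.
Proof.
move=> hy hf [hG _ GD].
suff : koszul_vanish y (mono (fun m => forall F, F \in facets G -> off_join set0 F t m)) t.
  by apply: vanish_eq => m; rewrite off_skeletonE.
apply: glue_set => [F||B BG B0]; [exact: off_join_up|exact: facets_neq0|].
have BD := subset_trans BG GD.
suff : koszul_vanish y (mono (off_join set0 (\bigcap_(F in B) F) t)) (t.+1 - #|B|).
  by apply: vanish_eq => m; rewrite some_off_join (negPf B0).
have le : (t.+1 - #|B| <= minn t #|\bigcap_(F in B) F|)%N.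
  rewrite leq_min facet_bound_card // andbT.
  by have : (0 < #|B|)%N by [rewrite card_gt0]; lia.
have dis : [disjoint set0 & \bigcap_(F in B) F] by rewrite -setI_eq0 set0I.
have up := off_join_up (W := set0) (F := \bigcap_(F in B) F) (j := t).
apply: (koszul_vanish_leq (mono_is_ideal K up) le).
have := off_join_vanish hy dis (geq_minr t _).
by rewrite cards0 add0n; apply: vanish_eq => m; apply: off_join_minn.
Qed.

(** Otherwise choose an element outside [P] in each face prime. Their product lies in the
    Stanley-Reisner ideal, so a power of it lies in [P]. *)
Lemma prime_above_facet C (I P : S -> Prop) : is_complex C ->
  same_pred (radical I) (@stanley_reisner K n C) -> prime_id P -> subpred_of I P ->
  exists2 F, F \in facets C & subpred_of (mono (off_face F)) P.
Proof.
move=> hC rad pP IP; have [hP P1 hPP] := pP; apply: contrapT => none.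
have /choice [x hx] F : exists x : S, F \in facets C -> mono (off_face F) x /\ ~ P x.
  case: (boolP (F \in facets C)) => FC; last by exists 0.
  apply: contrapT => nx; apply: none; exists F => // z hz.
  by apply: contrapT => nz; apply: nx; exists z.
have : stanley_reisner C (\prod_(F in facets C) x F).
  move=> F FC; rewrite face_primeE (bigD1 F) //=.
  apply: (idealMl _ (mono_is_ideal K (@off_face_up n F))).
  by case: (hx F FC).
move=> /rad[k /IP]; rewrite -prodrXl => h.
have : exists2 F, F \in facets C & P (x F ^+ k).
  move: h; rewrite -big_filter => /(prime_prod pP)[F].
  by rewrite mem_filter => /andP[FC _] ?; exists F.
move=> [F FC]; elim: k {h} => [//|k IH]; rewrite exprS => /hPP[|//].
by case: (hx F FC).
Qed.

Lemma radical_stanley_reisner C : is_complex C ->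
  same_pred (radical (@stanley_reisner K n C)) (stanley_reisner C).
Proof.
move=> hC f; split=> [[k hk] F FC|hf]; last by exists 1%N; rewrite expr1.
have [_ p1 pp] := face_prime_prime K F; rewrite face_primeE.
have := hk F FC; rewrite face_primeE.
by elim: k {hk} => [//|k IH]; rewrite exprS => /pp[].
Qed.

Lemma skeleton_cohen_macaulay G : facet_bound -> facet_subcomplex D G ->
  cohen_macaulay K (skeleton G (t%:Z - 1)).
Proof.
move=> hf hG M maxM; have [cG _ _] := hG.
have cS := skeleton_complex cG; set Sk := skeleton G _ in cS *.
rewrite stanley_reisnerE // => IM; set I := mono _ in IM *.
have hI : is_ideal I by apply/mono_is_ideal/off_complex_up.
have pM := maximal_prime maxM; have [hM M1 hMM] := pM.
have [N [y My]] := noetherian_fg (@mpoly_noetherian K n) hM.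
have hy (j : 'I_n) : exists a, [/\ univariate j a, a != 0 & lin_span y a].
  by have [a [ua a0 Ma]] := nullstellensatz j maxM; exists a; rewrite -My.
have V := skeleton_vanish hy hf hG.
have [s [ss sM rs]] := reg_seq_exists (@mpoly_noetherian K n) hI V.
rewrite -My in sM; have lrs := reg_seq_loc M rs.
(* This bound on chains of primes serves twice: for the dimension, and through [reg_seq_prime_chain]
   for the depth. *)
have bound k (p : nat -> S -> Prop) :
  (forall i, (i <= k)%N -> prime_id (p i)) -> subpred_of I (p 0%N) ->
  (forall i, (i < k)%N -> subpred_of (p i) (p i.+1) /\ ~ subpred_of (p i.+1) (p i)) ->
  (k <= t)%N.
  move=> pp Ip ch; have := radical_stanley_reisner cS; rewrite stanley_reisnerE // => rad.
  have [|F FS Fp] := @prime_above_facet Sk I (p 0%N) cS _ (pp 0%N (leq0n k)) Ip.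
    by move=> f; rewrite stanley_reisnerE.
  have Ft : (#|F| <= t)%N.
    have := facets_sub FS; rewrite inE => /andP[_].
    by rewrite /face_dim Num.Theory.lerD2r lez_nat.
  apply: leq_trans Ft; apply: (prime_chain_length pp ch) => j jF.
  by apply/Fp/mono_X/off_faceP; exists j; rewrite // mnm1E eqxx.
exists t; split.
- exists s; split=> //; apply/(regular_forP (loc_ideal M) s hI); split=> //.
  move=> [u nu]; rewrite mulr1 => hu; apply: nu.
  exact: adjoin_seq_min hu.
- move=> e [s' [<- s'M /(regular_forP (loc_ideal M) s' hI)[rs' _]]].
  have [p [pp Ip _ ch]] := reg_seq_prime_chain (@mpoly_noetherian K n) maxM hI rs' IM s'M.
  exact: bound pp Ip ch.
- by rewrite -ss; apply: (reg_seq_prime_chain (@mpoly_noetherian K n) maxM hI lrs IM sM).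
- by move=> e [p [pp Ip _ ch]]; apply: bound pp Ip ch.
Qed.

Lemma facet_bound_of_subcomplexes :
  (forall A, A \subset facets D -> A != set0 -> depth_geq K (off_complex (gen_complex A)) t) ->
  facet_bound.
Proof.
move=> h k /andP[k1]; rewrite leq_min => /andP[_ kt] A AD Ak.
have A0 : A != set0 by rewrite -card_gt0 Ak.
have : depth_geq K (fun m => exists2 F, F \in A & off_face F m) (t.+1 - #|A|).
  apply: unglue_set => // [F|B BA B0]; first exact: off_face_up.
  have BD := subset_trans BA AD.
  by apply: vanish_eq (h B BD B0) => m; apply: off_gen_complex.
move=> /(depth_geq_eq (some_off_face A)) /depth_geq_face.
by rewrite Ak addn1 subSn.
Qed.

Lemma facet_bound_of_skeletons :
  (forall A, A \subset facets D -> A != set0 ->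
    depth_geq K (off_complex (skeleton (gen_complex A) (t%:Z - 1))) t) ->
  facet_bound.
Proof.
move=> h k /andP[k1]; rewrite leq_min => /andP[_ kt] A AD Ak.
have A0 : A != set0 by rewrite -card_gt0 Ak.
have V : depth_geq K (fun m => exists2 F, F \in A & off_join set0 F t m) (t.+1 - #|A|).
  apply: unglue_set => // [F|B BA B0]; first exact: off_join_up.
  have BD := subset_trans BA AD; have [cB _ _] := gen_complex_sub BD B0.
  apply: vanish_eq (h B BD B0) => m.
  by rewrite off_skeletonE // facets_gen_complex.
(* If the intersection has fewer than [t] elements, its skeleton is the full simplex, whose depth is
   the number of its vertices. *)
have [le|gt] := leqP t #|\bigcap_(F in A) F|; first by lia.
suff : depth_geq K (off_face (\bigcap_(F in A) F)) (t.+1 - #|A|).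
  by move=> /depth_geq_face; rewrite Ak addn1 subSn.
apply: depth_geq_eq V => m; rewrite some_off_join (negPf A0) /off_join /off_face.
rewrite set0U setD0; split; apply: contraNN; last by move=> /andP[].
by move=> sub; rewrite sub /=; apply: leq_trans (ltnW gt); apply: subset_leq_card.
Qed.

End FacetConditions.

(** * Depth of intersections of primary monomial ideals *)

Section RigidDepth.

Context (K : fieldType) (n : nat) (D : {set {set 'I_n}}).
Hypothesis cplxD : is_complex D.
Local Notation S := {mpoly K[n]}.
Local Notation mon := 'X_{1..n}.
Implicit Types (U : mon -> Prop) (m : mon) (F H s : {set 'I_n}) (I P : S -> Prop).
Implicit Types (A B G C : {set {set 'I_n}}) (Q : {set 'I_n} -> mon -> Prop).

Lemma mnm_ind_le s m : s \subset msupport m -> (mnm_ind s <= m)%MM.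
Proof.
move=> /subsetP h; apply/mnm_lepP => j; rewrite mnmE.
by case: (boolP (j \in s)) => // /h; rewrite mem_msupport lt0n.
Qed.

Lemma mnm_muln_le m m' N : (m <= m')%MM -> (m *+ N <= m' *+ N)%MM.
Proof.
by move=> /mnm_lepP h; apply/mnm_lepP => j; rewrite !mulmnE leq_mul2r h orbT.
Qed.

Lemma mnm_muln_leq m N N' : (N <= N')%N -> (m *+ N <= m *+ N')%MM.
Proof. by move=> h; apply/mnm_lepP => j; rewrite !mulmnE leq_mul2l h orbT. Qed.

Lemma mono_radical_X U m : radical (mono U : S -> Prop) 'X_[m] <-> exists N, U (m *+ N)%MM.
Proof.
by split=> -[N]; [rewrite mpolyXn => /mono_X; exists N | exists N; rewrite mpolyXn; apply/mono_X].
Qed.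

Lemma radical_dilation U : up_closed U ->
  same_pred (radical (mono U)) (@stanley_reisner K n D) ->
  exists2 N, (0 < N)%N & forall m, U (m *+ N)%MM <-> off_complex D m.
Proof.
move=> upU rad; have radX m : (exists N, U (m *+ N)%MM) <-> off_complex D m.
  by rewrite -mono_radical_X rad stanley_reisnerE //; apply: mono_X.
have /choice [k hk] s : exists k, s \notin D -> U (mnm_ind s *+ k)%MM.
  have [sD|sD] := boolP (s \in D); first by exists 0%N.
  have /radX[k hk] : off_complex D (mnm_ind s) by rewrite /off_complex msupport_ind.
  by exists k.
(* There are finitely many squarefree monomials, and this exponent works for all of them; the
   successor makes it positive. *)
exists (\sum_s k s).+1 => // m; split=> [h|h]; first by apply/radX; exists (\sum_s k s).+1.
apply: (upU (mnm_ind (msupport m) *+ k (msupport m))%MM); first exact: hk.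
apply: lepm_trans (mnm_muln_le _ (mnm_ind_le (subxx _))) _; apply: mnm_muln_leq.
by rewrite (bigD1 (msupport m)) //= leqW // leq_addr.
Qed.

(* Dilating by a large [N] turns [mono U] into its radical, so that the depth of
   [S / mono U] is at most that of the Stanley-Reisner ring. *)
Lemma depth_of_radical U t : up_closed U ->
  same_pred (radical (mono U)) (@stanley_reisner K n D) ->
  has_depth (@stanley_reisner K n D) t -> depth_geq K U t -> has_depth (mono U : S -> Prop) t.
Proof.
move=> upU rad /(has_depth_complex _ _ cplxD)[_ tmax] Ut.
have [N N0 hN] := radical_dilation upU rad.
have U0 : ~ U 0%MM.
  move=> u0; apply: (off_complex_proper cplxD); apply/hN.
  by apply: upU u0 _; apply/mnm_lepP => j; rewrite mnm0E.
apply/has_depthP => //; split=> // e Ue; apply: tmax.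
have c0 j : ((0%MM : mon) j < N)%N by rewrite mnm0E.
apply: depth_geq_eq (depth_geq_dilate upU N0 c0 Ue) => m.
by rewrite add0m.
Qed.

Lemma radical_family Q : (forall F, up_closed (Q F)) ->
  (forall F, F \in facets D -> forall m, Q F m -> off_face F m) ->
  (forall F, F \in facets D -> forall j, j \notin F -> exists N, Q F (U_(j) *+ N)%MM) ->
  same_pred (radical (mono (fun m => forall F, F \in facets D -> Q F m)))
    (@stanley_reisner K n D).
Proof.
move=> up sub pow; set U := fun m => _.
have upU : up_closed U by move=> m m' h le F FD; apply: up (h F FD) le.
move=> f; split=> [[k hk]|].
  apply: (proj1 (radical_stanley_reisner cplxD f)); exists k.
  rewrite stanley_reisnerE //; apply: mono_sub hk => m h.
  by apply/off_complexE => // F FD; apply: sub (h F FD).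
rewrite stanley_reisnerE // => hf; apply: mono_terms.
  exact/radical_is_ideal/mono_is_ideal.
move=> m /hf /(off_complexE _ cplxD) hm; apply/mono_radical_X.
have /choice [N hN] F : exists N, F \in facets D -> Q F (m *+ N)%MM.
  case: (boolP (F \in facets D)) => FD; last by exists 0%N.
  have /off_faceP[j jF mj] := hm F FD; have [N hN] := pow F FD j jF.
  by exists N => _; apply: up hN _; apply: mnm_muln_le; rewrite lep1mP.
exists (\sum_F N F)%N => F FD; apply: up (hN F FD) _; apply: mnm_muln_leq.
by rewrite (bigD1 F) //= leq_addr.
Qed.

(** The hypotheses on [Q F] describe the monomials of a P_F-primary ideal: nothing depends on the
    variables of [F], and the radical is P_F. *)
Lemma depth_of_family Q t : (forall F, up_closed (Q F)) ->
  (forall F, invariant_on F (Q F)) ->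
  (forall F, F \in facets D -> forall m, Q F m -> off_face F m) ->
  (forall F, F \in facets D -> forall j, j \notin F -> exists N, Q F (U_(j) *+ N)%MM) ->
  has_depth (@stanley_reisner K n D) t -> facet_bound D t ->
  has_depth (mono (fun m => forall F, F \in facets D -> Q F m) : S -> Prop) t.
Proof.
move=> up inv sub pow ht hf; apply: depth_of_radical => //.
- by move=> m m' h le F FD; apply: up (h F FD) le.
- exact: radical_family.
- by apply: vanish_of_facet_bound => //; apply: variable_coord.
Qed.

Definition big_power F (a : 'I_n -> nat) m : Prop := exists2 j, j \notin F & (a j <= m j)%N.

Lemma big_power_up F a : up_closed (big_power F a).
Proof.
by move=> m m' [j jF h] /mnm_lepP/(_ j) le; exists j => //; apply: leq_trans le.
Qed.

Lemma big_power_invariant F a : invariant_on F (big_power F a).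
Proof. by move=> m m' e [j jF h]; exists j; rewrite // -e. Qed.

Lemma irreducible_gen F (a : 'I_n -> nat) :
  ideal_gen (fun f : S => exists2 j : 'I_n, j \notin F & f = 'X_j ^+ a j) =
  mono (big_power F a).
Proof.
rewrite (@ideal_gen_mono _ _ (fun m => exists2 j, j \notin F & m = (U_(j) *+ a j)%MM)).
  apply: mono_eq => m; split=> [[_ [j jF ->]] /mnm_lepP/(_ j)|[j jF h]].
    by rewrite mulmnE mnm1E eqxx mul1n; exists j.
  exists (U_(j) *+ a j)%MM; first by exists j.
  by apply/mnm_lepP => i; rewrite mulmnE mnm1E; case: eqP => [<-|_]; rewrite ?mul1n.
move=> f; split=> [[j jF ->]|[_ [j jF ->] ->]].
  by exists (U_(j) *+ a j)%MM; [exists j | rewrite mpolyXn].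
by exists j; rewrite // mpolyXn.
Qed.

Lemma irreducible_intersection_depth t (J : {set 'I_n} -> S -> Prop) :
  has_depth (@stanley_reisner K n D) t -> facet_bound D t ->
  (forall F, F \in facets D -> irreducible_monomial F (J F)) ->
  has_depth (facet_cap D J) t.
Proof.
move=> ht hf hJ.
have /choice [a ha] F : exists a : 'I_n -> nat, F \in facets D ->
    (forall j, j \notin F -> (0 < a j)%N) /\ J F = mono (big_power F a).
  case: (boolP (F \in facets D)) => [/hJ[a [a0 /same_predP e]]|_]; last by exists (fun=> 0%N).
  by exists a => _; rewrite e irreducible_gen.
rewrite (@facet_cap_mono _ _ _ _ (fun F => big_power F (a F))); last by move=> F /ha[].
apply: depth_of_family => // [F|F|F /ha[a0 _] m [j jF h]|F _ j jF].
- exact: big_power_up.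
- exact: big_power_invariant.
- by apply/off_faceP; exists j; rewrite // -lt0n (leq_trans (a0 j jF)).
- by exists (a F j); exists j => //; rewrite mulmnE mnm1E eqxx mul1n.
Qed.

Definition off_degree F m := (\sum_(j | j \notin F) m j)%N.

Lemma off_degree_up F k : up_closed (fun m => (k <= off_degree F m)%N).
Proof.
move=> m m' h /mnm_lepP le; apply: leq_trans h _; apply: leq_sum => j _.
exact: le.
Qed.

Lemma ideal_exp_face F k :
  ideal_exp (@face_prime K n F) k = mono (fun m => (k <= off_degree F m)%N).
Proof.
apply: same_predP => f; split.
  apply; first exact/mono_is_ideal/off_degree_up.
  move=> _ [s [<- + ->]]; elim: s => [|g s IH] hs.
    by move=> m _.
  rewrite big_cons /= => m; rewrite -mcoeff_msupp.
  move=> /msuppM_le /allpairsP[[m1 m2] /=]; rewrite !mcoeff_msupp => -[h1 h2 ->].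
  rewrite /off_degree; under eq_bigr do rewrite mnmDE.
  rewrite big_split /= -addn1 addnC leq_add //.
    have : mono (off_face F) g by rewrite -face_primeE; apply: hs; rewrite mem_head.
    move=> /(_ m1 h1) /off_faceP[j jF mj].
    by rewrite (bigD1 j) //= addn_gt0 lt0n mj.
  by apply: IH h2 => a as_; apply: hs; rewrite inE as_ orbT.
move=> hf; apply: mono_terms; first exact: ideal_gen_is_ideal.
move=> m /hf hm.
suff [s [r [sk sF ->]]] : exists (s : seq S) r,
    [/\ size s = k, forall a, a \in s -> face_prime F a & 'X_[m] = r * \prod_(a <- s) a].
  apply: (idealMr _ (ideal_gen_is_ideal _)); apply: ideal_gen_sub.
  by exists s.
elim: k m hm {hf} => [|k IH] m hm.
  by exists [::], 'X_[m]; split=> //; rewrite big_nil mulr1.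
have [j jF mj] : exists2 j, j \notin F & (0 < m j)%N.
  apply: contrapT => nj; move: hm; rewrite /off_degree big1 // => j jF.
  by apply/eqP; rewrite -leqn0 leqNgt; apply: contra_notN nj => mj; exists j.
have le : (U_(j) <= m)%MM by rewrite lep1mP -lt0n.
have [|s [r [sk sF e]]] := IH (m - U_(j))%MM.
  move: hm; rewrite /off_degree (bigD1 j) //= [X in _ -> (_ <= X)%N](bigD1 j) //=.
  rewrite mnmBE mnm1E eqxx.
  rewrite [X in _ -> (_ <= _ + X)%N](eq_bigr (fun i => m i)); first by lia.
  by move=> i /andP[_ ne]; rewrite mnmBE mnm1E eq_sym (negPf ne) subn0.
exists ('X_j :: s), r; split=> [|a|]; first by rewrite /= sk.
  rewrite inE => /orP[/eqP->|/sF//].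
  by rewrite face_primeE; apply/mono_X/off_faceP; exists j; rewrite // mnm1E eqxx.
by rewrite big_cons mulrCA -e -mpolyXD addmC submK.
Qed.

Lemma power_intersectionE (k : {set 'I_n} -> nat) :
  facet_cap D (fun F => ideal_exp (@face_prime K n F) (k F)) =
  mono (fun m => forall F, F \in facets D -> (k F <= off_degree F m)%N).
Proof. by rewrite (facet_cap_mono (fun F _ => ideal_exp_face F (k F))). Qed.

Lemma power_intersection_depth t (k : {set 'I_n} -> nat) :
  has_depth (@stanley_reisner K n D) t -> facet_bound D t ->
  (forall F, F \in facets D -> (0 < k F)%N) ->
  has_depth (facet_cap D (fun F => ideal_exp (@face_prime K n F) (k F))) t.
Proof.
move=> ht hf k0; rewrite power_intersectionE.
apply: (@depth_of_family (fun F m => (k F <= off_degree F m)%N)) => // [F|F|F /k0 kF m h|F _ j jF].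
- exact: off_degree_up.
- move=> m m' e; rewrite /off_degree; under eq_bigr => j jF do rewrite (e j jF).
  by [].
- apply/off_faceP; apply: contrapT => nj; have := leq_trans kF h.
  rewrite /off_degree big1 // => j jF; apply/eqP.
  by rewrite -leqn0 leqNgt lt0n; apply: contra_notN nj => mj; exists j.
- exists (k F); rewrite /off_degree (bigD1 j) //= mulmnE mnm1E eqxx mul1n.
  exact: leq_addr.
Qed.

Lemma minimal_prime_facet I P : subpred_of I (@stanley_reisner K n D) ->
  same_pred (radical I) (@stanley_reisner K n D) ->
  minimal_prime I P <-> exists2 F, F \in facets D & P = mono (off_face F).
Proof.
move=> sub rad; have Isub F : F \in facets D -> subpred_of I (mono (off_face F)).
  by move=> FD f /sub /(_ F FD); rewrite face_primeE.
split=> [[pP IP minP]|[F FD ->]].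
  have [F FD FP] := prime_above_facet cplxD rad pP IP.
  exists F => //; apply: same_predP => f; split; last exact: FP.
  exact: (minP _ (face_prime_prime K F) (Isub F FD) FP f).
split=> [|//|Q pQ IQ QF]; [exact: face_prime_prime|exact: Isub|].
have [F' F'D F'Q] := prime_above_facet cplxD rad pQ IQ.
suff e : F = F' by rewrite -e in F'Q.
apply: (facets_antichain FD F'D); apply/subsetP => i iF; apply: contraT => iF'.
have : mono (off_face F) ('X_i : S).
  by apply/QF/F'Q/mono_X/off_faceP; exists i; rewrite // mnm1E eqxx.
move=> /mono_X/off_faceP[j jF]; rewrite mnm1E; case: (i =P j) => // e _.
by rewrite -e iF in jF.
Qed.

End RigidDepth.

(** * Unmixed monomial ideals *)

Section Primary.

Context (K : fieldType) (n : nat).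
Local Notation S := {mpoly K[n]}.
Local Notation mon := 'X_{1..n}.

Lemma mono_split (A B : mon -> Prop) (f : S) : (forall m, A m \/ B m) ->
  exists g h, [/\ mono A g, mono B h & f = g + h].
Proof. by move=> AB; have : mono (fun m => A m \/ B m) f by []; rewrite -mono_sum. Qed.

(* Modulo nilpotents [r] lies in [K[x_F]]; then compare leading monomials. *)
Lemma mono_primary (F : {set 'I_n}) (Q : mon -> Prop) (r x : S) :
  up_closed Q -> invariant_on F Q ->
  (forall j, j \notin F -> exists N, Q (U_(j) *+ N)%MM) ->
  mono Q (r * x) -> ~ mono Q x -> mono (off_face F) r.
Proof.
move=> up inv pow hrx hx; have hQ := mono_is_ideal K up.
have [r1 [r2 [h1 h2 rE]]] : exists r1 r2, [/\ mono (fun m => msupport m \subset F) r1,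
    mono (off_face F) r2 & r = r1 + r2].
  by apply: mono_split => m; case: (boolP (msupport m \subset F)); [left|right].
have [r10|r10] := eqVneq r1 0; first by rewrite rE r10 add0r.
have [k hk] : radical (mono Q) r2.
  apply: mono_terms; first exact: radical_is_ideal.
  move=> m /h2 /off_faceP[j jF mj]; apply/mono_radical_X.
  have [N hN] := pow j jF; exists N; apply: up hN _; apply: mnm_muln_le.
  by rewrite lep1mP.
have [x1 [x2 [hx1 hx2 xE]]] : exists x1 x2, [/\ mono Q x1, mono (fun m => ~ Q m) x2 & x = x1 + x2].
  by apply: mono_split => m; case: (pselect (Q m)); [left|right].
have [x20|x20] := eqVneq x2 0; first by case: hx; rewrite xE x20 addr0.
(* Since r = r1 - (-r2), r1^k - (-r2)^k is a multiple of [r]; so r1^k x is a multiple of r x up to a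
   multiple of r2^k, and both lie in [mono Q]. *)
have r1x : mono Q (r1 ^+ k * x).
  have -> : r1 ^+ k * x = (\sum_(i < k) r1 ^+ (k.-1 - i) * (- r2) ^+ i) * (r * x) +
      ((-1) ^+ k * x) * r2 ^+ k.
    have := subrXX r1 (- r2) k; rewrite opprK -rE => e.
    rewrite -(subrK ((- r2) ^+ k) (r1 ^+ k)) e (exprNn r2 k); ring.
  by apply: (idealD hQ); apply: (idealMr _ hQ).
have r1x2 : mono Q (r1 ^+ k * x2).
  have -> : r1 ^+ k * x2 = r1 ^+ k * x - r1 ^+ k * x1 by rewrite xE; ring.
  by apply: (idealB hQ) => //; apply: (idealMr _ hQ).
have r1k0 : r1 ^+ k != 0 by rewrite expf_neq0.
have inF : poly_in F (r1 ^+ k).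
  apply: poly_in_exp => m /h1 /subsetP sub j jF; apply/eqP.
  by apply: contraNT jF => mj; apply: sub; rewrite mem_msupport.
have nzl : (r1 ^+ k)@_(mlead (r1 ^+ k)) != 0 by rewrite mleadc_eq0.
have := r1x2 (mlead (r1 ^+ k) + mlead x2)%MM; rewrite mleadcM.
rewrite mulf_neq0 ?mleadc_eq0 // => /(_ isT) h; exfalso.
apply: (hx2 (mlead x2)); first by rewrite mleadc_eq0.
by apply: inv h => j jF; rewrite mnmDE (inF _ nzl) // add0n.
Qed.

End Primary.

Section Unmixed.

Context (K : fieldType) (n : nat) (D : {set {set 'I_n}}).
Hypothesis cplxD : is_complex D.
Local Notation S := {mpoly K[n]}.
Local Notation mon := 'X_{1..n}.
Implicit Types (U : mon -> Prop) (m : mon) (F H s : {set 'I_n}) (I P : S -> Prop).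
Implicit Types (A B G C : {set {set 'I_n}}).

(* The monomials in the contraction to [S] of [mono U] localized at the prime
   of [F]. *)
Definition facet_local U F m : Prop := exists N, U (m + mnm_ind F *+ N)%MM.

Lemma facet_local_up U F : up_closed U -> up_closed (facet_local U F).
Proof.
move=> up m m' [N h] /mnm_lepP le; exists N; apply: up h _.
by apply/mnm_lepP => j; rewrite !mnmDE leq_add2r.
Qed.

Lemma facet_local_invariant U F : up_closed U -> invariant_on F (facet_local U F).
Proof.
(* The total degree of [m] bounds its exponents on [F], so this power of the variables of [F] makes
   up for lowering them. *)
move=> up m m' e [N h]; exists (N + mdeg m)%N; apply: up h _.
apply/mnm_lepP => j; rewrite !mnmDE !mulmnE mnmE.
case: (boolP (j \in F)) => jF; last by rewrite e // !mul0n.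
rewrite !mul1n addnCA addnC leq_add2l mdegE (bigD1 j) //=.
by rewrite addnCA leq_addr.
Qed.

(** If [m] were not in [U], some associated prime would contain the annihilator of its class, and by
    unmixedness this prime is some P_F. But a power of the product of the variables of [F] kills the
    class and is not in P_F. *)
Lemma unmixed_components U m : up_closed U -> unmixed (mono U : S -> Prop) ->
  same_pred (radical (mono U)) (@stanley_reisner K n D) ->
  U m <-> (forall F, F \in facets D -> facet_local U F m).
Proof.
move=> up unm rad; split=> [Um F _|h]; first by exists 0%N; rewrite mulm0n addm0.
apply: contrapT => nUm; have hU := mono_is_ideal K up.
have hJ := annih_is_ideal ('X_[m] : S) hU; set J := annih _ _ in hJ.
have J1 : ~ J 1 by rewrite /J /annih mul1r => /mono_X.
have [g mg _] := max_annih_exists (@mpoly_noetherian K n) hJ J1.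
have pP := max_annih_prime hJ mg.
have /unm : associated_prime (mono U) (annih J g).
  by split=> //; exists (g * 'X_[m]) => r; rewrite /annih /J /annih mulrA.
have sub : subpred_of (mono U) (@stanley_reisner K n D).
  by move=> f hf; apply/rad; exists 1%N; rewrite expr1.
move=> /(minimal_prime_facet cplxD _ sub rad)[F FD e].
have [N hN] := h F FD.
have : annih J g 'X_[mnm_ind F *+ N].
  rewrite /annih /J /annih mulrAC -mpolyXD addmC.
  by apply: (idealMl _ hU); apply/mono_X.
rewrite e => /mono_X; rewrite /off_face => /negP; apply.
apply/subsetP => j; rewrite mem_msupport mulmnE mnmE.
by case: (j \in F).
Qed.

Lemma rigid_of_facet_bound t : has_depth (@stanley_reisner K n D) t ->
  facet_bound D t -> rigid_depth K D.
Proof.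
move=> ht hf I [A /same_predP IE] unm rad; exists t => //.
have := @ideal_gen_mono K n A _ (fun _ => iff_refl _); rewrite -IE => {}IE.
set U := fun m => _ in IE.
have up : up_closed U.
  by move=> m m' [a Aa le] le'; exists a => //; apply: lepm_trans le le'.
rewrite IE in unm rad *; apply: (depth_of_radical cplxD) => //.
suff : depth_geq K (fun m => forall F, F \in facets D -> facet_local U F m) t.
  by apply: depth_geq_eq => m; apply: iff_sym; apply: unmixed_components.
apply: vanish_of_facet_bound => // [j|F|F].
- exact: variable_coord.
- exact: facet_local_up.
- exact: facet_local_invariant.
Qed.

Section DoubledFacets.

Context (G : {set {set 'I_n}}).
Hypothesis subG : facet_subcomplex D G.

(* The ideal [mono doubled_mnm] is the intersection of the [(x_j | j \notin F)] for
   the facets [F] of [D] outside [G] and of the [(x_j ^ 2 | j \notin F)] for the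
   facets [F] of [G]. Up to radical, its colon by [x_1 * ... * x_n] is the
   Stanley-Reisner ideal of [G]. *)
Definition doubled F (j : 'I_n) : nat := if F \in facets G then 2 else 1.

Definition doubled_mnm m : Prop :=
  forall F, F \in facets D -> big_power F (doubled F) m.

Lemma doubled_up : up_closed doubled_mnm.
Proof. by move=> m m' h le F FD; apply: big_power_up (h F FD) le. Qed.

Lemma doubled_gt0 F j : (0 < doubled F j)%N.
Proof. by rewrite /doubled; case: ifP. Qed.

Lemma doubled_le2 F j : (doubled F j <= 2)%N.
Proof. by rewrite /doubled; case: ifP. Qed.

(** The component of a facet outside [G] has to contain x_1...x_n, which requires a variable outside
    [F]. *)
Lemma facet_outside F : F \in facets D -> F \notin facets G -> exists j, j \notin F.
Proof.
move=> FD FG; have [cG _ /subsetP GD] := subG; apply: contrapT => none.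
have [F' F'G] := complex_facet cG.
suff e : F' = F by rewrite -e F'G in FG.
apply: (facets_antichain (GD _ F'G) FD); apply/subsetP => j _.
by apply: contraT => jF; case: none; exists j.
Qed.

(** The components outside [G] impose no condition after the dilation at x_1...x_n; the others
    become the face primes of the facets of [G]. *)
Lemma ones_dilation (Q : {set 'I_n} -> mon -> Prop) (N : nat) m :
  (forall F, F \in facets D -> F \notin facets G ->
    Q F (mnm_ind setT + m *+ N)%MM) ->
  (forall F, F \in facets G -> Q F (mnm_ind setT + m *+ N)%MM <-> off_face F m) ->
  (forall F, F \in facets D -> Q F (mnm_ind setT + m *+ N)%MM) <-> off_complex G m.
Proof.
move=> hout hin; have [cG _ /subsetP GD] := subG; rewrite off_complexE //.
split=> h F FF; first by apply/hin => //; apply/h/GD.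
case: (boolP (F \in facets G)) => FG; last exact: hout.
by apply/hin => //; apply: h.
Qed.

Lemma subcomplex_depth_of_ones U (N : nat) t : up_closed U -> (1 < N)%N ->
  (forall m, U (mnm_ind setT + m *+ N)%MM <-> off_complex G m) ->
  has_depth (mono U : S -> Prop) t ->
  exists2 d : nat, has_depth (@stanley_reisner K n G) d & (t <= d)%N.
Proof.
move=> up N1 hU; have [cG _ _] := subG.
have U0 : ~ U 0%MM.
  move=> u0; apply: (off_complex_proper cG); apply/hU.
  by apply: up u0 _; apply/mnm_lepP => j; rewrite mnm0E.
move=> /(has_depthP _ _ up U0)[Ut _]; apply: has_depth_complex_geq => //.
have N0 : (0 < N)%N by apply: ltnW.
have cN j : ((mnm_ind setT : mon) j < N)%N by rewrite mnmE inE.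
by apply: depth_geq_eq (depth_geq_dilate up N0 cN Ut).
Qed.

Lemma doubled_ones m : doubled_mnm (mnm_ind setT + m *+ 2)%MM <-> off_complex G m.
Proof.
apply: (ones_dilation (Q := fun F => big_power F (doubled F))) => F FF.
  move=> nG; have [j jF] := facet_outside FF nG; exists j => //.
  by rewrite /doubled (negPf nG) mnmDE mnmE inE.
split=> [[j jF]|/off_faceP[j jF mj]].
  rewrite /doubled FF mnmDE mnmE inE mulmnE => h; apply/off_faceP; exists j => //.
  by rewrite -lt0n; lia.
exists j => //; rewrite /doubled FF mnmDE mnmE inE mulmnE /=.
by move: mj; rewrite -lt0n; lia.
Qed.

Lemma doubled_radical :
  same_pred (radical (mono doubled_mnm)) (@stanley_reisner K n D).
Proof.
apply: (radical_family cplxD (Q := fun F => big_power F (doubled F))).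
- by move=> F; apply: big_power_up.
- move=> F FD m [j jF h]; apply/off_faceP; exists j => //.
  by rewrite -lt0n (leq_trans (doubled_gt0 F j)).
- move=> F FD j jF; exists 2; exists j => //.
  by rewrite mulmnE mnm1E eqxx mul1n doubled_le2.
Qed.

Lemma doubled_unmixed : unmixed (mono doubled_mnm : S -> Prop).
Proof.
have up := doubled_up; set I := mono _; have hI : is_ideal I by apply: mono_is_ideal.
have sub : subpred_of I (@stanley_reisner K n D).
  by move=> f hf; apply/doubled_radical; exists 1%N; rewrite expr1.
have IE f : I f <-> forall F, F \in facets D -> mono (big_power F (doubled F)) f.
  by split=> h; [move=> F FD m /h; apply | move=> m fm F FD; apply: h fm].
have bp_id F : is_ideal (mono (big_power F (doubled F)) : S -> Prop).
  by apply/mono_is_ideal/big_power_up.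
move=> P; rewrite (minimal_prime_facet cplxD _ sub doubled_radical); split.
  move=> [pP [x Px]]; have [hP P1 hPP] := pP.
  (* [P] is the intersection of the colons of the components by [x]; being prime, it contains one of
     them. *)
  have [F FD FP] : exists2 F, F \in facets D &
      forall r, mono (big_power F (doubled F)) (r * x) -> P r.
    apply: contrapT => none.
    have /choice [r hr] F : exists r : S, F \in facets D ->
        mono (big_power F (doubled F)) (r * x) /\ ~ P r.
      case: (boolP (F \in facets D)) => FD; last by exists 0.
      apply: contrapT => nr; apply: none; exists F => // r hr.
      by apply: contrapT => Pr; apply: nr; exists r.
    have : P (\prod_(F <- enum (facets D)) r F).
      apply/Px/IE => F FD; rewrite (big_rem F) ?mem_enum //= mulrAC.
      by apply: (idealMl _ (bp_id F)); case: (hr F FD).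
    by move=> /(prime_prod pP)[F]; rewrite mem_enum => FD; case: (hr F FD).
  exists F => //; apply: same_predP => r; split=> [/Px /IE /(_ F FD) h|].
    apply: (mono_primary (big_power_up (a := doubled F)) _ _ h).
    - exact: big_power_invariant.
    - move=> j jF; exists 2; exists j => //.
      by rewrite mulmnE mnm1E eqxx mul1n doubled_le2.
    - by move=> hx; apply/P1/FP; rewrite mul1r.
  rewrite -face_primeE; apply=> // _ [j jF ->].
  have : P ('X_j ^+ 2).
    apply: FP; apply: (idealMl _ (bp_id F)); rewrite mpolyXn; apply/mono_X.
    by exists j; rewrite // mulmnE mnm1E eqxx mul1n doubled_le2.
  by rewrite expr2 => /hPP[].
move=> [F FD ->]; split; first exact: face_prime_prime.
(* Outside [F], this is the largest monomial not in the component of [F]. Exponent 2 on [F] puts it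
   into every other component, since no other facet contains [F]. *)
pose w : mon := [multinom if j \in F then 2 else (doubled F j).-1 | j < n].
exists 'X_[w] => r; split.
  move=> hr; suff : annih I 'X_[w] r by [].
  apply: mono_terms; first exact: annih_is_ideal.
  move=> m /hr /off_faceP[j jF mj]; rewrite /annih -mpolyXD; apply/mono_X => F' F'D.
  have [->|ne] := eqVneq F' F.
    exists j => //; rewrite mnmDE mnmE (negPf jF).
    by move: mj (doubled_gt0 F j); rewrite -lt0n; lia.
  have [i iF iF'] : exists2 i, i \in F & i \notin F'.
    apply/subsetPn; apply: contraNN ne => FF'.
    by rewrite (facets_antichain FD F'D FF').
  exists i => //; rewrite mnmDE mnmE iF.
  by apply: leq_trans (doubled_le2 _ _) _; rewrite leq_addl.
move=> /IE /(_ F FD) h m rm; have [|j jF] := h (w + m)%MM; first by rewrite mcoeffMX.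
rewrite mnmDE mnmE (negPf jF) => le; apply/off_faceP; exists j => //.
by move: le (doubled_gt0 F j); rewrite -lt0n; lia.
Qed.

Lemma subcomplex_depth_of_rigid t : has_depth (@stanley_reisner K n D) t ->
  rigid_depth K D ->
  exists2 d : nat, has_depth (@stanley_reisner K n G) d & (t <= d)%N.
Proof.
move=> [ht htmax] rigid.
have [||d hd [hd' dmax]] := rigid (mono doubled_mnm) _ doubled_unmixed.
- by exists doubled_mnm; rewrite mono_gen //; exact: doubled_up.
- exact: doubled_radical.
have e : d = t by apply/eqP; rewrite eqn_leq htmax // dmax.
rewrite e in hd; apply: (subcomplex_depth_of_ones doubled_up (N := 2)) hd => //.
exact: doubled_ones.
Qed.

Lemma subcomplex_depth_of_irreducible t :
  (forall J : {set 'I_n} -> S -> Prop,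
    (forall F, F \in facets D -> irreducible_monomial F (J F)) ->
    has_depth (facet_cap D J) t) ->
  exists2 d : nat, has_depth (@stanley_reisner K n G) d & (t <= d)%N.
Proof.
move=> h; have := h (fun F => ideal_gen (fun f : S =>
    exists2 j : 'I_n, j \notin F & f = 'X_j ^+ doubled F j)).
rewrite (facet_cap_mono (fun F _ => irreducible_gen _ F (doubled F))) => h'.
apply: (subcomplex_depth_of_ones doubled_up (N := 2)) (h' _) => //.
  exact: doubled_ones.
by move=> F FD; exists (doubled F); split=> // j _; apply: doubled_gt0.
Qed.

Lemma subcomplex_depth_of_powers t :
  (forall k : {set 'I_n} -> nat, (forall F, F \in facets D -> (0 < k F)%N) ->
    has_depth (facet_cap D (fun F => ideal_exp (@face_prime K n F) (k F))) t) ->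
  exists2 d : nat, has_depth (@stanley_reisner K n G) d & (t <= d)%N.
Proof.
(* The degree of x_1...x_n in the variables outside any [F] is at most n, so n + 1 is just out of
   reach. *)
pose k F := if F \in facets G then n.+1 else 1%N.
move=> /(_ k); rewrite power_intersectionE => h.
(* With this dilation a single variable outside [F] lifts the degree above n + 1 at once. *)
apply: (subcomplex_depth_of_ones _ (N := n.+2)) (h _) => //.
- by move=> m m' hm le F FD; apply: off_degree_up (hm F FD) le.
- move=> m; apply: (ones_dilation (Q := fun F m => (k F <= off_degree F m)%N)) => F FF.
    move=> nG; have [j jF] := facet_outside FF nG.
    by rewrite /k (negPf nG) /off_degree (bigD1 j) //= mnmDE mnmE inE.
  rewrite /k FF; split=> [le|/off_faceP[j jF mj]]; last first.
    rewrite /off_degree (bigD1 j) //= mnmDE mnmE inE mulmnE.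
    by apply: leq_trans (leq_addr _ _); move: mj; rewrite -lt0n; nia.
  apply/off_faceP; apply: contrapT => nj; move: le; rewrite leqNgt => /negP; apply.
  rewrite /off_degree ltnS (eq_bigr (fun=> 1%N)) => [|j jF].
    by rewrite sum1_card; apply: leq_trans (max_card _) _; rewrite card_ord.
  rewrite mnmDE mnmE inE mulmnE; suff -> : m j = 0%N by [].
  by apply/eqP; apply: contra_notT nj => mj; exists j.
- by move=> F _; rewrite /k; case: ifP.
Qed.

End DoubledFacets.

Lemma facet_bound_of_depth t :
  (forall G, facet_subcomplex D G ->
    exists2 d : nat, has_depth (@stanley_reisner K n G) d & (t <= d)%N) ->
  facet_bound D t.
Proof.
move=> h; apply: (facet_bound_of_subcomplexes (K := K) cplxD) => A AD A0.
have subA := gen_complex_sub cplxD AD A0; have [cA _ _] := subA.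
have [d /(has_depth_complex _ _ cA)[Vd _] td] := h _ subA.
exact: depth_geq_leq (off_complex_up cA) td Vd.
Qed.

(** At the graded maximal ideal, depth equals dimension, and the dimension is at least [t] because
    each facet has at least [t] elements. So the skeletons have depth at least [t]. *)
Lemma facet_bound_of_cohen_macaulay t : has_depth (@stanley_reisner K n D) t ->
  (forall G, facet_subcomplex D G -> cohen_macaulay K (skeleton G (t%:Z - 1))) ->
  facet_bound D t.
Proof.
move=> /(has_depth_complex _ _ cplxD)[Vt _] h.
apply: (facet_bound_of_skeletons (K := K) cplxD) => A AD A0.
have subA := gen_complex_sub cplxD AD A0; have [cA _ _] := subA.
have cS := skeleton_complex t cA; set Sk := skeleton _ _ in cS *.
have maxM := graded_max_maximal K n; have upS := off_complex_up cS.
have hI := mono_is_ideal K upS.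
have IM : subpred_of (stanley_reisner Sk) (@graded_max K n).
  rewrite stanley_reisnerE //; apply: mono_sub_graded_max.
  exact: off_complex_proper.
have [d] := h _ subA (@graded_max K n) maxM IM.
rewrite stanley_reisnerE // in IM *.
move=> [[s [sd sM /(regular_forP (loc_ideal _) s hI)[rs _]]] _] [_ dimmax].
have Vd : depth_geq K (off_complex Sk) d.
  rewrite -sd; apply: koszul_vanish_loc_reg_seq rs sM => //.
  by rewrite graded_maxE.
apply: (depth_geq_leq upS _ Vd); apply: dimmax.
have [F FA] : exists F, F \in A by apply/set0Pn.
have FD := subsetP AD F FA.
have tF := depth_geq_complex_facet cplxD FD Vt.
have [H HF Ht] : exists2 H : {set 'I_n}, H \subset F & #|H| = t.
  exists [set x in take t (enum F)].
    by apply/subsetP => x; rewrite inE => /mem_take; rewrite mem_enum.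
  by rewrite cardsE (card_uniqP _) ?take_uniq ?enum_uniq // size_takel // -cardE.
have hH : is_ideal (mono (off_face H) : S -> Prop) by apply/mono_is_ideal/off_face_up.
(* A chain of primes of length [t] above the face prime of [H] is extracted from a regular sequence
   of that length. *)
have VH : depth_geq K (off_face H) t.
  rewrite -Ht; apply: vanish_invariant; [|exact: off_face_up|exact: off_face_invariant].
  exact: variable_coord.
have /depth_geqP := VH => /(_ (off_face_up (F := H))) [s' [<- s'M rs']].
have HM : subpred_of (mono (off_face H)) (@graded_max K n).
  by apply: mono_sub_graded_max => /off_faceP[j _]; rewrite mnm0E.
have [p [pp Hp pM ch]] := reg_seq_prime_chain (@mpoly_noetherian K n) maxM hH
  (reg_seq_loc _ rs') HM s'M.
exists p; split=> // f hf; apply: Hp; apply: mono_sub hf => m.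
rewrite /off_complex /off_face; apply: contraNN => mH.
have mF := subset_trans mH HF.
rewrite inE /face_dim Num.Theory.lerD2r lez_nat -Ht subset_leq_card // andbT.
by apply/gen_complexP; exists F.
Qed.

End Unmixed.

Theorem theorem2p3 (K : fieldType) (n : nat) (D : {set {set 'I_n}}) (t : nat)
    (hD : is_complex D) (hpure : pure D)
    (ht : has_depth (@stanley_reisner K n D) t) :
  [<-> (* (a) *) rigid_depth K D;
       (* (b) *) forall J : {set 'I_n} -> {mpoly K[n]} -> Prop,
         (forall F, F \in facets D -> irreducible_monomial F (J F)) ->
         has_depth (facet_cap D J) t;
       (* (c) *) forall m : {set 'I_n} -> nat,
         (forall F, F \in facets D -> (0 < m F)%N) ->
         has_depth (facet_cap D (fun F => ideal_exp (@face_prime K n F) (m F))) t;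
       (* (d) *) forall G : {set {set 'I_n}}, facet_subcomplex D G ->
         exists2 d : nat, has_depth (@stanley_reisner K n G) d & (t <= d)%N;
       (* (e) *) forall G : {set {set 'I_n}}, facet_subcomplex D G ->
         cohen_macaulay K (skeleton G (t%:Z - 1));
       (* (f) *) forall k : nat, (1 <= k <= minn #|facets D| t)%N ->
         forall A : {set {set 'I_n}}, A \subset facets D -> #|A| = k ->
         (t - k + 1 <= #|\bigcap_(F in A) F|)%N].
Proof.
tfae.
(* The first two implications go through (d) and (f), from which the intersection of primary
   components is handled uniformly. *)
- move=> a; have f := facet_bound_of_depth hD
    (fun G sG => subcomplex_depth_of_rigid hD sG ht a).
  by move=> J hJ; apply: irreducible_intersection_depth.
- move=> b; have f := facet_bound_of_depth hD
    (fun G sG => subcomplex_depth_of_irreducible sG b).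
  by move=> k hk; apply: power_intersection_depth.
- by move=> c G sG; exact: (subcomplex_depth_of_powers sG c).
- by move=> /(facet_bound_of_depth hD) f G sG; exact: (skeleton_cohen_macaulay f sG).
- by move=> e; exact: (facet_bound_of_cohen_macaulay hD ht e).
- by move=> f; exact: (rigid_of_facet_bound hD ht f).
Qed.
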